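(* Let $n\ge 2$, $m\in\mathbb{C}$ with $\Re m>0$, $\lambda\in\mathbb{C}^n$, and let $X\in\mathfrak{a}_n$ be a real diagonal $n\times n$ matrix. Let $a_1>\dots>a_r$ be the distinct diagonal entries of $X$, with multiplicities $n_1,\dots,n_r$, so that $\pi(X)=\mathrm{diag}[a_1,\dots,a_1,a_2,\dots,a_2,\dots,a_r,\dots,a_r]$, and let $N_0=0$, $N_k=n_1+\dots+n_k$. Then $$\chi_\lambda^{(m)}(e^X)=\frac{\Gamma(mn/2)}{\prod_{i=1}^r\Gamma(m n_i/2)}\,e^{i\lambda_n\sum_{k=1}^r n_k a_k}\int_{\sigma_r}\chi^{(m)}_{\lambda_0}(e^{\xi})\,\prod_{i=1}^r\gamma_i^{m n_i/2-1}\,d\gamma ,$$ where, for $\gamma\in\sigma_r$, $\xi=\mathrm{diag}[\xi_1,\dots,\xi_{n-1}]$ (with $\xi_1\ge\dots\ge\xi_{n-1}$) is such that the $e^{2\xi_i}$ are the roots (with multiplicity) of $$q(x)=\prod_{j=1}^r(x-e^{2a_j})^{n_j-1}\;\sum_{i=1}^r\gamma_i\prod_{j\ne i}(x-e^{2a_j}).$$ More precisely, $$\xi=\mathrm{diag}[\overbrace{a_1,\dots,a_1}^{n_1-1},\eta_1,\overbrace{a_2,\dots,a_2}^{n_2-1},\eta_2,\dots,\overbrace{a_{r-1},\dots,a_{r-1}}^{n_{r-1}-1},\eta_{r-1},\overbrace{a_r,\dots,a_r}^{n_r-1}]\in E(\pi(X)),$$ i.e. $\xi_k=a_i$ whenever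 $N_{i-1}<k<N_i$ and $\xi_{N_i}=\eta_i\in[a_{i+1},a_i]$ for $1\le i\le r-1$, where $e^{2\eta_1},\dots,e^{2\eta_{r-1}}$ are the roots of $q_1(x)=\sum_{i=1}^r\gamma_i\prod_{j\ne i}(x-e^{2a_j})$. Equivalently, $$\gamma_p=\frac{\prod_{j=1}^{r-1}(e^{2\eta_j}-e^{2a_p})}{\prod_{j\ne p}(e^{2a_j}-e^{2a_p})},\qquad p=1,\dots,r.$$
   Context: $\mathfrak{a}_n$ is the space of real diagonal $n\times n$ matrices $X=\mathrm{diag}[x_1,\dots,x_n]$, with $S_n$ acting by permuting diagonal entries; $\mathfrak{a}_n^+$ is the subset with strictly decreasing diagonal entries and $\overline{\mathfrak{a}_n^+}$ its closure. $\pi(X)$ is the unique element of $(S_n\cdot X)\cap\overline{\mathfrak{a}_n^+}$. For $X\in\overline{\mathfrak{a}_n^+}$, $E(X)=\{\xi=(\xi_1,\dots,\xi_{n-1}): x_{k+1}\le\xi_k\le x_k\}$ (identified with diagonal matrices in $\mathfrak{a}_{n-1}$). $\sigma_r=\{(\gamma_1,\dots,\gamma_r)\in\mathbb{R}^r:\gamma_k\ge0,\ \sum_k\gamma_k=1\}$, and $d\gamma=d\gamma_1\cdots d\gamma_{r-1}$ (for $r=1$, $\sigma_1=\{1\}$ with unit point mass). $\lambda(X)=\sum_j\lambda_jx_j$ and $\lambda_0=(\lambda_1-\lambda_n,\dots,\lambda_{n-1}-\lambda_n)\in\mathbb{C}^{n-1}$. Generalized spherical function: $\phi_\lambda^{(m)}$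 for the root system $A_{n-1}$ is the unique analytic ($S_n$-invariant) function of $X\in\mathfrak{a}_n$ with $\phi_\lambda^{(m)}(e^0)=1$ and $$D_n(Y;m)\,\phi_\lambda^{(m)}(e^X)=\prod_{k=1}^n\Big(Y+\tfrac{n-1}{2}+\tfrac{i\lambda_k}{m}\Big)\phi_\lambda^{(m)}(e^X),$$ where $Y$ is an indeterminate, $\delta(k)=n-k$, and $$D_n(Y;m)=\prod_{p<q}(e^{2x_p}-e^{2x_q})^{-1}\sum_{\sigma\in S_n}\epsilon(\sigma)\,e^{2\sum_{k}\delta(\sigma(k))x_k}\prod_{s=1}^n\Big(Y+\delta(\sigma(s))+\tfrac1m\tfrac{\partial}{\partial x_s}\Big).$$ With $\rho^{(m)}(X)=\frac m2\sum_{k=1}^n(n+1-2k)x_k$, set $\chi^{(m)}_\lambda=\phi^{(m)}_{\lambda-i\rho^{(m)}}$; $\chi^{(m)}_{\lambda_0}$ is the corresponding function in $n-1$ variables (with the $\rho^{(m)}$ for $n-1$). Equivalently (known description), $\chi_\lambda^{(m)}(e^X)=e^{i\lambda(X)}$ for $n=1$, and for $n\ge2$ and $X\in\mathfrak{a}_n^+$, $$\chi_\lambda^{(m)}(e^X)=\frac{\Gamma(mn/2)}{\Gamma(m/2)^n}e^{i\lambda_n\sum_kx_k}\int_{\sigma_n}\chi^{(m)}_{\lambda_0}(e^\xi)(\beta_1\cdots\beta_n)^{m/2-1}d\beta,$$ where $e^{2\xi_1},\dots,e^{2\xi_{n-1}}$ are the roots of $\sum_{p=1}^n\beta_p\prod_{i\ne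 p}(x-e^{2x_i})$; $\chi^{(m)}_\lambda$ is extended to all of $\mathfrak{a}_n$ continuously and $S_n$-invariantly. *)

(* Defs.v *)
From HB Require Import structures.
From mathcomp Require Import all_boot all_order all_algebra all_fingroup.
From mathcomp Require Import all_classical all_reals all_analysis.
From mathcomp Require Import complex.

Set Implicit Arguments.
Unset Strict Implicit.
Unset Printing Implicit Defensive.

Import Order.TTheory GRing.Theory Num.Theory.
Import numFieldNormedType.Exports.

Local Open Scope classical_set_scope.
Local Open Scope complex_scope.
Local Open Scope ring_scope.

(* A diagonal matrix X = diag[x_1, ..., x_n] is represented by the row vector
   X : 'rV[R]_n of its diagonal entries, and a function of e^X by a function
   of X. All indices are shifted to start at 0: the usual entry x_k is
   X 0 k' with k' = k - 1. *)

Definition cexp (R : realType) (z : R[i]) : R[i] :=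
  (expR (complex.Re z) * cos (complex.Im z))
  +i* (expR (complex.Re z) * sin (complex.Im z)).

(* x ^ w for a real x > 0. Since ln 0 = 0 in the library, the value at x = 0
   is 1; this only matters on null sets below. *)
Definition cpow (R : realType) (x : R) (w : R[i]) : R[i] :=
  cexp (w * (ln x)%:C).

Definition Cintegral (R : realType) (D : set R) (f : R -> R[i]) : R[i] :=
  (\int[@lebesgue_measure R]_(t in D) complex.Re (f t))
  +i* (\int[@lebesgue_measure R]_(t in D) complex.Im (f t)).

Definition Clim (R : realType) (T : Type) (F : set_system T) (f : T -> R[i]) :
    R[i] :=
  lim ((complex.Re (f t)) @[t --> F]) +i* lim ((complex.Im (f t)) @[t --> F]).

(* Euler's integral, only meaningful for Re z > 0. *)
Definition Gamma (R : realType) (z : R[i]) : R[i] :=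
  Cintegral [set t | 0 < t] (fun t => cpow t (z - 1) * (expR (- t))%:C).

Definition simplex (R : realType) (r : nat) : set 'rV[R]_r.+1 :=
  [set g | (forall k, 0 <= g 0 k) /\ \sum_k g 0 k = 1].

(* The integral of f(g) dg_1 ... dg_r over the (r+1)-tuples g of nonnegative
   reals of sum s, as an iterated Lebesgue integral: g_1 ranges over [0, s],
   then (g_2, ..., g_{r+1}) over the tuples of sum s - g_1. The last
   coordinate is determined by the others; for r = 0 this is a unit point
   mass at g_1 = s. *)
Fixpoint scaled_simplex_integral (R : realType) (r : nat) (s : R) :
    ('rV[R]_r.+1 -> R[i]) -> R[i] :=
  match r with
  | 0 => fun f => f (const_mx s)
  | r'.+1 => fun f => Cintegral `[0, s] (fun t =>
      @scaled_simplex_integral R r' (s - t)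
        (fun g => f (row_mx (const_mx t : 'rV[R]_1) g)))
  end.

Definition simplex_integral (R : realType) (r : nat)
    (f : 'rV[R]_r.+1 -> R[i]) : R[i] :=
  scaled_simplex_integral 1 f.

(* The open Weyl chamber and its closure. *)
Definition chamber (R : realType) (n : nat) : set 'rV[R]_n :=
  [set X | forall i j : 'I_n, (i < j)%N -> X 0 j < X 0 i].

Definition closed_chamber (R : realType) (n : nat) : set 'rV[R]_n :=
  [set X | forall i j : 'I_n, (i < j)%N -> X 0 j <= X 0 i].

Definition chamber_proj (R : realType) (n : nat) (X : 'rV[R]_n) : 'rV[R]_n :=
  xget 0 [set Y | closed_chamber Y /\ exists s : 'S_n, Y = col_perm s X].

(* The set E(X) of vectors interlacing X. *)
Definition interlacing (R : realType) (n : nat) (X : 'rV[R]_n.+1) :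
    set 'rV[R]_n :=
  [set xi | forall k : 'I_n,
     X 0 (lift ord0 k) <= xi 0 k <= X 0 (widen_ord (leqnSn n) k)].

(* z_0, ..., z_{n-1} are the roots of p, listed with multiplicity. *)
Definition roots_are (R : realType) (n : nat) (p : {poly R}) (z : 'I_n -> R) :
    Prop :=
  p != 0 /\ p = lead_coef p *: \prod_(k < n) ('X - (z k)%:P).

Definition exp2_roots_are (R : realType) (n : nat) (p : {poly R})
    (xi : 'rV[R]_n) : Prop :=
  roots_are p (fun k => expR (2 * xi 0 k)).

(* The nonincreasing xi such that the e^(2 xi_k) are the roots of p. *)
Definition log_roots (R : realType) (n : nat) (p : {poly R}) : 'rV[R]_n :=
  xget 0 [set xi | closed_chamber xi /\ exp2_roots_are p xi].

Definition mix_poly (R : realType) (r : nat) (a g : 'rV[R]_r) : {poly R} :=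
  \sum_(p < r) g 0 p *: \prod_(j < r | j != p) ('X - (expR (2 * a 0 j))%:P).

Definition mult_poly (R : realType) (r : nat) (a : 'rV[R]_r)
    (nn : 'I_r -> nat) (g : 'rV[R]_r) : {poly R} :=
  \prod_(j < r) ('X - (expR (2 * a 0 j))%:P) ^+ (nn j).-1 * mix_poly a g.

Definition pairing (R : realType) (n : nat) (lambda : 'rV[R[i]]_n)
    (X : 'rV[R]_n) : R[i] :=
  \sum_j lambda 0 j * (X 0 j)%:C.

Definition lambda0 (R : realType) (n : nat) (lambda : 'rV[R[i]]_n.+1) :
    'rV[R[i]]_n :=
  \row_(j < n) (lambda 0 (widen_ord (leqnSn n) j) - lambda 0 ord_max).

(* The right-hand side of the recursive description of chi in n+1 variables,
   for X in the open chamber; f is chi in n variables with parameter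
   lambda0. *)
Definition chi_step (R : realType) (m : R[i]) (n : nat)
    (lambda : 'rV[R[i]]_n.+1) (f : 'rV[R]_n -> R[i]) (X : 'rV[R]_n.+1) :
    R[i] :=
  Gamma (m * n.+1%:R / 2%:R) / Gamma (m / 2%:R) ^+ n.+1
  * cexp ('i%C * lambda 0 ord_max * (\sum_k X 0 k)%:C)
  * simplex_integral (fun b : 'rV[R]_n.+1 =>
      f (log_roots n (mix_poly X b))
      * cpow (\prod_k b 0 k) (m / 2%:R - 1)).

(* The continuous and S_n-invariant extension of a function on the open
   chamber. *)
Definition chamber_ext (R : realType) (n : nat) (f : 'rV[R]_n -> R[i])
    (X : 'rV[R]_n) : R[i] :=
  let Y := chamber_proj X in
  if `[< chamber Y >] then f Y else Clim (within (@chamber R n) (nbhs Y)) f.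

(* chi^(m)_lambda(e^X), the generalized spherical function of type A_{n-1}
   with shifted parameter lambda - i rho^(m), given by its integral recursion
   on n. It is characterised, up to this shift, as the S_n-invariant analytic
   joint eigenfunction of the operators D_n(Y; m) normalised at X = 0. The
   value for n = 0 is a dummy. *)
Fixpoint chi (R : realType) (m : R[i]) (n : nat) :
    'rV[R[i]]_n -> 'rV[R]_n -> R[i] :=
  match n with
  | 0 => fun _ _ => 1
  | n'.+1 => fun lambda X =>
      if n' is 0 then cexp ('i%C * pairing lambda X)
      else chamber_ext (chi_step m lambda (@chi R m n' (lambda0 lambda))) X
  end.

(* N_i = n_1 + ... + n_i *)
Definition partial_sum (r : nat) (nn : 'I_r -> nat) (i : nat) : nat :=
  \sum_(j < r | (j < i)%N) nn j.

(* Main.v *)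
(* By induction on n, chi is given on the closed chamber by the same integral
   formula as on the open one, with exponents m/2: the sorted roots of a monic
   polynomial depend continuously on its coefficients, so the integrand is
   jointly continuous and the Dirichlet integral is continuous in X. When
   entries of X coincide, the root vector depends on the weights beta only
   through their sums gamma_i over the blocks of equal entries. Integrating
   out the remaining weights merges the exponents m/2 into m n_i/2 and the
   factors Gamma(m/2)^(n_i) into Gamma(m n_i/2) (aggregation of Dirichlet
   laws, which reduces to the Beta integral for two coordinates); Gamma has no
   zeros in the right half-plane, so one may divide. *)
Require Import Defs.
From mathcomp Require Import all_boot all_order all_algebra all_fingroup.
From mathcomp Require Import all_classical all_reals all_analysis.
From mathcomp Require Import measurable_realfun complex ring lra polyrcf.

Set Implicit Arguments.
Unset Strict Implicit.
Unset Printing Implicit Defensive.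

Import Order.TTheory GRing.Theory Num.Theory.
Import numFieldNormedType.Exports.

Local Open Scope classical_set_scope.
Local Open Scope complex_scope.
Local Open Scope ring_scope.

(** * Complex powers *)

(** On a wall [chi] is a limit from the open chamber, and there the defining integral is awkward:
    the roots collide and the root map only makes sense for sorted nodes and weights in the simplex.
    Two devices remove these side conditions. Precomposition with [chamber_proj] and
    [simplex_retract] makes the root map continuous on a whole vector space without changing it
    where it is integrated. [dirichlet] puts the integral in stick-breaking coordinates, so that
    every integration runs over the fixed interval []0, 1[] against an integrable weight independent
    of [X]; continuity in [X] is then a uniform estimate on the other factor. One Fubini argument,
    [beta_convolution], gives both the relation between Beta and Gamma and the merging of two
    Dirichlet coordinates. The nonvanishing of Gamma, needed at complex arguments, is the other
    delicate point: where the real part is large against the square of the imaginary part, the Gamma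
    integral times a constant phase has positive real part, and the functional equation carries this
    to the whole half-plane. *)

Section ComplexPower.
Variable R : realType.
Implicit Types (z w : R[i]) (s t : R).
Local Notation Re := (@complex.Re R).
Local Notation Im := (@complex.Im R).

Lemma cReD z w : Re (z + w) = Re z + Re w.
Proof. by case: z w => [a b] [c d]. Qed.
Lemma cImD z w : Im (z + w) = Im z + Im w.
Proof. by case: z w => [a b] [c d]. Qed.
Lemma cReN z : Re (- z) = - Re z.
Proof. by case: z. Qed.
Lemma cImN z : Im (- z) = - Im z.
Proof. by case: z. Qed.
Lemma cReM z w : Re (z * w) = Re z * Re w - Im z * Im w.
Proof. by case: z w => [a b] [c d]. Qed.
Lemma cImM z w : Im (z * w) = Re z * Im w + Im z * Re w.
Proof. by case: z w => [a b] [c d]. Qed.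
Lemma complex_ext z w : Re z = Re w -> Im z = Im w -> z = w.
Proof. by case: z w => [a b] [c d] /= -> ->. Qed.
Lemma cRe_sum I (r : seq I) (P : pred I) (F : I -> R[i]) :
  Re (\sum_(i <- r | P i) F i) = \sum_(i <- r | P i) Re (F i).
Proof. by elim/big_ind2 : _ => // z x w y <- <-; rewrite cReD. Qed.

Lemma cexpD z w : cexp (z + w) = cexp z * cexp w.
Proof.
apply: complex_ext; rewrite ?(cReM, cImM)/= cReD cImD ?expRD ?cosD ?sinD; ring.
Qed.

Lemma cexp0 : cexp (0 : R[i]) = 1.
Proof. by apply: complex_ext; rewrite /= expR0 ?cos0 ?sin0; ring. Qed.

Lemma cexp_real t : cexp t%:C = (expR t)%:C.
Proof. by apply: complex_ext; rewrite /= ?cos0 ?sin0; ring. Qed.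

Lemma norm_Re_cexp z : `|Re (cexp z)| <= expR (Re z).
Proof.
rewrite /= normrM gtr0_norm ?expR_gt0// ler_piMr ?expR_ge0//.
by rewrite ler_norml cos_geN1 cos_le1.
Qed.

Lemma norm_Im_cexp z : `|Im (cexp z)| <= expR (Re z).
Proof.
rewrite /= normrM gtr0_norm ?expR_gt0// ler_piMr ?expR_ge0//.
by rewrite ler_norml sin_geN1 sin_le1.
Qed.

Lemma cpowD t z w : cpow t (z + w) = cpow t z * cpow t w.
Proof. by rewrite /cpow mulrDl cexpD. Qed.

Lemma cpow0 t : cpow t (0 : R[i]) = 1.
Proof. by rewrite /cpow mul0r cexp0. Qed.

Lemma cpow_1 z : cpow 1 z = 1.
Proof. by rewrite /cpow ln1 mulr0 cexp0. Qed.

Lemma cpowr1 t : 0 < t -> cpow t (1 : R[i]) = t%:C.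
Proof. by move=> t0; rewrite /cpow mul1r cexp_real lnK// posrE. Qed.

Lemma cpowM s t z : 0 < s -> 0 < t -> cpow (s * t) z = cpow s z * cpow t z.
Proof.
by move=> s0 t0; rewrite /cpow lnM ?posrE// rmorphD/= mulrDr cexpD.
Qed.

Lemma cpow_prod I (r : seq I) (P : pred I) (F : I -> R) z :
  (forall i, 0 < F i) ->
  cpow (\prod_(i <- r | P i) F i) z = \prod_(i <- r | P i) cpow (F i) z.
Proof.
move=> F0.
suff [] : 0 < \prod_(i <- r | P i) F i /\
  cpow (\prod_(i <- r | P i) F i) z = \prod_(i <- r | P i) cpow (F i) z by [].
elim/big_rec2 : _ => [|i y x _ [x0 xy]]; first by rewrite cpow_1.
by rewrite cpowM// xy mulr_gt0.
Qed.

Lemma norm_Re_cpow t z : `|Re (cpow t z)| <= expR (Re z * ln t).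
Proof. by apply: (le_trans (norm_Re_cexp _)); rewrite cReM/= mulr0 subr0. Qed.

Lemma norm_Im_cpow t z : `|Im (cpow t z)| <= expR (Re z * ln t).
Proof. by apply: (le_trans (norm_Im_cexp _)); rewrite cReM/= mulr0 subr0. Qed.

Lemma Re_cpow t z : Re (cpow t z) = expR (Re z * ln t) * cos (Im z * ln t).
Proof. by rewrite /cpow /cexp !(cReM, cImM)/=; congr (expR _ * cos _); ring. Qed.

Lemma Im_cpow t z : Im (cpow t z) = expR (Re z * ln t) * sin (Im z * ln t).
Proof. by rewrite /cpow /cexp !(cReM, cImM)/=; congr (expR _ * sin _); ring. Qed.

End ComplexPower.

(** * Real and complex Lebesgue integrals *)

Section AffineChange.
Variable R : realType.
Local Notation mu := (@lebesgue_measure R).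

Lemma measurable_affine (c d : R) :
  measurable_fun [set: R] (fun x : R => c * x + d).
Proof. by apply: measurable_funD => //; apply: measurable_funM. Qed.

(** The pushforward scaled by [c] gives every half-open interval its length, so uniqueness of
    Lebesgue measure identifies it with [mu]. *)
Let lebesgue_measure_affine_gt0 (c d : R) (A : set R) : 0 < c -> measurable A ->
  mu ((fun x : R => c * x + d) @^-1` A) = (c^-1%:E * mu A)%E.
Proof.
move=> c0 mA.
pose phi (x : R) : measurableTypeR R := c * x + d.
have mphi : measurable_fun [set: R] phi by exact: measurable_affine.
have [pm pmE] : exists pm : {measure set (measurableTypeR R) -> \bar R},
    forall B, pm B = pushforward mu phi B.
  by unshelve eexists (pushforward mu phi : {measure set (measurableTypeR R) -> \bar R}).
have nuE : forall A, measurable A -> mu A = mscale (NngNum (ltW c0)) pm A.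
  apply: lebesgue_measure_unique => //= _ [[a b]] _ <-.
  rewrite /mscale/= pmE /pushforward.
  have -> : phi @^-1` `]a, b] = `](a - d) / c, (b - d) / c]%classic.
    apply/seteqP; split => x /=; rewrite !in_itv/= ltr_pdivrMr// ler_pdivlMr//;
      by rewrite ltrBlDr lerBrDr mulrC.
  rewrite !lebesgue_measure_itv/= !lte_fin ltr_pM2r ?invr_gt0// ltrD2r.
  case: ifP => _; last by rewrite mule0.
  by rewrite -EFinB -EFinM; congr EFin; field; rewrite gt_eqF.
rewrite (nuE A mA) /mscale/= pmE /pushforward muleA -EFinM mulVf ?gt_eqF//.
by rewrite mul1e.
Qed.

Lemma lebesgue_measure_affine (c d : R) (A : set R) : c != 0 -> measurable A ->
  mu ((fun x : R => c * x + d) @^-1` A) = (`|c|^-1%:E * mu A)%E.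
Proof.
move=> c0 mA; have [c_gt0|c_lt0] := orP (lt_total c0); last first.
  by rewrite gtr0_norm// lebesgue_measure_affine_gt0.
rewrite ltr0_norm//.
have mNA : measurable ((-%R : R -> R) @^-1` A).
  by rewrite -[X in measurable X]setTI; exact: oppr_measurable.
have -> : (fun x : R => c * x + d) @^-1` A =
    (fun x => - c * x + - d) @^-1` ((-%R : R -> R) @^-1` A).
  by apply/seteqP; split => x /=; rewrite opprD mulNr !opprK.
rewrite lebesgue_measure_affine_gt0 ?oppr_gt0//; congr (_ * _)%E.
exact: lebesgue_measureN.
Qed.

Variables (c d : R).
Hypothesis c0 : c != 0.
Local Notation aff := (fun x : R => c * x + d).

Lemma ge0_integral_affine (D : set R) (f : R -> \bar R) :
  measurable D -> measurable_fun D f -> (forall x, D x -> 0 <= f x)%E ->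
  (\int[mu]_(x in aff @^-1` D) f (c * x + d)%R = `|c|^-1%:E * \int[mu]_(x in D) f x)%E.
Proof.
move=> mD mf f0.
pose phi (x : R) : measurableTypeR R := c * x + d.
have mphi : measurable_fun [set: R] phi by exact: measurable_affine.
have ic0 : 0 <= `|c|^-1 by rewrite invr_ge0.
transitivity (\int[pushforward mu phi]_(x in D) f x)%E.
  rewrite ge0_integral_pushforward// => x; rewrite inE; exact: f0.
rewrite -[RHS](@ge0_integral_mscale _ _ _ mu D mD (NngNum ic0) f)//.
apply: eq_measure_integral => /= A mA AD.
by rewrite /mscale/= /pushforward lebesgue_measure_affine.
Qed.

Lemma measurable_fun_affine (D : set R) d' (T : measurableType d') (f : R -> T) :
  measurable D -> measurable_fun D f ->
  measurable_fun (aff @^-1` D) (fun x => f (c * x + d)).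
Proof.
move=> mD mf; apply: (measurable_comp mD) => //.
- by move=> _ [x Dx <-].
- by apply: measurable_funS (measurable_affine _ _).
Qed.

Lemma integrable_affine (D : set R) (f : R -> R) : measurable D ->
  mu.-integrable D (EFin \o f) ->
  mu.-integrable (aff @^-1` D) (EFin \o (fun x => f (c * x + d))).
Proof.
move=> mD /integrableP[mf foo]; apply/integrableP; split.
  exact: (measurable_fun_affine mD mf).
rewrite (@ge0_integral_affine D (fun x => `|(f x)%:E|%E))//; last first.
  exact: measurableT_comp.
by rewrite lte_mul_pinfty// lee_fin invr_ge0.
Qed.

(** The positive and negative parts scale separately. When one of them has infinite integral, [fine]
    sends both sides to 0, so the identity persists. *)
Lemma Rintegral_affine (D : set R) (f : R -> R) :
  measurable D -> measurable_fun D f ->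
  \int[mu]_(x in aff @^-1` D) f (c * x + d) = `|c|^-1 * \int[mu]_(x in D) f x.
Proof.
move=> mD /measurable_EFinP mf; rewrite /Rintegral.
rewrite [in LHS]integralE [in RHS]integralE.
have := @ge0_integral_affine D _ mD (measurable_funepos mf) (fun x _ => funepos_ge0 _ x).
have := @ge0_integral_affine D _ mD (measurable_funeneg mf) (fun x _ => funeneg_ge0 _ x).
have -> : (fun x => (EFin \o f)^\+ (c * x + d)%R)%E =
  (fun x => (f (c * x + d))%:E)^\+%E by exact/esym/(funepos_comp (EFin \o f) aff).
have -> : (fun x => (EFin \o f)^\- (c * x + d)%R)%E =
  (fun x => (f (c * x + d))%:E)^\-%E by exact/esym/(funeneg_comp (EFin \o f) aff).
move=> -> ->.
set k := `|c|^-1.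
have k0 : 0 < k by rewrite invr_gt0 normr_gt0.
have: (0 <= \int[mu]_(x in D) (EFin \o f)^\+ x)%E by apply: integral_ge0.
have: (0 <= \int[mu]_(x in D) (EFin \o f)^\- x)%E by apply: integral_ge0.
set a := integral _ _ _; set b := integral _ _ _.
case: a => [a| |]//; case: b => [b| |]// _ _.
- by rewrite -!EFinM -!EFinB/= mulrBr.
- by rewrite gt0_muley ?lte_fin//= mulr0.
- by rewrite gt0_muley ?lte_fin//= mulr0.
- by rewrite gt0_muley ?lte_fin//= mulr0.
Qed.

End AffineChange.

(** * Integrability of power, Beta and Gamma integrands *)

Section Integrability.
Variable R : realType.
Local Notation mu := (@lebesgue_measure R).

Lemma le_integrable_real (D : set R) (f g : R -> R) : measurable D ->
  measurable_fun D f -> (forall x, D x -> `|f x| <= g x) ->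
  mu.-integrable D (EFin \o g) -> mu.-integrable D (EFin \o f).
Proof.
move=> mD mf fg ig; apply: (@le_integrable _ _ _ mu D mD (EFin \o f) (EFin \o g)) => //;
  first exact/measurable_EFinP.
by move=> x Dx /=; rewrite lee_fin (le_trans (fg _ Dx))// ler_norm.
Qed.

(** On [[1/(n+1), 1]] the primitive [t^a / a] bounds the integral by [1/a], uniformly in n; monotone
    convergence passes to the union of these intervals, which contains []0, 1[]. *)
Lemma integrable_powR01 (a : R) : 0 < a ->
  mu.-integrable `]0, 1[ (EFin \o (fun t => t `^ (a - 1))).
Proof.
move=> a0.
have mP D : measurable_fun D (fun t : R => t `^ (a - 1)).
  by apply: measurable_funTS; exact: measurable_powR.
suff : mu.-integrable (\bigcup_n `[n.+1%:R^-1, 1]%classic)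
    (EFin \o (fun t : R => t `^ (a - 1))).
  apply: integrableS => //; first by apply: bigcupT_measurable => n.
  move=> t /=; rewrite in_itv/= => /andP[t0 t1].
  have [n nt] := ltr_add_invr t0; exists n => //=; rewrite in_itv/= (ltW t1) andbT.
  by move: nt; rewrite add0r => /ltW.
apply/integrableP; split; first by apply/measurable_EFinP; exact: mP.
have h n : (\int[mu]_(t in `[(n.+1%:R^-1 : R)%R, 1%R]) (t `^ (a - 1))%:E <= (a^-1)%:E)%E.
  have [->|n0] := eqVneq n 0%N.
    by rewrite invr1 set_itv1 integral_set1 lee_fin invr_ge0 ltW.
  have n1 : (n.+1%:R^-1 : R) < 1 by rewrite invf_lt1 ?ltr0Sn// ltr1n ltnS lt0n.
  have ni0 : 0 < (n.+1%:R^-1 : R) by rewrite invr_gt0.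
  have dF (t : R) : 0 < t -> is_derive t 1 (fun t : R => a^-1 * t `^ a) (t `^ (a - 1)).
    move=> t0; have dp := @is_derive1_powR R a t t0.
    apply: (is_derive_eq (is_deriveZ a^-1 dp)).
    by rewrite /GRing.scale/= mulrA mulVf ?gt_eqF// mul1r.
  have cF (t : R) : 0 < t -> {for t, continuous (fun t : R => a^-1 * t `^ a)}.
    move=> t0; apply: differentiable_continuous; apply/derivable1_diffP.
    exact: (@ex_derive _ _ _ _ _ _ _ (dF t t0)).
  rewrite (@continuous_FTC2 R _ (fun t => a^-1 * t `^ a))//.
  - rewrite powR1 mulr1 -EFinB lee_fin lerBlDr lerDl.
    by rewrite mulr_ge0 ?powR_ge0// invr_ge0 ltW.
  - apply: continuous_in_subspaceT => t; rewrite inE/= in_itv/= => /andP[nt _].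
    have t0 : 0 < t by exact: lt_le_trans nt.
    apply: differentiable_continuous; apply/derivable1_diffP.
    by apply: derivable_powR; rewrite in_itv/= t0.
  - split => [t|  |].
    + rewrite in_itv/= => /andP[nt _].
      exact: (@ex_derive _ _ _ _ _ _ _ (dF t (lt_trans ni0 nt))).
    + by apply: cvg_at_right_filter; exact: cF.
    + by apply: cvg_at_left_filter; exact: cF.
  - move=> t; rewrite in_itv/= => /andP[nt _].
    by rewrite derive1E (@derive_val _ _ _ _ _ _ _ (dF t (lt_trans ni0 nt))).
have nd : nondecreasing_seq (fun n => `[n.+1%:R^-1, 1]%classic : set R).
  move=> i j ij; apply/subsetPset => t /=; rewrite !in_itv/= => /andP[it ->].
  by rewrite andbT (le_trans _ it)// lef_pV2 ?posrE// ler_nat.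
have hc : (\int[mu]_(t in `[(n.+1%:R^-1 : R)%R, 1%R]) (t `^ (a - 1))%:E)%E @[n --> \oo] -->
    (\int[mu]_(t in \bigcup_n `[(n.+1%:R^-1 : R)%R, 1%R]%classic) (t `^ (a - 1))%:E)%E.
  apply: (@ge0_nondecreasing_set_cvg_integral _ (measurableTypeR R) R
    (fun n => `[n.+1%:R^-1, 1]%classic)).
  - exact: nd.
  - by move=> i; exact: measurable_itv.
  - by move=> i; apply/measurable_EFinP; exact: mP.
  - by move=> i x _; rewrite lee_fin powR_ge0.
apply: le_lt_trans (ltry a^-1).
under eq_integral do rewrite /= ger0_norm ?powR_ge0//.
rewrite -(cvg_lim _ hc)//.
by apply: lime_le; [apply/cvg_ex; eexists; exact: hc|exact: nearW].
Qed.

(** The two summands serve the two signs of [c]: the power is at most 1 if [c] is nonnegative, and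
    at most its value at 1/2 otherwise. This controls the factor of the Beta integrand that is away
    from its singularity. *)
Lemma powR_le_halfM (c u : R) : 2^-1 <= u <= 1 -> u `^ c <= 1 + 2^-1 `^ c.
Proof.
move=> /andP[u2 u1]; have u0 : 0 < u by apply: lt_le_trans u2; rewrite invr_gt0.
have [c0|c0] := leP 0 c.
  by rewrite (@le_trans _ _ 1) ?lerDl ?powR_ge0// -(powRr0 u) ger_powR ?u0.
rewrite -[leLHS]add0r lerD ?ler01// -[c]opprK (powRN u) (powRN 2^-1).
by rewrite lef_pV2 ?posrE ?powR_gt0// ?invr_gt0// ge0_ler_powR ?nnegrE ?oppr_ge0 ?invr_ge0// ltW.
Qed.

Lemma integrable_onem (f : R -> R) :
  mu.-integrable `]0, 1[ (EFin \o f) ->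
  mu.-integrable `]0, 1[ (EFin \o (fun t => f (1 - t))).
Proof.
move=> fi.
have N1 : (-1 : R) != 0 by rewrite oppr_eq0 oner_eq0.
have := @integrable_affine R (-1) 1 N1 _ f (measurable_itv _) fi.
have -> : (fun x : R => -1 * x + 1) @^-1` `]0, 1[ = `]0, 1[%classic.
  by apply/seteqP; split => x /=; rewrite !in_itv/=; lra.
by congr (_.-integrable _ _); apply/funext => t/=; congr ((f _)%:E); ring.
Qed.

(** Cut at 1/2: on each half one factor is bounded by a constant [K] and the other is an integrable
    power. *)
Lemma integrable_beta (a b : R) : 0 < a -> 0 < b ->
  mu.-integrable `]0, 1[ (EFin \o (fun t => t `^ (a - 1) * (1 - t) `^ (b - 1))).
Proof.
move=> a0 b0.
have mP c : measurable_fun [set: R] (fun t : R => t `^ c) by exact: measurable_powR.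
pose K c : R := 1 + 2^-1 `^ c.
have K0 c : 0 <= K c by rewrite addr_ge0 ?powR_ge0.
apply: (@le_integrable_real _ _
  (fun t => K (b - 1) * t `^ (a - 1) + K (a - 1) * (1 - t) `^ (b - 1))) => //.
- apply: measurable_funTS; apply: measurable_funM => //.
  apply: (measurableT_comp (mP _)).
  by apply: measurable_funB.
- move=> t; rewrite /= in_itv/= => /andP[t0 t1].
  rewrite ger0_norm ?mulr_ge0 ?powR_ge0//.
  have [t2|t2] := leP t 2^-1.
    rewrite -[leLHS]addr0 lerD ?mulr_ge0 ?powR_ge0// mulrC.
    by rewrite ler_wpM2r ?powR_ge0// powR_le_halfM//; lra.
  rewrite -[leLHS]add0r lerD ?mulr_ge0 ?powR_ge0//.
  by rewrite ler_wpM2r ?powR_ge0// powR_le_halfM//; lra.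
- rewrite (_ : EFin \o _ = (fun t => (K (b - 1))%:E * (t `^ (a - 1))%:E) \+
    (fun t => (K (a - 1))%:E * ((1 - t) `^ (b - 1))%:E))%E//.
  apply: integrableD => //.
    apply: integrableZl => //; exact: integrable_powR01.
  apply: integrableZl => //.
  exact: (@integrable_onem (fun u => u `^ (b - 1)) (integrable_powR01 b0)).
Qed.

(** The dominating function is the bare power on []0, 1[] plus a multiple of the exponential density
    of rate 1/2, which beats the power at infinity. *)
Lemma integrable_gamma (a : R) : 0 < a ->
  mu.-integrable [set t | 0 < t] (EFin \o (fun t => t `^ (a - 1) * expR (- t))).
Proof.
move=> a0.
have mP c : measurable_fun [set: R] (fun t : R => t `^ c) by exact: measurable_powR.
have mD : measurable [set t : R | 0 < t].
  have -> : [set t : R | 0 < t] = `]0, +oo[%classic; last exact: measurable_itv.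
  by apply/seteqP; split => x /=; rewrite in_itv/= andbT.
pose p := Num.max (a - 1) 1.
have p0 : 0 < p by rewrite lt_max ltr01 orbT.
(* From [ln x <= x - 1] at [x = t / (2p)] one gets [p ln t <= p ln (2p) + t/2 - p], whence
   [t^p e^(-t) <= K e^(-t/2)]. *)
pose K := expR (p * ln (2 * p)).
pose g0 : R -> R := (fun t => t `^ (a - 1)) \_ `]0, 1[.
pose g1 : R -> R := exponential_pdf 2^-1.
have i1 : mu.-integrable [set: R] (EFin \o g1).
  by apply: integrable_exponential_pdf; rewrite invr_gt0.
have i0 : mu.-integrable [set: R] (EFin \o g0).
  rewrite /g0 -restrict_EFin.
  exact: ((@integrable_mkcond _ _ _ mu `]0, 1[%classic _ (measurable_itv _)).1
    (integrable_powR01 a0)).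
apply: (@le_integrable_real _ _ (fun t => g0 t + 2 * K * g1 t)) => //.
- apply: measurable_funTS; apply: measurable_funM => //.
  by apply: measurableT_comp => //; exact: oppr_measurable.
- move=> t /= t0; rewrite ger0_norm ?mulr_ge0 ?powR_ge0 ?expR_ge0//.
  rewrite /g0 /g1 exponential_pdfE ?(ltW t0)// patchE.
  case: ifPn; rewrite ?inE ?notin_setE/= in_itv/= t0/=.
    move=> t1; rewrite -[leLHS]addr0 lerD//; last first.
      by rewrite !mulr_ge0 ?expR_ge0 ?invr_ge0.
    by rewrite -[leRHS]mulr1 ler_wpM2l ?powR_ge0// -expR0 ler_expR oppr_le0 ltW.
  move=> /negP; rewrite -leNgt => t1; rewrite add0r.
  have -> : 2 * K * (2^-1 * expR (- 2^-1 * t)) = K * expR (- 2^-1 * t) by field.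
  apply: (@le_trans _ _ (t `^ p * expR (- t))).
    by rewrite ler_wpM2r ?expR_ge0// ler_powR// le_max lexx.
  rewrite /K /powR gt_eqF// -!expRD ler_expR.
  have : ln (t / (2 * p)) <= t / (2 * p) - 1.
    have := @le_ln1Dx R (t / (2 * p) - 1); rewrite (addrC 1) subrK; apply.
    by rewrite ltrBrDr addNr divr_gt0 ?mulr_gt0.
  rewrite ln_div ?posrE ?mulr_gt0// -(ler_pM2l p0).
  have -> : p * (t / (2 * p) - 1) = t / 2 - p by field; rewrite gt_eqF.
  by rewrite mulrBr; lra.
- rewrite (_ : EFin \o _ = (EFin \o g0) \+ (fun t => (2 * K)%:E * (g1 t)%:E))%E//.
  apply: integrableD => //; first exact: integrableS i0.
  by apply: integrableZl => //; exact: integrableS i1.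
Qed.

End Integrability.

(** * Complex-valued integrals by components *)

Section ComplexIntegral.
Variable R : realType.
Local Notation mu := (@lebesgue_measure R).
Local Notation Re := (@complex.Re R).
Local Notation Im := (@complex.Im R).

(** The 1-norm rather than the modulus: integrals and limits are taken on real and imaginary parts
    separately, and these it dominates directly while staying submultiplicative. *)
Definition cabs (z : R[i]) : R := `|Re z| + `|Im z|.

Lemma cabs_ge0 z : 0 <= cabs z. Proof. by rewrite addr_ge0. Qed.
Lemma cabs_Re z : `|Re z| <= cabs z. Proof. by rewrite lerDl. Qed.
Lemma cabs_Im z : `|Im z| <= cabs z. Proof. by rewrite lerDr. Qed.
Lemma cabsM z w : cabs (z * w) <= cabs z * cabs w.
Proof.
rewrite /cabs cReM cImM; apply: (le_trans (lerD (ler_normB _ _) (ler_normD _ _))).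
rewrite !normrM; lra.
Qed.
Lemma cabs_real t : cabs t%:C = `|t|.
Proof. by rewrite /cabs/= normr0 addr0. Qed.

Lemma cabs_cpow t z : 0 < t -> cabs (cpow t z) <= 2 * t `^ Re z.
Proof.
move=> t0; rewrite /cabs mulr2n mulrDl mul1r /powR gt_eqF//.
by rewrite lerD ?norm_Re_cpow ?norm_Im_cpow.
Qed.

Definition Cmeasurable d (T : measurableType d) (D : set T) (f : T -> R[i]) :=
  measurable_fun D (fun t => Re (f t)) /\ measurable_fun D (fun t => Im (f t)).

Section Measurability.
Context d (T : measurableType d).
Implicit Types (D : set T) (f g : T -> R[i]).

Lemma Cmeasurable_cst D c : Cmeasurable D (fun=> c).
Proof. by split; exact: measurable_cst. Qed.

Lemma CmeasurableM D f g :
  Cmeasurable D f -> Cmeasurable D g -> Cmeasurable D (fun t => f t * g t).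
Proof.
move=> [f1 f2] [g1 g2]; split.
  under eq_fun do rewrite cReM.
  by apply: measurable_funB; apply: measurable_funM.
under eq_fun do rewrite cImM.
by apply: measurable_funD; apply: measurable_funM.
Qed.

Lemma Cmeasurable_real D (f : T -> R) :
  measurable_fun D f -> Cmeasurable D (fun t => (f t)%:C).
Proof. by move=> mf; split => //; exact: measurable_cst. Qed.

Lemma CmeasurableS (D E : set T) f : measurable E -> D `<=` E ->
  Cmeasurable E f -> Cmeasurable D f.
Proof. by move=> mE DE [f1 f2]; split; apply: measurable_funS; eassumption. Qed.

Lemma Cmeasurable_cpow (f : T -> R) z :
  measurable_fun [set: T] f -> Cmeasurable [set: T] (fun t => cpow (f t) z).
Proof.
move=> mf.
have mln c : measurable_fun [set: T] (fun t => c * ln (f t)).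
  apply: measurable_funM => //; exact: (measurableT_comp (@measurable_ln R)).
split.
  under eq_fun do rewrite Re_cpow.
  apply: measurable_funM.
    exact: (measurableT_comp (@measurable_expR R)).
  apply: (@measurableT_comp _ _ _ _ _ _ cos) => //.
  by apply: continuous_measurable_fun; exact: continuous_cos.
under eq_fun do rewrite Im_cpow.
apply: measurable_funM.
  exact: (measurableT_comp (@measurable_expR R)).
apply: (@measurableT_comp _ _ _ _ _ _ sin) => //.
by apply: continuous_measurable_fun; exact: continuous_sin.
Qed.

Lemma Cmeasurable_if (b : T -> bool) f :
  measurable_fun [set: T] b -> Cmeasurable [set: T] f ->
  Cmeasurable [set: T] (fun t => if b t then f t else 0).
Proof.
move=> mb [f1 f2]; split.
  rewrite (_ : (fun t => _) = fun t => if b t then Re (f t) else 0).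
    exact: measurable_fun_ifT.
  by apply/funext => t; case: ifP.
rewrite (_ : (fun t => _) = fun t => if b t then Im (f t) else 0).
  exact: measurable_fun_ifT.
by apply/funext => t; case: ifP.
Qed.

End Measurability.

Definition Cintegrable (D : set R) (f : R -> R[i]) :=
  mu.-integrable D (EFin \o (fun t => Re (f t))) /\
  mu.-integrable D (EFin \o (fun t => Im (f t))).

Implicit Types (D : set R) (f g : R -> R[i]).

Lemma eq_Cintegral D f g :
  (forall t, D t -> f t = g t) -> Cintegral D f = Cintegral D g.
Proof.
by move=> fg; rewrite /Cintegral; congr (_ +i* _); apply: eq_Rintegral => t;
  rewrite inE => Dt; rewrite fg.
Qed.

Lemma Cintegral0 D : Cintegral D (fun=> 0) = 0 :> R[i].
Proof.
rewrite /Cintegral /=.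
have h : \int[mu]_(t in D) (0 : R) = 0 by rewrite /Rintegral integral0.
by rewrite h.
Qed.

Lemma Cintegrable_le D f (g : R -> R) : measurable D -> Cmeasurable D f ->
  (forall t, D t -> cabs (f t) <= g t) -> mu.-integrable D (EFin \o g) ->
  Cintegrable D f.
Proof.
move=> mD [f1 f2] fg ig; split; apply: (le_integrable_real mD _ _ ig) => // t Dt.
  exact: le_trans (cabs_Re _) (fg _ Dt).
exact: le_trans (cabs_Im _) (fg _ Dt).
Qed.

Lemma integrableZl_real D c (f : R -> R) : measurable D ->
  mu.-integrable D (EFin \o f) -> mu.-integrable D (EFin \o (fun t => c * f t)).
Proof.
move=> mD fi; rewrite (_ : _ \o _ = (fun t => c%:E * (f t)%:E)%E)//.
exact: integrableZl.
Qed.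

Lemma Cintegrable_measurable D f : Cintegrable D f -> Cmeasurable D f.
Proof.
by move=> [f1 f2]; split; apply/measurable_EFinP; exact: (measurable_int mu).
Qed.

Lemma integrable_cabs D f : measurable D -> Cintegrable D f ->
  mu.-integrable D (EFin \o (fun t => cabs (f t))).
Proof.
move=> mD [f1 f2].
rewrite (_ : _ \o _ = (abse \o (EFin \o (fun t => Re (f t)))) \+
  (abse \o (EFin \o (fun t => Im (f t)))))%E//.
by apply: integrableD => //; exact: integrable_abse.
Qed.

Lemma CintegrableMl D (c : R[i]) f : measurable D ->
  Cintegrable D f -> Cintegrable D (fun t => c * f t).
Proof.
move=> mD fi.
apply: (@Cintegrable_le _ _ (fun t => cabs c * cabs (f t))) => //.
- apply: CmeasurableM; first exact: Cmeasurable_cst.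
  exact: Cintegrable_measurable.
- by move=> t _; exact: cabsM.
- by apply: integrableZl_real => //; exact: integrable_cabs.
Qed.

Lemma CintegralZl D (c : R[i]) f : measurable D -> Cintegrable D f ->
  Cintegral D (fun t => c * f t) = c * Cintegral D f.
Proof.
move=> mD [f1 f2]; apply: complex_ext; rewrite ?(cReM, cImM) /=.
  under eq_Rintegral do rewrite cReM.
  rewrite RintegralB//; [|exact: integrableZl_real..].
  by rewrite !RintegralZl.
under eq_Rintegral do rewrite cImM.
rewrite RintegralD//; [|exact: integrableZl_real..].
by rewrite !RintegralZl.
Qed.

Lemma CintegralZr D (c : R[i]) f : measurable D -> Cintegrable D f ->
  Cintegral D (fun t => f t * c) = Cintegral D f * c.
Proof.
move=> mD fi; rewrite mulrC -CintegralZl//.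
by apply: eq_Cintegral => t _; rewrite mulrC.
Qed.

Lemma CintegralB D f g : measurable D -> Cintegrable D f -> Cintegrable D g ->
  Cintegral D (fun t => f t - g t) = Cintegral D f - Cintegral D g.
Proof.
move=> mD [f1 f2] [g1 g2]; apply: complex_ext; rewrite ?(cReD, cImD, cReN, cImN)/=.
  rewrite -RintegralB//; apply: eq_Rintegral => t _.
  by rewrite cReD cReN.
rewrite -RintegralB//; apply: eq_Rintegral => t _.
by rewrite cImD cImN.
Qed.

(** The factor 2 comes from bounding the real and the imaginary part each by the full integral of
    [g]. *)
Lemma cabs_Cintegral D f (g : R -> R) : measurable D -> Cmeasurable D f ->
  (forall t, D t -> cabs (f t) <= g t) -> mu.-integrable D (EFin \o g) ->
  cabs (Cintegral D f) <= 2 * \int[mu]_(t in D) g t.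
Proof.
move=> mD mf fg ig; have [f1 f2] := Cintegrable_le mD mf fg ig.
rewrite mulr2n mulrDl mul1r; apply: lerD => /=.
  apply: (le_trans (le_normr_Rintegral _ _)) => //.
  apply: le_Rintegral => //; first exact: integrable_norm.
  by move=> t Dt; exact: le_trans (cabs_Re _) (fg _ Dt).
apply: (le_trans (le_normr_Rintegral _ _)) => //.
apply: le_Rintegral => //; first exact: integrable_norm.
by move=> t Dt; exact: le_trans (cabs_Im _) (fg _ Dt).
Qed.

Lemma Cintegral_mkcond D f :
  Cintegral D f = Cintegral setT (fun t => if t \in D then f t else 0).
Proof.
rewrite /Cintegral; congr (_ +i* _); rewrite Rintegral_mkcond;
  by apply: eq_Rintegral => t _; rewrite patchE; case: ifP.
Qed.

Lemma Cintegral_affine (c d : R) D f : c != 0 -> measurable D ->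
  Cmeasurable D f ->
  Cintegral ((fun x => c * x + d) @^-1` D) (fun x => f (c * x + d)) =
  (`|c|^-1)%:C * Cintegral D f.
Proof.
move=> c0 mD [f1 f2]; apply: complex_ext; rewrite ?(cReM, cImM)/=.
  by rewrite (Rintegral_affine _ c0 mD f1) mul0r subr0.
by rewrite (Rintegral_affine _ c0 mD f2) mul0r addr0.
Qed.

End ComplexIntegral.

(** * Fubini's theorem for real and complex integrands *)

Section Fubini.
Variable R : realType.
Local Notation mu := (@lebesgue_measure R).
Local Notation Re := (@complex.Re R).
Local Notation Im := (@complex.Im R).

Lemma RFubini (h : R * R -> R) : (mu \x mu)%E.-integrable setT (EFin \o h) ->
  \int[mu]_x (\int[mu]_y h (x, y)) = \int[mu]_y (\int[mu]_x h (x, y)).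
Proof.
move=> ih; rewrite /Rintegral.
have iF := integrable_fubini_F ih.
have mh := measurable_int (mu \x mu)%E ih.
have iG : mu.-integrable setT (fun y => \int[mu]_x (h (x, y))%:E)%E.
  have := (integrable21ltyP mu mu mh).1 ih.
  have mhs : measurable_fun setT ((EFin \o h) \o (fun p => (p.2, p.1))).
    by apply: (measurableT_comp mh); exact: measurable_swap.
  by move=> /(integrable12ltyP mu mu mhs).2/integrable_fubini_F.
(* The inner integrals are finite only almost everywhere, which is enough to drop [fine] under the
   outer integral. *)
have fineE (F : R -> \bar R) : mu.-integrable setT F ->
    (\int[mu]_x (fine (F x))%:E = \int[mu]_x F x)%E.
  move=> iF0; have mF := measurable_int mu iF0.
  apply: ae_eq_integral => //.
    by apply/measurable_EFinP; exact: measurableT_comp.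
  by apply: filterS (integrable_ae measurableT iF0) => x Fx Dx; rewrite fineK// Fx.
congr fine.
transitivity (\int[mu]_x \int[mu]_y (h (x, y))%:E)%E; first exact: (fineE _ iF).
rewrite (Fubini ih); symmetry; exact: (fineE _ iG).
Qed.

Lemma CFubini (f : R * R -> R[i]) (g : R * R -> R) :
  Cmeasurable [set: R * R] f -> (forall p, cabs (f p) <= g p) ->
  (mu \x mu)%E.-integrable setT (EFin \o g) ->
  Cintegral setT (fun x => Cintegral setT (fun y => f (x, y))) =
  Cintegral setT (fun y => Cintegral setT (fun x => f (x, y))).
Proof.
move=> [f1 f2] fg ig.
have key (k : R * R -> R) : measurable_fun [set: R * R] k ->
    (forall p, `|k p| <= cabs (f p)) -> (mu \x mu)%E.-integrable setT (EFin \o k).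
  move=> mk kf.
  apply: (@le_integrable _ _ _ (mu \x mu)%E _ measurableT (EFin \o k) (EFin \o g)) => //.
    exact/measurable_EFinP.
  move=> p _ /=; rewrite lee_fin (le_trans (kf _))// (le_trans (fg _))//.
  exact: ler_norm.
apply: complex_ext => /=.
  by rewrite (RFubini (key _ f1 _))// => p; exact: cabs_Re.
by rewrite (RFubini (key _ f2 _))// => p; exact: cabs_Im.
Qed.

End Fubini.

(** * Beta and Gamma functions *)

Section BetaIntegral.
Variable R : realType.
Local Notation mu := (@lebesgue_measure R).
Local Notation Re := (@complex.Re R).
Local Notation Im := (@complex.Im R).

Definition Beta (a b : R[i]) : R[i] :=
  Cintegral `]0, 1[ (fun t => cpow t (a - 1) * cpow (1 - t) (b - 1)).

Lemma measurable_pos : measurable [set t : R | 0 < t].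
Proof.
have -> : [set t : R | 0 < t] = `]0, +oo[%classic; last exact: measurable_itv.
by apply/seteqP; split => x /=; rewrite in_itv/= andbT.
Qed.

Lemma preimage_scale (y : R) : 0 < y ->
  (fun x : R => y^-1 * x + 0) @^-1` `]0, 1[ = `]0, y[%classic.
Proof.
move=> y0; apply/seteqP; split => x /=; rewrite !in_itv/= addr0 mulrC.
  by rewrite pmulr_lgt0 ?invr_gt0// ltr_pdivrMr// mul1r.
by rewrite pmulr_lgt0 ?invr_gt0// ltr_pdivrMr// mul1r.
Qed.

(** The real counterpart of [Beta_scaled], by the same substitution [x = y t]; it supplies the
    dominating functions for complex exponents and for Fubini. *)
Lemma integrable_beta_scaled (a b y : R) : 0 < a -> 0 < b -> 0 < y ->
  mu.-integrable `]0, y[ (EFin \o (fun x => x `^ (a - 1) * (y - x) `^ (b - 1))) /\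
  \int[mu]_(x in `]0, y[) (x `^ (a - 1) * (y - x) `^ (b - 1)) =
  y `^ (a + b - 1) * \int[mu]_(t in `]0, 1[) (t `^ (a - 1) * (1 - t) `^ (b - 1)).
Proof.
move=> a0 b0 y0; have ib := integrable_beta a0 b0.
pose f (t : R) := t `^ (a - 1) * (1 - t) `^ (b - 1).
have yV : y^-1 != 0 by rewrite invr_eq0 gt_eqF.
have yN : y != 0 by rewrite gt_eqF.
have fE x : `]0, y[%classic x -> x `^ (a - 1) * (y - x) `^ (b - 1) =
    y `^ (a + b - 2) * f (y^-1 * x + 0).
  rewrite /= in_itv/= => /andP[x0 xy]; rewrite /f addr0.
  have -> : a + b - 2 = (a - 1) + (b - 1) by ring.
  rewrite (@powRD _ y) ?yN ?implybT// mulrACA -!powRM ?(ltW y0)//.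
  - by congr (_ `^ _ * _ `^ _); field.
  - by rewrite subr_ge0 mulrC ler_pdivrMr// mul1r ltW.
  - by apply: mulr_ge0; rewrite ?invr_ge0 ltW.
have := integrable_affine 0 yV (measurable_itv _) ib.
rewrite preimage_scale// => iy; split.
  apply: (@eq_integrable _ _ _ mu _ (measurable_itv _) (EFin \o
      (fun x => y `^ (a + b - 2) * f (y^-1 * x + 0)))).
    by move=> x; rewrite inE => xy /=; rewrite fE.
  by apply: integrableZl_real => //; exact: iy.
transitivity (\int[mu]_(x in `]0, y[) (y `^ (a + b - 2) * f (y^-1 * x + 0))).
  by apply: eq_Rintegral => x; rewrite inE; exact: fE.
rewrite RintegralZl; [|exact: measurable_itv|exact: iy].
have mf : measurable_fun (`]0, 1[%classic : set R) f by apply/measurable_EFinP; exact: (measurable_int mu ib).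
rewrite -[in LHS](preimage_scale y0) (Rintegral_affine _ yV (measurable_itv _) mf).
rewrite normfV invrK gtr0_norm// mulrA; congr (_ * _).
rewrite mulrC -[X in X * _]powRr1 ?(ltW y0)// -powRD ?yN ?implybT//.
by congr (_ `^ _); ring.
Qed.

Lemma Cmeasurable_beta (a b y : R[i]) (D : set R) (c : R) :
  Cmeasurable D (fun t : R => cpow t a * cpow (c - t) b).
Proof.
apply: (@CmeasurableS _ _ _ _ setT) => //.
apply: CmeasurableM; apply: Cmeasurable_cpow => //.
by apply: measurable_funB => //; exact: measurable_cst.
Qed.

Lemma Cintegrable_beta (a b : R[i]) (y : R) : 0 < Re a -> 0 < Re b -> 0 < y ->
  Cintegrable `]0, y[ (fun t => cpow t (a - 1) * cpow (y - t) (b - 1)).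
Proof.
move=> a0 b0 y0; have [ib _] := integrable_beta_scaled a0 b0 y0.
apply: (@Cintegrable_le _ _ _ (fun t => 4 * (t `^ (Re a - 1) * (y - t) `^ (Re b - 1)))) => //.
- exact: Cmeasurable_beta.
- move=> t; rewrite /= in_itv/= => /andP[t0 ty].
  apply: (le_trans (cabsM _ _)).
  have -> : 4 * (t `^ (Re a - 1) * (y - t) `^ (Re b - 1)) =
    (2 * t `^ (Re a - 1)) * (2 * (y - t) `^ (Re b - 1)) by ring.
  apply: ler_pM; rewrite ?cabs_ge0//.
    by apply: (le_trans (cabs_cpow _ t0)); rewrite cReD.
  by apply: (le_trans (cabs_cpow _ _)); rewrite ?subr_gt0// cReD.
- exact: integrableZl_real.
Qed.

Lemma Beta_scaled (a b : R[i]) (y : R) : 0 < Re a -> 0 < Re b -> 0 < y ->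
  Cintegral `]0, y[ (fun t => cpow t (a - 1) * cpow (y - t) (b - 1)) =
  cpow y (a + b - 1) * Beta a b.
Proof.
move=> a0 b0 y0.
pose f (t : R) := cpow t (a - 1) * cpow (1 - t) (b - 1).
have yV : y^-1 != 0 by rewrite invr_eq0 gt_eqF.
have yN : y != 0 by rewrite gt_eqF.
have fE x : `]0, y[%classic x -> cpow x (a - 1) * cpow (y - x) (b - 1) =
    cpow y (a + b - 2%:R) * f (y^-1 * x + 0).
  rewrite /= in_itv/= => /andP[x0 xy]; rewrite /f addr0.
  have -> : a + b - 2%:R = (a - 1) + (b - 1) by ring.
  have x1 : 0 < y^-1 * x by rewrite mulr_gt0 ?invr_gt0.
  have x2 : 0 < 1 - y^-1 * x by rewrite subr_gt0 mulrC ltr_pdivrMr// mul1r.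
  have e1 : x = y * (y^-1 * x) by field.
  have e2 : y - x = y * (1 - y^-1 * x) by field.
  rewrite [in LHS]e2 [X in cpow X _ * _]e1.
  rewrite (cpowM _ y0 x1) (cpowM _ y0 x2) (cpowD y (a - 1)).
  exact: mulrACA.
transitivity (Cintegral ((fun x : R => y^-1 * x + 0) @^-1` `]0, 1[)
   (fun x => cpow y (a + b - 2%:R) * f (y^-1 * x + 0))).
  by rewrite preimage_scale//; exact: eq_Cintegral.
rewrite (@Cintegral_affine R y^-1 0 _ (fun u => cpow y (a + b - 2%:R) * f u))//; last first.
  by apply: CmeasurableM; [exact: Cmeasurable_cst|exact: Cmeasurable_beta].
rewrite CintegralZl//; last exact: Cintegrable_beta.
rewrite mulrA normfV invrK gtr0_norm// -cpowr1// -cpowD; congr (cpow _ _ * _).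
by ring.
Qed.

End BetaIntegral.

(** * Convolution of two powers against a third function *)

Section BetaConvolution.
Variable R : realType.
Local Notation mu := (@lebesgue_measure R).
Local Notation Re := (@complex.Re R).
Local Notation Im := (@complex.Im R).
Variables (a b : R[i]) (G : R -> R[i]).
Hypotheses (a0 : 0 < Re a) (b0 : 0 < Re b).
Hypothesis mG : Cmeasurable [set: R] G.
Hypothesis iG : mu.-integrable [set t | 0 < t]
  (EFin \o (fun t => t `^ (Re a + Re b - 1) * cabs (G t))).

(** Extension by 0 outside the triangle [0 < x < y] lets Fubini be applied on the whole plane. The 4
    in the majorant [g] is the product of the two factors 2 of [cabs_cpow]. *)
Let tri (p : R * R) := (0 < p.1) && (p.1 < p.2).
Let f (p : R * R) : R[i] :=
  if tri p then cpow p.1 (a - 1) * cpow (p.2 - p.1) (b - 1) * G p.2 else 0.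
Let g (p : R * R) : R :=
  if tri p then 4 * (p.1 `^ (Re a - 1) * (p.2 - p.1) `^ (Re b - 1)) * cabs (G p.2) else 0.

Let mtri : measurable_fun [set: R * R] tri.
Proof.
apply: measurable_and.
  by apply: measurable_fun_ltr; [exact: measurable_cst|exact: measurable_fst].
by apply: measurable_fun_ltr; [exact: measurable_fst|exact: measurable_snd].
Qed.

Let mdiff : measurable_fun [set: R * R] (fun p : R * R => p.2 - p.1).
Proof.
by apply: measurable_funB; [exact: measurable_snd|exact: measurable_fst].
Qed.

Let mG2 : Cmeasurable [set: R * R] (fun p => G p.2).
Proof.
case: mG => m1 m2; split.
  by apply: (measurableT_comp m1); exact: measurable_snd.
by apply: (measurableT_comp m2); exact: measurable_snd.
Qed.

Let mcabs : measurable_fun [set: R] (fun t => cabs (G t)).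
Proof.
case: mG => m1 m2; apply: measurable_funD; exact: (measurableT_comp (@normr_measurable R setT)).
Qed.

Let mf : Cmeasurable [set: R * R] f.
Proof.
apply: Cmeasurable_if => //; apply: CmeasurableM => //.
apply: CmeasurableM; apply: Cmeasurable_cpow => //; exact: measurable_fst.
Qed.

Let mg : measurable_fun [set: R * R] g.
Proof.
apply: measurable_fun_ifT => //.
apply: measurable_funM; last by apply: (measurableT_comp mcabs); exact: measurable_snd.
apply: measurable_funM; first exact: measurable_cst.
apply: measurable_funM.
  by apply: (measurableT_comp (@measurable_powR R _)); exact: measurable_fst.
exact: (measurableT_comp (@measurable_powR R _)).
Qed.

Let g0 p : 0 <= g p.
Proof.
by rewrite /g; case: ifP => // _; rewrite !mulr_ge0 ?powR_ge0 ?cabs_ge0.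
Qed.

Let fg p : cabs (f p) <= g p.
Proof.
rewrite /f /g; case: ifPn => [/andP[p1 p2]|_]; last first.
  by rewrite /cabs/= normr0 addr0.
apply: (le_trans (cabsM _ _)); rewrite ler_wpM2r ?cabs_ge0//.
apply: (le_trans (cabsM _ _)).
have -> : 4 * (p.1 `^ (Re a - 1) * (p.2 - p.1) `^ (Re b - 1)) =
  (2 * p.1 `^ (Re a - 1)) * (2 * (p.2 - p.1) `^ (Re b - 1)) by ring.
apply: ler_pM; rewrite ?cabs_ge0//.
  by apply: (le_trans (cabs_cpow _ p1)); rewrite cReD.
by apply: (le_trans (cabs_cpow _ _)); rewrite ?subr_gt0// cReD.
Qed.

Let B : R := \int[mu]_(t in `]0, 1[) (t `^ (Re a - 1) * (1 - t) `^ (Re b - 1)).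

Let inner_g y : (\int[mu]_x (g (x, y))%:E)%E =
  (((fun t => 4 * B * (t `^ (Re a + Re b - 1) * cabs (G t)))
     \_ [set t | 0 < t]) y)%:E.
Proof.
have -> : (\int[mu]_x (g (x, y))%:E = \int[mu]_(x in `]0%R, y[)
   (4 * cabs (G y) * (x `^ (Re a - 1) * (y - x) `^ (Re b - 1)))%:E)%E.
  rewrite [RHS]integral_mkcond; apply: eq_integral => x _.
  rewrite restrict_EFin /= patchE /g /tri/=.
  have -> : (x \in (`]0, y[%classic : set R)) = (0 < x) && (x < y).
    by apply/idP/idP; rewrite inE/= in_itv.
  by case: ifP => // _; congr EFin; ring.
rewrite patchE; case: ifPn => [|]; rewrite ?inE ?notin_setE/=; last first.
  move=> /negP; rewrite -leNgt => y0; rewrite set_itv_ge ?integral_set0//.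
  by rewrite bnd_simp -leNgt.
move=> y0; have [ib ie] := integrable_beta_scaled a0 b0 y0.
under eq_integral do rewrite EFinM.
rewrite integralZl// -(fineK (integrable_fin_num _ ib))// -EFinM; congr EFin.
by rewrite [X in _ * X]ie -/B -[RHS]/(4 * B * (_ * _)); ring.
Qed.

Let ig : (mu \x mu)%E.-integrable setT (EFin \o g).
Proof.
apply/integrable21ltyP; first exact/measurable_EFinP.
have -> : (\int[mu]_y \int[mu]_x `|(EFin \o g) (x, y)| =
  \int[mu]_y (((fun t => 4 * B * (t `^ (Re a + Re b - 1) * cabs (G t)))
     \_ [set t | 0 < t]) y)%:E)%E.
  apply: eq_integral => y _; rewrite -inner_g; apply: eq_integral => x _ /=.
  by rewrite ger0_norm.
have := integrableZl_real (4 * B) (@measurable_pos R) iG.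
move=> /((@integrable_mkcond _ _ _ mu _ _ (@measurable_pos R)).1).
rewrite restrict_EFin => ih.
by have := integrable_fin_num measurableT ih; rewrite fin_numElt => /andP[].
Qed.

(** Fubini on the triangle [0 < t < w]: integrating over [t] first, at fixed [w], produces a scaled
    Beta integral. Taking [G] to be [e^(-w)] gives the product formula for Gamma; taking [G]
    supported in []0, 1[] merges two Dirichlet coordinates. *)
Lemma beta_convolution :
  Cintegral [set t | 0 < t] (fun t => Cintegral [set w | t < w]
    (fun w => cpow t (a - 1) * cpow (w - t) (b - 1) * G w)) =
  Beta a b * Cintegral [set w | 0 < w] (fun w => cpow w (a + b - 1) * G w).
Proof.
have := CFubini mf fg ig.
have -> : Cintegral setT (fun x => Cintegral setT (fun y => f (x, y))) =
  Cintegral [set t | 0 < t] (fun t => Cintegral [set w | t < w]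
    (fun w => cpow t (a - 1) * cpow (w - t) (b - 1) * G w)).
  rewrite [RHS]Cintegral_mkcond; apply: eq_Cintegral => t _; case: ifPn.
    rewrite inE/= => t0; rewrite [RHS]Cintegral_mkcond; apply: eq_Cintegral => w _.
    have -> : (w \in [set w | t < w]) = (t < w) by apply/idP/idP; rewrite inE.
    by rewrite /f /tri/= t0.
  rewrite notin_setE/= => /negP/negbTE t0; rewrite -[RHS](@Cintegral0 R setT).
  by apply: eq_Cintegral => w _; rewrite /f /tri/= t0.
move=> ->.
have mabG : Cmeasurable [set: R] (fun w => cpow w (a + b - 1) * G w).
  by apply: CmeasurableM => //; apply: Cmeasurable_cpow; exact: measurable_id.
rewrite -CintegralZl//; last 2 first.
- exact: measurable_pos.
- apply: (@Cintegrable_le _ _ _ (fun t => 2 * (t `^ (Re a + Re b - 1) * cabs (G t)))) => //.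
  + exact: measurable_pos.
  + exact: CmeasurableS mabG.
  + move=> t /= t0; apply: (le_trans (cabsM _ _)).
    rewrite mulrA ler_wpM2r ?cabs_ge0//.
    by apply: (le_trans (cabs_cpow _ t0)); rewrite !cReD.
  + by apply: integrableZl_real => //; exact: measurable_pos.
rewrite [RHS]Cintegral_mkcond; apply: eq_Cintegral => w _; case: ifPn.
  rewrite inE/= => w0.
  rewrite mulrA [X in X * _]mulrC -Beta_scaled// -CintegralZr//; last exact: Cintegrable_beta.
  rewrite [RHS]Cintegral_mkcond; apply: eq_Cintegral => t _.
  have -> : (t \in (`]0, w[%classic : set R)) = (0 < t) && (t < w).
    by apply/idP/idP; rewrite inE/= in_itv.
  by [].
rewrite notin_setE/= => /negP; rewrite -leNgt => w0.
rewrite -[RHS](@Cintegral0 R setT); apply: eq_Cintegral => t _.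
rewrite /f /tri/=; case: ifP => // /andP[t0 tw].
by have := lt_le_trans (lt_trans t0 tw) w0; rewrite ltxx.
Qed.

End BetaConvolution.

(** * Functional equation and nonvanishing of Gamma *)

Section GammaFunction.
Variable R : realType.
Local Notation mu := (@lebesgue_measure R).
Local Notation Re := (@complex.Re R).
Local Notation Im := (@complex.Im R).
Implicit Types (z a b : R[i]).

Lemma Cmeasurable_gamma z :
  Cmeasurable [set: R] (fun t : R => cpow t (z - 1) * (expR (- t))%:C).
Proof.
apply: CmeasurableM; first by apply: Cmeasurable_cpow; exact: measurable_id.
apply: Cmeasurable_real; apply: (measurableT_comp (@measurable_expR R)).
exact: oppr_measurable.
Qed.

Lemma Cintegrable_gamma z : 0 < Re z ->
  Cintegrable [set t | 0 < t] (fun t => cpow t (z - 1) * (expR (- t))%:C).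
Proof.
move=> z0.
apply: (@Cintegrable_le _ _ _ (fun t => 2 * (t `^ (Re z - 1) * expR (- t)))).
- exact: measurable_pos.
- exact: CmeasurableS (Cmeasurable_gamma z).
- move=> t /= t0; apply: (le_trans (cabsM _ _)).
  rewrite cabs_real (gtr0_norm (expR_gt0 _)) mulrA ler_wpM2r ?expR_ge0//.
  by apply: (le_trans (cabs_cpow _ t0)); rewrite cReD.
- by apply: integrableZl_real; [exact: measurable_pos|exact: integrable_gamma].
Qed.

(** In [beta_convolution] with [G w = e^(-w)], the translation [w = t + u] splits the exponential
    and the double integral becomes a product. *)
Lemma Gamma_Beta a b : 0 < Re a -> 0 < Re b ->
  Gamma a * Gamma b = Beta a b * Gamma (a + b).
Proof.
move=> a0 b0.
pose E (t : R) : R[i] := (expR (- t))%:C.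
have mE : Cmeasurable [set: R] E.
  apply: Cmeasurable_real; apply: (measurableT_comp (@measurable_expR R)).
  exact: oppr_measurable.
rewrite {3}/Gamma -(beta_convolution (G := E) a0 b0)//; last first.
  have := integrable_gamma (addr_gt0 a0 b0).
  congr (_.-integrable _ _); apply/funext => t /=; congr ((_ * _)%:E).
  by rewrite /E cabs_real ger0_norm ?expR_ge0.
rewrite {1}/Gamma -CintegralZr; [|exact: measurable_pos|exact: Cintegrable_gamma].
apply: eq_Cintegral => t /= t0.
pose h (u : R) := cpow u (b - 1) * (expR (- u))%:C.
transitivity (Cintegral ((fun w => 1 * w - t) @^-1` [set u | 0 < u])
   (fun w => cpow t (a - 1) * (expR (- t))%:C * h (1 * w - t))).
  rewrite (@Cintegral_affine R 1 (- t) _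
    (fun u => cpow t (a - 1) * (expR (- t))%:C * h u))//; last 2 first.
  - exact: measurable_pos.
  - apply: CmeasurableM; first exact: Cmeasurable_cst.
    exact: CmeasurableS (Cmeasurable_gamma b).
  rewrite normr1 invr1 mul1r CintegralZl//; first exact: measurable_pos.
  exact: Cintegrable_gamma.
have -> : (fun w => 1 * w - t) @^-1` [set u : R | 0 < u] = [set w | t < w].
  by apply/seteqP; split => w /=; rewrite mul1r subr_gt0.
apply: eq_Cintegral => w /= tw; rewrite /h mul1r /E.
have -> : (expR (- w))%:C = (expR (- t))%:C * (expR (- (w - t)))%:C :> R[i].
  by rewrite -rmorphM/= -expRD; congr (expR _)%:C; ring.
by ring.
Qed.

Lemma Gamma1 : Gamma 1 = 1 :> R[i].
Proof.
have e1 : 0 < (1 : R) by [].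
have h : \int[mu]_(t in [set t | 0 < t]) expR (- t) = 1.
  rewrite /Rintegral -[RHS]/(fine 1%:E) -(integral_exponential_pdf e1).
  congr fine; rewrite integral_mkcond.
  (* The density equals 1 at 0, a point that the domain [0 < t] excludes; deleting this null set
     makes the two integrands agree. *)
  have -> : (\int[mu]_x (exponential_pdf 1 x)%:E =
    \int[mu]_(x in [set~ (0%R : R)]) (exponential_pdf 1 x)%:E)%E.
    rewrite -setTD -negligible_integral//.
    - exact: integrable_exponential_pdf.
    - exact: lebesgue_measure_set1.
  rewrite [RHS]integral_mkcond; apply: eq_integral => t _.
  rewrite !patchE.
  have [t0|t0|->] := ltgtP 0 t.
  - rewrite !mem_set//=; last by move=> t00; rewrite t00 ltxx in t0.
    by rewrite exponential_pdfE ?(ltW t0)// mul1r mulN1r.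
  - rewrite memNset/=; last by apply/negP; rewrite -leNgt ltW.
    rewrite mem_set/=; last by move=> t00; rewrite t00 ltxx in t0.
    by rewrite lt0_exponential_pdf.
  - rewrite memNset/= ?ltxx// memNset//=; exact.
rewrite /Gamma (eq_Cintegral (g := fun t => (expR (- t))%:C)); last first.
  by move=> t _; rewrite subrr cpow0 mul1r.
apply: complex_ext => //=; by rewrite /Rintegral integral0_eq.
Qed.

Lemma is_derive_cos_cpow z (t : R) : 0 < t ->
  is_derive t 1 (fun s : R => Re (cpow s z)) (t^-1 * Re (z * cpow t z)).
Proof.
move=> t0; have dln := is_derive1_ln t0.
under eq_fun do rewrite Re_cpow.
rewrite cReM Re_cpow Im_cpow.
have dl (c : R) : is_derive t 1 (fun s => c * ln s) (c * t^-1).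
  exact: is_deriveZ.
have dE := @is_derive1_comp R expR (fun s => Re z * ln s) t _ _ (is_derive_expR _) (dl (Re z)).
have dC := @is_derive1_comp R cos (fun s => Im z * ln s) t _ _ (is_derive_cos _) (dl (Im z)).
apply: (is_derive_eq (is_deriveM dE dC)).
rewrite /GRing.scale/=; ring.
Qed.

Lemma is_derive_sin_cpow z (t : R) : 0 < t ->
  is_derive t 1 (fun s : R => Im (cpow s z)) (t^-1 * Im (z * cpow t z)).
Proof.
move=> t0; have dln := is_derive1_ln t0.
under eq_fun do rewrite Im_cpow.
rewrite cImM Re_cpow Im_cpow.
have dl (c : R) : is_derive t 1 (fun s => c * ln s) (c * t^-1).
  exact: is_deriveZ.
have dE := @is_derive1_comp R expR (fun s => Re z * ln s) t _ _ (is_derive_expR _) (dl (Re z)).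
have dC := @is_derive1_comp R sin (fun s => Im z * ln s) t _ _ (is_derive_sin _) (dl (Im z)).
apply: (is_derive_eq (is_deriveM dE dC)).
rewrite /GRing.scale/=; ring.
Qed.

Lemma is_derive_unique (f : R -> R) (t d1 d2 : R) :
  is_derive t 1 f d1 -> is_derive t 1 f d2 -> d1 = d2.
Proof. by move=> [_ <-] [_ <-]. Qed.

Lemma is_derive_near (f g : R -> R) (t d : R) :
  (\forall s \near t, f s = g s) -> is_derive t 1 f d -> is_derive t 1 g d.
Proof.
move=> fg [df <-]; apply: DeriveDef.
  by apply: (near_eq_derivable (f := f)) => //; rewrite oner_eq0.
by apply/esym/near_eq_derive => //; rewrite oner_eq0.
Qed.

Lemma Cintegrable_cpow z (y : R) : 0 < Re z -> 0 < y ->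
  Cintegrable `]0, y[ (fun t => cpow t (z - 1)).
Proof.
move=> z0 y0; have := @Cintegrable_beta R z 1 y z0 ltr01 y0.
rewrite (_ : (fun t : R => _) = (fun t : R => cpow t (z - 1)))//.
by apply/funext => t; rewrite subrr cpow0 mulr1.
Qed.

(* The scaling relation int_0^y t^(z-1) dt = y^z Beta z 1 is differentiated
   at y = 1. *)
Lemma Beta_1r z : 0 < Re z -> z * Beta z 1 = 1.
Proof.
move=> z0; set B := Beta z 1.
have hB y : 0 < y -> Cintegral `]0, y[ (fun t => cpow t (z - 1)) = cpow y z * B.
  move=> y0; have := @Beta_scaled R z 1 y z0 ltr01 y0.
  rewrite addrK => <-; apply: eq_Cintegral => t _.
  by rewrite subrr cpow0 mulr1.
have y2 : 0 < (2 : R) by [].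
have y12 : (1 : R) < 2 by rewrite ltr1n.
have ic (y : R) : 0 < y -> mu.-integrable `]0, y] (EFin \o (fun t => Re (cpow t (z - 1)))) /\
    mu.-integrable `]0, y] (EFin \o (fun t => Im (cpow t (z - 1)))).
  move=> y0; have [h1 h2] := @Cintegrable_cpow z (y + 1) z0 (addr_gt0 y0 ltr01).
  by split; [move: h1|move: h2]; apply: integrableS => //;
    apply: subset_itvl; rewrite bnd_simp ltrDl.
have itv0 (y : R) : 0 < y ->
    \int[mu]_(t in `]0, y]) Re (cpow t (z - 1)) = Re (cpow y z * B) /\
    \int[mu]_(t in `]0, y]) Im (cpow t (z - 1)) = Im (cpow y z * B).
  move=> y0; rewrite -hB//=; have [h1 h2] := @Cintegrable_cpow z y z0 y0.
  by split; rewrite -Rintegral_itv_bndo_bndc.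
have cc (g : R -> R) : (exists d, is_derive (1 : R) 1 g d) -> {for 1, continuous g}.
  move=> [d hd]; apply: differentiable_continuous; apply/derivable1_diffP.
  exact: (@ex_derive _ _ _ _ _ _ _ hd).
have lt01b : (BRight (0 : R) < BRight (1 : R))%O by rewrite bnd_simp.
have near0 : \forall s \near (1 : R), 0 < s by exact: lt_nbhsr.
apply: complex_ext.
- have [dF FTC] := @continuous_FTC1 R (fun t => Re (cpow t (z - 1))) (BRight 0) 1 2 y12
    (ic _ y2).1 lt01b (cc _ (ex_intro _ _ (@is_derive_cos_cpow _ _ ltr01))).
  have d1 := is_deriveB (is_deriveZ (Re B) (@is_derive_cos_cpow z _ ltr01))
                        (is_deriveZ (Im B) (@is_derive_sin_cpow z _ ltr01)).
  have d2 : is_derive (1 : R) 1 (fun y => \int[mu]_(t in `]0, y]) Re (cpow t (z - 1))) 1.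
    by apply: DeriveDef => //; rewrite -derive1E FTC cpow_1.
  rewrite -[RHS]/(1 : R) -[RHS](is_derive_unique (is_derive_near _ d1) d2); last first.
    near=> s; have s0 : 0 < s by near: s.
    rewrite (itv0 _ s0).1 cReM fctE/= [in RHS]mulrC (mulrC _ (Im B)); exact.
  rewrite invr1 !mul1r cpow_1 mulr1 cReM /GRing.scale/=; ring.
- have [dF FTC] := @continuous_FTC1 R (fun t => Im (cpow t (z - 1))) (BRight 0) 1 2 y12
    (ic _ y2).2 lt01b (cc _ (ex_intro _ _ (@is_derive_sin_cpow _ _ ltr01))).
  have d1 := is_deriveD (is_deriveZ (Im B) (@is_derive_cos_cpow z _ ltr01))
                        (is_deriveZ (Re B) (@is_derive_sin_cpow z _ ltr01)).
  have d2 : is_derive (1 : R) 1 (fun y => \int[mu]_(t in `]0, y]) Im (cpow t (z - 1))) 0.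
    by apply: DeriveDef => //; rewrite -derive1E FTC cpow_1.
  rewrite -[RHS]/(0 : R) -[RHS](is_derive_unique (is_derive_near _ d1) d2); last first.
    near=> s; have s0 : 0 < s by near: s.
    rewrite (itv0 _ s0).2 cImM fctE/= [in RHS]mulrC (mulrC _ (Re B)); exact.
  rewrite invr1 !mul1r cpow_1 mulr1 cImM /GRing.scale/=; ring.
Unshelve. all: by end_near.
Qed.

(** The Beta relation at [b = 1] stands in for an integration by parts, since [Beta z 1] is
    [1/z]. *)
Lemma GammaS z : 0 < Re z -> Gamma (z + 1) = z * Gamma z.
Proof.
move=> z0; have := Gamma_Beta z0 (b := 1) ltr01.
rewrite Gamma1 mulr1 => ->.
by rewrite mulrA Beta_1r// mul1r.
Qed.

(** Real moments in which the lower bound of [Gamma_neq0_large] is expressed; their recursion is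
    read off the complex one. *)
Let rgamma (p : R) := \int[mu]_(t in [set t | 0 < t]) (t `^ (p - 1) * expR (- t)).

Let rgammaE (p : R) : Gamma p%:C = (rgamma p)%:C.
Proof.
rewrite /Gamma (eq_Cintegral (g := fun t => (t `^ (p - 1) * expR (- t))%:C)); last first.
  move=> t /= t0; rewrite rmorphM/=; congr (_ * _).
  have -> : (p%:C - 1 : R[i]) = (p - 1)%:C by rewrite rmorphB.
  by rewrite /cpow -rmorphM/= cexp_real /powR gt_eqF.
by apply: complex_ext => //=; rewrite /Rintegral integral0_eq.
Qed.

Let rgammaS (p : R) : 0 < p -> rgamma (p + 1) = p * rgamma p.
Proof.
move=> p0; have := @GammaS p%:C p0.
have -> : (p%:C + 1 : R[i]) = (p + 1)%:C by rewrite rmorphD.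
by rewrite !rgammaE -rmorphM/= => -[].
Qed.

(** For [p >= 1] the integrand is at least [e^(-2)] on []1, 2[]. *)
Let rgamma_gt0 (p : R) : 1 <= p -> 0 < rgamma p.
Proof.
move=> p1; have p0 : 0 < p by exact: lt_le_trans p1.
have mI : measurable (`]1, 2[%classic : set R) by exact: measurable_itv.
apply: (@lt_le_trans _ _ (\int[mu]_(t in [set t | 0 < t]) (expR (- 2) * \1_`]1, 2[ t))).
  rewrite RintegralZl//; last 2 first.
  - exact: measurable_pos.
  - apply: (@integrableS _ _ _ _ setT) => //; first exact: measurable_pos.
    by apply: integrable_indic_itv.
  rewrite mulr_gt0 ?expR_gt0// /Rintegral integral_indic//; last exact: measurable_pos.
  rewrite setIidl/=; last first.
    by move=> t /=; rewrite in_itv/= => /andP[t1 _]; exact: lt_trans t1.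
  by rewrite lebesgue_measure_itv/= lte_fin ltr1n/= subr_gt0 ltr1n.
apply: le_Rintegral; first exact: measurable_pos.
- apply: integrableZl_real; first exact: measurable_pos.
  apply: (@integrableS _ _ _ _ setT) => //; first exact: measurable_pos.
  by apply: integrable_indic_itv.
- exact: integrable_gamma.
move=> t /= t0; rewrite indicE.
case: (boolP (t \in _)) => [|_]; last by rewrite mulr0 mulr_ge0 ?powR_ge0 ?expR_ge0.
rewrite inE/= in_itv/= => /andP[t1 t2]; rewrite mulr1 -[leLHS]mul1r.
apply: ler_pM; rewrite ?expR_ge0 ?ler_expR//; last by rewrite lerN2 ltW.
by rewrite -[leLHS](powRr0 t) ler_powR ?subr_ge0// ltW.
Qed.

(** By the half-angle formula [cos x = 1 - 2 sin^2 (x/2)] this reduces to [sin^2 h <= h^2], a mean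
    value estimate. *)
Lemma cos_ge_quad (x : R) : 1 - x ^+ 2 / 2 <= cos x.
Proof.
have sle (h : R) : sin h ^+ 2 <= h ^+ 2.
  wlog h0 : h / 0 <= h => [hw|].
    have [/hw//|/ltW h0] := leP 0 h.
    by have := hw (- h); rewrite sinN !sqrrN; apply; rewrite oppr_ge0.
  have [c _] := @MVT_segment R sin cos 0 h h0 (fun x _ => is_derive_sin x)
     (continuous_subspaceT (@continuous_sin R)).
  rewrite sin0 !subr0 => ->; rewrite exprMn ler_piMl ?sqr_ge0//.
have xE : x = (x / 2) *+ 2 by rewrite -mulr_natr; field.
rewrite xE; move: (x / 2) => h; rewrite cos_mulr2n cos2sin2; move: (sle h).
have -> : (h *+ 2) ^+ 2 / 2 = 2 * h ^+ 2 by rewrite -mulr_natr; field.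
rewrite -(mulr_natr (1 - _)); lra.
Qed.

(** The right-hand side is [(u - 1/u)^2]. For [u >= 1] one has [0 <= ln u <= u - 1 <= u - 1/u], and
    both sides are invariant under [u -> 1/u]. *)
Let sqr_ln_le (u : R) : 0 < u -> ln u ^+ 2 <= u ^+ 2 - 2 + u^-1 ^+ 2.
Proof.
move=> u0.
have key (v : R) : 1 <= v -> ln v ^+ 2 <= v ^+ 2 - 2 + v^-1 ^+ 2.
  move=> v1; have v0 : 0 < v by exact: lt_le_trans v1.
  have -> : v ^+ 2 - 2 + v^-1 ^+ 2 = (v - v^-1) ^+ 2 by field; rewrite gt_eqF.
  have l0 : 0 <= ln v by rewrite ln_ge0.
  have l1 : ln v <= v - 1.
    by have := @le_ln1Dx R (v - 1); rewrite (addrC 1) subrK; apply; lra.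
  have v2 : v^-1 <= 1 by rewrite invf_le1.
  by rewrite ler_sqr ?nnegrE//; lra.
have [u1|u1] := leP 1 u; first exact: key.
have := key u^-1; rewrite lnV ?posrE// sqrrN invrK => h.
by apply: (le_trans (h _)); [rewrite invf_ge1// ltW|lra].
Qed.

(** With [Y < p/13] the expression is at least [p^2 (11p/13 - 3) + 2p], and [11p/13 > 3] as soon as
    [p >= 4]. This is where the constants 4 and 13 come from. *)
Let moment_combination_gt0 (p Y : R) : 4 <= p -> 0 <= Y -> 13 * Y < p ->
  0 < p ^+ 3 - 3 * p ^+ 2 + 2 * p - Y * (2 * p ^+ 2 - 5 / 2 * p + 1).
Proof.
move=> p4 Y0 py.
have h1 : Y * (2 * p ^+ 2 - 5 / 2 * p + 1) <= p / 13 * (2 * p ^+ 2).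
  by apply: ler_pM => //; [nra|lra|lra].
have h2 : 0 <= p ^+ 2 * (11 / 13 * p - 3) by rewrite mulr_ge0 ?sqr_ge0//; lra.
have h3 : p ^+ 2 * (11 / 13 * p - 3) = p ^+ 3 - 3 * p ^+ 2 - p / 13 * (2 * p ^+ 2) by field.
lra.
Qed.

(* Re (c^(-iy) Gamma(p + iy)) is the integral of
   t^(p-1) e^(-t) cos(y ln(t/c)); with c = p, cos x >= 1 - x^2/2 and
   (ln u)^2 <= u^2 - 2 + u^-2 bound it below by moments of the Gamma law. *)
Let Gamma_neq0_large (p y : R) : 4 <= p -> 13 * y ^+ 2 < p ->
  Gamma (p +i* y) != 0.
Proof.
move=> p4 py; have p0 : 0 < p by lra.
pose z : R[i] := p +i* y.
have z0 : 0 < Re z by [].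
pose w : R[i] := cpow p (- (0 +i* y)).
apply/eqP => Gz.
have Gw : Re (w * Gamma z) = 0 by rewrite /z Gz mulr0.
have mD := @measurable_pos R.
have := Cintegrable_gamma z0 => iz.
move: Gw; rewrite /Gamma -CintegralZl//.
rewrite [LHS](_ : _ = \int[mu]_(t in [set t | 0 < t])
  Re (w * (cpow t (z - 1) * (expR (- t))%:C)))//.
pose h (c : R) (t : R) := t `^ (c - 1) * expR (- t).
rewrite (@eq_Rintegral _ _ _ mu _ (fun t => h p t * cos (y * ln (t / p)))); last first.
  move=> t /set_mem t0; have {}t0 : 0 < t := t0.
  have -> : w * (cpow t (z - 1) * (expR (- t))%:C) =
      cexp ((p - 1) * ln t +i* (y * ln (t / p))) * (expR (- t))%:C.
    rewrite mulrA /w /cpow -cexpD; congr (cexp _ * _).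
    rewrite ln_div ?posrE//; apply: complex_ext; rewrite ?(cReD, cImD, cReM, cImM)/=; ring.
  by rewrite cReM/= mulr0 subr0 /h /powR gt_eqF// mulrAC.
have ih (c : R) : 0 < c -> mu.-integrable [set t | 0 < t] (EFin \o h c).
  exact: integrable_gamma.
(* The lower bound, expanded so that its integral is a combination of the moments at [p], [p + 2]
   and [p - 2]. *)
pose k t := (1 + y ^+ 2) * h p t -
  (y ^+ 2 / 2 * p ^- 2 * h (p + 2) t + y ^+ 2 / 2 * p ^+ 2 * h (p - 2) t).
have i1 : mu.-integrable [set t | 0 < t] (EFin \o (fun t => (1 + y ^+ 2) * h p t)).
  by apply: integrableZl_real => //; exact: ih.
have i2 : mu.-integrable [set t | 0 < t]
    (EFin \o (fun t => y ^+ 2 / 2 * p ^- 2 * h (p + 2) t)).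
  by apply: integrableZl_real => //; apply: ih; lra.
have i3 : mu.-integrable [set t | 0 < t]
    (EFin \o (fun t => y ^+ 2 / 2 * p ^+ 2 * h (p - 2) t)).
  by apply: integrableZl_real => //; apply: ih; lra.
have i23 : mu.-integrable [set t | 0 < t]
    (EFin \o (fun t => y ^+ 2 / 2 * p ^- 2 * h (p + 2) t + y ^+ 2 / 2 * p ^+ 2 * h (p - 2) t)).
  by have := @integrableD _ _ _ mu _ mD _ _ i2 i3.
have ik : mu.-integrable [set t | 0 < t] (EFin \o k).
  by have := @integrableB _ _ _ mu _ mD _ _ i1 i23.
have iC : mu.-integrable [set t | 0 < t] (EFin \o (fun t => h p t * cos (y * ln (t / p)))).
  apply: (@le_integrable_real _ _ _ (h p)) => //; last exact: ih.
    apply: measurable_funTS; apply: measurable_funM.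
      apply: measurable_funM; first exact: measurable_powR.
      by apply: (measurableT_comp (@measurable_expR R)); exact: oppr_measurable.
    apply: (@measurableT_comp _ _ _ _ _ _ cos).
      by apply: continuous_measurable_fun; exact: continuous_cos.
    apply: measurable_funM; first exact: measurable_cst.
    apply: (measurableT_comp (@measurable_ln R)).
    by apply: measurable_funM; [exact: measurable_id|exact: measurable_cst].
  move=> t _; rewrite normrM ger0_norm ?mulr_ge0 ?powR_ge0 ?expR_ge0//.
  by rewrite ler_piMr ?cos_max ?mulr_ge0 ?powR_ge0 ?expR_ge0.
have kle t : 0 < t -> k t <= h p t * cos (y * ln (t / p)).
  move=> t0; have tN : t != 0 by rewrite gt_eqF.
  pose u := t / p; have u0 : 0 < u by rewrite divr_gt0.
  have hp0 : 0 <= h p t by rewrite mulr_ge0 ?powR_ge0 ?expR_ge0.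
  apply: (@le_trans _ _ (h p t * (1 - y ^+ 2 / 2 * (u ^+ 2 - 2 + u^-1 ^+ 2)))).
    have e2 : h (p + 2) t = t ^+ 2 * h p t.
      rewrite /h mulrA -(powR_mulrn 2 (ltW t0)) -powRD ?tN ?implybT//.
      by congr (_ `^ _ * _); ring.
    have e3 : h p t = t ^+ 2 * h (p - 2) t.
      rewrite /h mulrA -(powR_mulrn 2 (ltW t0)) -powRD ?tN ?implybT//.
      by congr (_ `^ _ * _); ring.
    rewrite /k e2 e3 /u le_eqVlt; apply/orP; left; apply/eqP; field.
    by rewrite !gt_eqF.
  rewrite ler_wpM2l//; apply: le_trans (cos_ge_quad _).
  rewrite lerD2l lerN2 exprMn mulrAC ler_wpM2l//; last exact: sqr_ln_le.
  by rewrite divr_ge0 ?sqr_ge0.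
move=> G0.
have : \int[mu]_(t in [set t | 0 < t]) k t <= 0.
  by rewrite -[leRHS]G0; apply: le_Rintegral.
rewrite RintegralB// RintegralD// !RintegralZl//; try (by apply: ih; lra).
rewrite -!/(rgamma _).
have g1 : rgamma p = (p - 1) * ((p - 2) * rgamma (p - 2)).
  rewrite -rgammaS; last by lra.
  have -> : p - 1 = p - 2 + 1 by ring.
  rewrite -rgammaS; last by lra.
  by congr rgamma; ring.
have g2 : rgamma (p + 2) = (p + 1) * (p * rgamma p).
  rewrite -rgammaS// -rgammaS; last by lra.
  by congr rgamma; ring.
have gp : 0 < rgamma (p - 2) by apply: rgamma_gt0; lra.
rewrite g2 g1; set g := rgamma _.
set Y := y ^+ 2; have Y0 : 0 <= Y by exact: sqr_ge0.
have pN : p != 0 by rewrite gt_eqF.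
(* Once all moments are multiples of [rgamma (p - 2)], the cubic terms in the coefficient of [Y]
   cancel, thanks to centring the logarithm at [p]. Hence [p] only has to dominate a multiple of
   [Y]. *)
pose E := p ^+ 3 - 3 * p ^+ 2 + 2 * p - Y * (2 * p ^+ 2 - 5 / 2 * p + 1).
rewrite [leLHS](_ : _ = g * p^-1 * E); last by rewrite /E /g; field.
by rewrite leNgt !mulr_gt0 ?invr_gt0// moment_combination_gt0.
Qed.

(* GammaS propagates a zero to arguments with arbitrarily large real part. *)
Lemma Gamma_neq0 z : 0 < Re z -> Gamma z != 0.
Proof.
case: z => x y /= x0; apply/eqP => Gz.
(* A shift by [k] meets both requirements of [Gamma_neq0_large] at once, the imaginary part being
   unchanged. *)
pose k := (Num.truncn (4 + 13 * y ^+ 2)).+1.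
have hk : 4 + 13 * y ^+ 2 < k%:R.
  by rewrite truncnS_gt.
have Gk (j : nat) : Gamma ((x + j%:R) +i* y) = 0.
  elim: j => [|j IH]; first by rewrite addr0.
  have -> : (x + j.+1%:R) +i* y = ((x + j%:R) +i* y) + 1 :> R[i].
    by apply: complex_ext; rewrite /= ?addr0// -natr1 addrA.
  rewrite GammaS ?IH ?mulr0//=.
  by rewrite ltr_wpDr.
have := @Gamma_neq0_large (x + k%:R) y.
rewrite Gk eqxx => h.
have y2 : 0 <= y ^+ 2 by exact: sqr_ge0.
suff : false by [].
by apply: h; lra.
Qed.

End GammaFunction.

(** * Continuity of parametric integrals *)

Section ComplexContinuity.
Variable R : realType.
Local Notation Re := (@complex.Re R).
Local Notation Im := (@complex.Im R).

Definition Ccontinuous (T : topologicalType) (f : T -> R[i]) :=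
  continuous (fun t => Re (f t) : R) /\ continuous (fun t => Im (f t) : R).

Lemma Ccontinuous_comp (T U : topologicalType) (f : U -> R[i]) (g : T -> U) :
  Ccontinuous f -> continuous g -> Ccontinuous (fun t => f (g t)).
Proof.
move=> [f1 f2] cg; split => t.
  by apply: (@continuous_comp _ _ _ g (fun u => Re (f u))); [exact: cg|exact: f1].
by apply: (@continuous_comp _ _ _ g (fun u => Im (f u))); [exact: cg|exact: f2].
Qed.

Lemma CcontinuousM (T : topologicalType) (f g : T -> R[i]) :
  Ccontinuous f -> Ccontinuous g -> Ccontinuous (fun t => f t * g t).
Proof.
move=> [f1 f2] [g1 g2]; split => t.
  under eq_fun do rewrite cReM.
  by apply: cvgB; apply: cvgM; [exact: f1|exact: g1|exact: f2|exact: g2].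
under eq_fun do rewrite cImM.
by apply: cvgD; apply: cvgM; [exact: f1|exact: g2|exact: f2|exact: g1].
Qed.

Lemma continuous_pair (T U V : topologicalType) (f : T -> U) (g : T -> V) :
  continuous f -> continuous g -> continuous (fun t => (f t, g t)).
Proof.
by move=> cf cg t; apply: (@cvg_pair _ _ _ _ (nbhs (f t)) (nbhs (g t)));
  [exact: cf|exact: cg].
Qed.

Lemma Ccontinuous_cst (T : topologicalType) c :
  Ccontinuous (fun _ : T => c).
Proof. by split => t; exact: cvg_cst. Qed.

Lemma Ccontinuous_real (T : topologicalType) (f : T -> R) :
  continuous f -> Ccontinuous (fun t => (f t)%:C).
Proof. by move=> cf; split => t; [exact: cf|exact: cvg_cst]. Qed.

Lemma Ccontinuous_sum (T : topologicalType) I (s : seq I) (f : I -> T -> R[i]) :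
  (forall i, Ccontinuous (f i)) -> Ccontinuous (fun t => \sum_(i <- s) f i t).
Proof.
move=> cf; elim: s => [|i s [IH1 IH2]].
  by under eq_fun do rewrite big_nil; exact: Ccontinuous_cst.
split => t; under eq_fun do rewrite big_cons ?(cReD, cImD).
  by apply: cvgD; [exact: (cf i).1|exact: IH1].
by apply: cvgD; [exact: (cf i).2|exact: IH2].
Qed.

Lemma Ccontinuous_cexp (T : topologicalType) (f : T -> R[i]) :
  Ccontinuous f -> Ccontinuous (fun t => cexp (f t)).
Proof.
move=> [f1 f2]; split => t /=.
  apply: cvgM.
    by apply: (@continuous_comp _ _ _ (fun t => Re (f t)) expR); [exact: f1|exact: continuous_expR].
  by apply: (@continuous_comp _ _ _ (fun t => Im (f t)) cos); [exact: f2|exact: continuous_cos].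
apply: cvgM.
  by apply: (@continuous_comp _ _ _ (fun t => Re (f t)) expR); [exact: f1|exact: continuous_expR].
by apply: (@continuous_comp _ _ _ (fun t => Im (f t)) sin); [exact: f2|exact: continuous_sin].
Qed.

Lemma Ccontinuous_Cmeasurable (f : R -> R[i]) (D : set R) :
  Ccontinuous f -> Cmeasurable D f.
Proof.
by move=> [f1 f2]; split; apply: measurable_funTS; exact: continuous_measurable_fun.
Qed.

Lemma Ccontinuous_cabs (T : topologicalType) (f : T -> R[i]) :
  Ccontinuous f -> continuous (fun t => cabs (f t)).
Proof.
move=> [f1 f2] t; apply: cvgD; apply: cvg_norm; [exact: f1|exact: f2].
Qed.

Lemma cvg_rV (T : Type) (F : set_system T) (FF : Filter F) n
    (u : T -> 'rV[R]_n) (l : 'rV[R]_n) :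
  (forall i, u t 0 i @[t --> F] --> l 0 i) -> u t @[t --> F] --> l.
Proof.
move=> ul; apply/cvg_ballP => e e0.
have h : \forall t \near F, forall i : 'I_n, ball (l 0 i) e (u t 0 i).
  by apply: filter_forall => i; move/cvg_ballP : (ul i); exact.
by apply: filterS h => t ht; split => // i j; rewrite ord1; exact: ht.
Qed.

Lemma continuous_rV (T : topologicalType) n (u : T -> 'rV[R]_n) :
  (forall i, continuous (fun t => u t 0 i)) -> continuous u.
Proof. by move=> cu t; apply: cvg_rV => i; exact: cu. Qed.

Lemma continuous_coord (T : topologicalType) n (u : T -> 'rV[R]_n) i :
  continuous u -> continuous (fun t => u t 0 i).
Proof.
move=> cu t; apply: (@continuous_comp _ _ _ u (fun M : 'rV[R]_n => M 0 i)).
  exact: cu.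
exact: coord_continuous.
Qed.

End ComplexContinuity.

(** * Continuity of integrals in a parameter *)

Section ParametricIntegral.
Variable R : realType.
Local Notation mu := (@lebesgue_measure R).
Local Notation Re := (@complex.Re R).
Local Notation Im := (@complex.Im R).

Lemma Ccontinuous_bounded (f : R -> R[i]) : Ccontinuous f ->
  exists M, forall t, 0 <= t <= 1 -> cabs (f t) <= M.
Proof.
move=> cf; have [c _ hc] := @EVT_max R (fun t => cabs (f t)) 0 1 ler01
  (continuous_subspaceT (Ccontinuous_cabs cf)).
by exists (cabs (f c)) => t t01; apply: hc; rewrite in_itv.
Qed.

Lemma CintegrableM_continuous (w f : R -> R[i]) :
  Cintegrable `]0, 1[ w -> Ccontinuous f ->
  Cintegrable `]0, 1[ (fun t => w t * f t).
Proof.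
move=> iw cf; have [M hM] := Ccontinuous_bounded cf.
have mI : measurable (`]0, 1[%classic : set R) by exact: measurable_itv.
apply: (@Cintegrable_le _ _ _ (fun t => M * cabs (w t))) => //.
- apply: CmeasurableM; first exact: Cintegrable_measurable.
  exact: Ccontinuous_Cmeasurable.
- move=> t; rewrite /= in_itv/= => /andP[t0 t1]; apply: (le_trans (cabsM _ _)).
  by rewrite mulrC ler_wpM2r ?cabs_ge0// hM// !ltW.
- by apply: integrableZl_real => //; exact: integrable_cabs.
Qed.

(** Tube lemma: by compactness of [[0, 1]], the local estimates around the points [(p0, t)] hold
    over one common neighbourhood of [p0]. *)
Lemma near_uniform (T : topologicalType) (H : T * R -> R) (p0 : T) (e : R) :
  continuous H -> 0 < e ->
  \forall p \near p0, forall t, 0 <= t <= 1 -> `|H (p, t) - H (p0, t)| < e.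
Proof.
move=> cH e0.
have := @segment_compact R 0 1.
move=> /compact_near_coveringP/(_ T (nbhs p0) (fun p t => `|H (p, t) - H (p0, t)| < e) _).
have h (t : R) : `[0, 1]%classic t -> \forall t' \near t & p \near nbhs p0,
    `|H (p, t') - H (p0, t')| < e.
  move=> _; have e2 : 0 < e / 2 by rewrite divr_gt0.
  have /cvgr_dist_lt/(_ _ e2) [[A B] /= [Ap Bt] AB] := cH (p0, t).
  exists (B, A) => // -[t' p] /= [Bt' Ap'].
  have h1 := AB (p, t') (conj Ap' Bt').
  have h2 := AB (p0, t') (conj (nbhs_singleton Ap) Bt').
  rewrite -(subrKA (H (p0, t))) (le_lt_trans (ler_normD _ _))//.
  by rewrite [ltRHS](splitr e) ltrD// distrC.
move=> /(_ h); apply: filterS => p hp t t01.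
by apply: hp; rewrite /= in_itv.
Qed.

(** The parameter space is an arbitrary topological space, so the argument is not sequential: the
    increment of the integral is bounded by the uniform increment of [H] times the integral of
    [cabs w]. *)
Lemma Ccontinuous_Cintegral (T : topologicalType) (w : R -> R[i])
    (H : T * R -> R[i]) :
  Cintegrable `]0, 1[ w -> Ccontinuous H ->
  Ccontinuous (fun p => Cintegral `]0, 1[ (fun t => w t * H (p, t))).
Proof.
move=> iw [H1 H2].
have mI : measurable (`]0, 1[%classic : set R) by exact: measurable_itv.
have cp p : Ccontinuous (fun t => H (p, t)).
  apply: (@Ccontinuous_comp _ _ _ H (fun t => (p, t))) => //.
  by apply: continuous_pair => t; [exact: cvg_cst|exact: cvg_id].
pose C := \int[mu]_(t in `]0, 1[) cabs (w t).
have C0 : 0 <= C by apply: Rintegral_ge0 => t _; exact: cabs_ge0.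
have main p0 e : 0 < e -> \forall p \near p0,
    cabs (Cintegral `]0, 1[ (fun t => w t * H (p, t)) -
          Cintegral `]0, 1[ (fun t => w t * H (p0, t))) < e.
  (* One factor 2 is lost in [cabs] of the increment of [H], another in [cabs_Cintegral]; [C + 1]
     avoids a division by 0 and makes the final inequality strict. *)
  move=> e0; pose d := e / (4 * (C + 1)).
  have d0 : 0 < d by rewrite divr_gt0// mulr_gt0// ltr_wpDl.
  have n1 := near_uniform p0 H1 d0.
  have n2 := near_uniform p0 H2 d0.
  near=> p.
  rewrite -CintegralB//; [|exact: CintegrableM_continuous..].
  rewrite (eq_Cintegral (g := fun t => w t * (H (p, t) - H (p0, t)))); last first.
    by move=> t _; rewrite mulrBr.
  apply: (@le_lt_trans _ _ (2 * \int[mu]_(t in `]0, 1[) (2 * d * cabs (w t)))).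
    apply: cabs_Cintegral => //.
    - apply: CmeasurableM; first exact: Cintegrable_measurable.
      have [a1 a2] := cp p; have [b1 b2] := cp p0.
      apply: Ccontinuous_Cmeasurable; split => t.
        under eq_fun do rewrite cReD cReN.
        by apply: cvgB; [exact: a1|exact: b1].
      under eq_fun do rewrite cImD cImN.
      by apply: cvgB; [exact: a2|exact: b2].
    - move=> t; rewrite /= in_itv/= => /andP[t0 t1]; apply: (le_trans (cabsM _ _)).
      rewrite mulrC ler_wpM2r ?cabs_ge0//.
      have t01 : 0 <= t <= 1 by rewrite !ltW.
      rewrite /cabs cReD cImD cReN cImN mulr2n mulrDl mul1r; apply: lerD; apply: ltW.
        by move: t t01 {t0 t1}; near: p.
      by move: t t01 {t0 t1}; near: p.
    - by apply: integrableZl_real => //; exact: integrable_cabs.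
  rewrite RintegralZl//; last exact: integrable_cabs.
  rewrite -/C /d.
  have -> : 2 * (2 * (e / (4 * (C + 1))) * C) = e * (C / (C + 1)).
    by field; rewrite gt_eqF// ltr_wpDl.
  by rewrite gtr_pMr// ltr_pdivrMr ?ltr_wpDl// mul1r ltrDl.
split => p0; apply/cvgrPdist_lt => e e0; apply: filterS (main p0 e e0) => p.
  move=> h; apply: le_lt_trans h; apply: le_trans (cabs_Re _).
  by rewrite cReD cReN distrC.
move=> h; apply: le_lt_trans h; apply: le_trans (cabs_Im _).
by rewrite cImD cImN distrC.
Unshelve. all: by end_near. Qed.

End ParametricIntegral.

(** * Dirichlet integrals *)

Section DirichletIntegral.
Variable R : realType.
Local Notation mu := (@lebesgue_measure R).
Local Notation Re := (@complex.Re R).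
Local Notation Im := (@complex.Im R).

Definition consV r (t : R) (g : 'rV[R]_r.+1) : 'rV[R]_r.+2 :=
  row_mx (const_mx t : 'rV[R]_1) g.

Lemma consV0 r t (g : 'rV[R]_r.+1) : consV t g 0 ord0 = t.
Proof.
have := row_mxEl (const_mx t : 'rV[R]_1) g 0 ord0; rewrite [RHS]mxE => e; rewrite -[RHS]e.
by congr (fun_of_matrix _ 0 _); exact: val_inj.
Qed.

Lemma consVS r t (g : 'rV[R]_r.+1) i : consV t g 0 (lift ord0 i) = g 0 i.
Proof.
rewrite -(row_mxEr (const_mx t : 'rV[R]_1) g 0 i).
by congr (fun_of_matrix _ 0 _); exact: val_inj.
Qed.

Lemma consVP r (g : 'rV[R]_r.+2) (t : R) (h : 'rV[R]_r.+1) :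
  g 0 ord0 = t -> (forall i, g 0 (lift ord0 i) = h 0 i) -> g = consV t h.
Proof.
move=> g0 gS; apply/rowP => i; have [j ->|->] := unliftP ord0 i.
  by rewrite consVS.
by rewrite consV0.
Qed.

Lemma continuous_consV (T : topologicalType) r (t : T -> R) (g : T -> 'rV[R]_r.+1) :
  continuous t -> continuous g -> continuous (fun x => consV (t x) (g x)).
Proof.
move=> ct cg; apply: continuous_rV => i; have [j ->|->] := unliftP ord0 i.
  by under eq_fun do rewrite consVS; exact: continuous_coord.
by under eq_fun do rewrite consV0.
Qed.

Lemma continuous_scaleV (T : topologicalType) n (t : T -> R) (g : T -> 'rV[R]_n) :
  continuous t -> continuous g -> continuous (fun x => t x *: g x).
Proof.
move=> ct cg; apply: continuous_rV => i.
under eq_fun do rewrite mxE.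
by move=> x; apply: cvgM; [exact: ct|exact: (continuous_coord cg)].
Qed.

Lemma continuous_consV_scale r (t c : R) :
  continuous (fun g : 'rV[R]_r.+1 => consV t (c *: g)).
Proof.
apply: (@continuous_consV 'rV[R]_r.+1 r (fun=> t) (fun g => c *: g)).
  exact: cst_continuous.
by apply: (@continuous_scaleV 'rV[R]_r.+1 _ (fun=> c) id) => q; [exact: cst_continuous|exact: cvg_id].
Qed.

Lemma continuous_consV_id r (t : R) : continuous (fun g : 'rV[R]_r.+1 => consV t g).
Proof.
have := @continuous_consV_scale r t 1.
by under eq_fun do rewrite scale1r.
Qed.

(* The integral of F(g) prod_i g_i^(al_i - 1) over the simplex in the
   stick-breaking coordinates g = (t, (1 - t) g'), whose Jacobian is absorbed
   in the exponent of 1 - t. *)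
Fixpoint dirichlet (r : nat) : ('I_r.+1 -> R[i]) -> ('rV[R]_r.+1 -> R[i]) -> R[i] :=
  match r with
  | 0 => fun _ F => F (const_mx 1)
  | r'.+1 => fun al F => Cintegral `]0, 1[ (fun t =>
      cpow t (al ord0 - 1) * cpow (1 - t) (\sum_i al (lift ord0 i) - 1)
      * @dirichlet r' (fun i => al (lift ord0 i))
          (fun g => F (consV t ((1 - t) *: g))))
  end.

Lemma Re_sum_gt0 r (al : 'I_r.+1 -> R[i]) :
  (forall i, 0 < Re (al i)) -> 0 < Re (\sum_i al i).
Proof.
move=> al0; rewrite cRe_sum big_ord_recl ltr_wpDr ?sumr_ge0// => i _.
exact: ltW.
Qed.

(** The induction is uniform in the parameter space: the outer integration variable joins the
    parameter, [T] becoming [T * R], so that the inner integral is jointly continuous. *)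
Lemma Ccontinuous_dirichlet (T : topologicalType) r (al : 'I_r.+1 -> R[i])
    (F : T * 'rV[R]_r.+1 -> R[i]) :
  (forall i, 0 < Re (al i)) -> Ccontinuous F ->
  Ccontinuous (fun p => dirichlet al (fun g => F (p, g))).
Proof.
elim: r T al F => [|r IH] T al F al0 cF.
  have c1 : continuous (fun p : T => (p, const_mx 1 : 'rV[R]_1)).
    by apply: continuous_pair => t; [exact: cvg_id|exact: cvg_cst].
  exact: (Ccontinuous_comp cF c1).
pose H (q : T * R) := dirichlet (fun i => al (lift ord0 i))
  (fun g => F (q.1, consV q.2 ((1 - q.2) *: g))).
apply: (@Ccontinuous_Cintegral _ _ _ H).
  by apply: Cintegrable_beta => //; exact: Re_sum_gt0.
pose F' (q : (T * R) * 'rV[R]_r.+1) := F (q.1.1, consV q.1.2 ((1 - q.1.2) *: q.2)).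
apply: (IH _ _ F') => //; apply: (Ccontinuous_comp cF).
have c1 : continuous (fun q : (T * R) * 'rV[R]_r.+1 => q.1).
  by move=> q; exact: cvg_fst.
have c2 : continuous (fun q : (T * R) * 'rV[R]_r.+1 => q.2).
  by move=> q; exact: cvg_snd.
have c12 : continuous (fun q : (T * R) * 'rV[R]_r.+1 => q.1.2).
  move=> q; apply: (@continuous_comp _ _ _ (fun q => q.1) snd); first exact: c1.
  exact: cvg_snd.
have c11 : continuous (fun q : (T * R) * 'rV[R]_r.+1 => q.1.1).
  move=> q; apply: (@continuous_comp _ _ _ (fun q => q.1) fst); first exact: c1.
  exact: cvg_fst.
apply: continuous_pair => //; apply: continuous_consV => //.
apply: continuous_scaleV => // q; apply: cvgB; [exact: cvg_cst|exact: c12].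
Qed.

Lemma Ccontinuous_dirichlet_slice r (al : 'I_r.+1 -> R[i]) (F : 'rV[R]_r.+2 -> R[i]) (s : R) :
  (forall i, 0 < Re (al i)) -> Ccontinuous F ->
  Ccontinuous (fun t : R => dirichlet al (fun g => F (consV t ((s - t) *: g)))).
Proof.
move=> al0 cF.
apply: (@Ccontinuous_dirichlet _ r al (fun q => F (consV q.1 ((s - q.1) *: q.2)))) => //.
apply: (Ccontinuous_comp cF); apply: continuous_consV; first by move=> q; exact: cvg_fst.
apply: continuous_scaleV; last by move=> q; exact: cvg_snd.
by move=> q; apply: cvgB; [exact: cvg_cst|exact: cvg_fst].
Qed.

Lemma eq_dirichlet r (al al' : 'I_r.+1 -> R[i]) (F F' : 'rV[R]_r.+1 -> R[i]) :
  al =1 al' -> (forall g, simplex g -> F g = F' g) ->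
  dirichlet al F = dirichlet al' F'.
Proof.
move=> /funext <- {al'}; elim: r al F F' => [|r IH] al F F' FF'.
  apply: FF'; split; first by move=> k; rewrite mxE.
  by rewrite big_ord_recl big_ord0 mxE addr0.
apply: eq_Cintegral => t; rewrite /= in_itv/= => /andP[t0 t1].
congr (_ * _); apply: IH => g [g0 gs]; apply: FF'; split.
  move=> k; have [j ->|->] := unliftP ord0 k; rewrite ?consV0 ?consVS ?(ltW t0)//.
  by rewrite mxE mulr_ge0// subr_ge0 ltW.
rewrite big_ord_recl consV0; under eq_bigr do rewrite consVS mxE.
by rewrite -mulr_sumr gs mulr1 addrC subrK.
Qed.

Lemma Cintegral_itv_cc_oo (x y : R) (f : R -> R[i]) :
  Cmeasurable `]x, y[ f -> Cintegral `[x, y] f = Cintegral `]x, y[ f.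
Proof.
move=> [f1 f2]; rewrite /Cintegral.
have key (k : R -> R) : measurable_fun `]x, y[ k ->
    \int[mu]_(t in `[x, y]) k t = \int[mu]_(t in `]x, y[) k t.
  move=> mk; rewrite /Rintegral -integral_itv_obnd_cbnd; last first.
    by apply/measurable_EFinP; exact/measurable_fun_itv_bndo_bndcP.
  by rewrite -integral_itv_bndo_bndc//; exact/measurable_EFinP.
by rewrite !key.
Qed.

(* The coordinates may vanish only on a null set, so it suffices to know the
   integrand where they are positive. *)
Lemma scaled_simplex_integralE r (al : 'I_r.+1 -> R[i]) (F f : 'rV[R]_r.+1 -> R[i])
    (s : R) (c : R[i]) :
  0 < s -> (forall i, 0 < Re (al i)) -> Ccontinuous F ->
  (forall g : 'rV[R]_r.+1, (forall i, 0 < g 0 i) -> \sum_i g 0 i = s ->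
     f g = c * (F g * \prod_i cpow (g 0 i) (al i - 1))) ->
  scaled_simplex_integral s f =
  c * cpow s (\sum_i al i - 1) * dirichlet al (fun h => F (s *: h)).
Proof.
elim: r al F f s c => [|r IH] al F f s c s0 al0 cF fE.
  rewrite /= fE; last 2 first.
  - by move=> i; rewrite mxE.
  - by rewrite big_ord_recl big_ord0 mxE addr0.
  rewrite !big_ord_recl !big_ord0 mxE mulr1 addr0 -!mulrA; congr (_ * _).
  rewrite mulrC; congr (_ * F _).
  by apply/rowP => i; rewrite !mxE mulr1.
set al' := fun i => al (lift ord0 i).
have al'0 i : 0 < Re (al' i) by exact: al0.
set A := \sum_i al' i.
have A0 : 0 < Re A by exact: Re_sum_gt0.
pose Q t := dirichlet al' (fun g => F (consV t ((s - t) *: g))).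
have inner t : 0 < t < s -> scaled_simplex_integral (s - t)
    (fun g => f (row_mx (const_mx t : 'rV[R]_1) g)) =
    c * (cpow t (al ord0 - 1) * cpow (s - t) (A - 1) * Q t).
  move=> /andP[t0 ts].
  (* The power of the first coordinate is constant for the inner integral; the free multiplier [c]
     in the statement is there to carry it. *)
  rewrite (IH al' (fun g => F (consV t g)) _ (s - t) (c * cpow t (al ord0 - 1)))//.
  - by rewrite -!mulrA.
  - by rewrite subr_gt0.
  - exact: (Ccontinuous_comp cF (@continuous_consV_id _ t)).
  - move=> g g0 gs; rewrite -/(consV t g) fE.
    + rewrite [in LHS]big_ord_recl consV0 -!mulrA; congr (_ * _); rewrite mulrCA.
      by congr (_ * (_ * _)); apply: eq_bigr => i _; rewrite consVS.
    + by move=> k; have [j ->|->] := unliftP ord0 k; rewrite ?consV0 ?consVS.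
    + rewrite big_ord_recl consV0; under eq_bigr do rewrite consVS.
      by rewrite gs addrC subrK.
have cQ : Ccontinuous Q by exact: Ccontinuous_dirichlet_slice.
pose h t := c * (cpow t (al ord0 - 1) * cpow (s - t) (A - 1) * Q t).
have mh : Cmeasurable (`]0, s[%classic : set R) h.
  apply: CmeasurableM; first exact: Cmeasurable_cst.
  by apply: CmeasurableM; [exact: Cmeasurable_beta|exact: Ccontinuous_Cmeasurable].
rewrite [LHS]/=.
(* The hypothesis on [f] concerns positive coordinates only, so the two endpoints, a null set, are
   dropped before [inner] is used. *)
rewrite Cintegral_itv_cc_oo; last first.
  case: mh => h1 h2; split.
    apply: (eq_measurable_fun _ _ h1) => t; rewrite inE/= in_itv/= => ts.
    by rewrite inner.
  apply: (eq_measurable_fun _ _ h2) => t; rewrite inE/= in_itv/= => ts.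
  by rewrite inner.
rewrite (eq_Cintegral (g := h)); last by move=> t; rewrite /= in_itv/=; exact: inner.
have sV : s^-1 != 0 by rewrite invr_eq0 gt_eqF.
(* This is [h] after the substitution [t = s u]: the two powers yield the exponent minus 2, and the
   Jacobian restores one factor [s]. *)
pose k u := c * cpow s (\sum_i al i - 2%:R) *
  (cpow u (al ord0 - 1) * cpow (1 - u) (A - 1) * Q (s * u)).
have mk : Cmeasurable (`]0, 1[%classic : set R) k.
  apply: CmeasurableM; first exact: Cmeasurable_cst.
  apply: CmeasurableM; first exact: Cmeasurable_beta.
  apply: Ccontinuous_Cmeasurable; apply: (Ccontinuous_comp cQ) => q.
  by apply: cvgM; [exact: cvg_cst|exact: cvg_id].
have := @Cintegral_affine R s^-1 0 _ k sV (measurable_itv _) mk.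
rewrite preimage_scale// (eq_Cintegral (g := h)); last first.
  move=> t; rewrite /= in_itv/= => /andP[t0 ts].
  rewrite /k /h addr0 big_ord_recl -/A.
  have x1 : 0 < s^-1 * t by rewrite mulr_gt0 ?invr_gt0.
  have x2 : 0 < 1 - s^-1 * t by rewrite subr_gt0 mulrC ltr_pdivrMr// mul1r.
  have e1 : t = s * (s^-1 * t) by field; rewrite gt_eqF.
  have e2 : s - t = s * (1 - s^-1 * t) by field; rewrite gt_eqF.
  rewrite [in RHS]e2 -e1 [X in _ = _ * (cpow X _ * _ * _)]e1.
  rewrite (cpowM _ s0 x1) (cpowM _ s0 x2).
  have -> : al ord0 + A - 2%:R = (al ord0 - 1) + (A - 1) by ring.
  rewrite (cpowD s (al ord0 - 1)); ring.
move=> ->.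
rewrite normfV invrK gtr0_norm// /k CintegralZl//; last first.
  apply: CintegrableM_continuous; first exact: Cintegrable_beta.
  apply: (Ccontinuous_comp cQ) => q.
  by apply: cvgM; [exact: cvg_cst|exact: cvg_id].
rewrite mulrA; congr (_ * _).
  rewrite mulrCA; congr (_ * _); rewrite -cpowr1// -cpowD.
  by congr (cpow _ _); ring.
apply: eq_Cintegral => u _; congr (_ * _); rewrite /Q; congr dirichlet.
apply/funext => g; congr F; apply: esym; apply: consVP => [|i].
  by rewrite mxE consV0.
by rewrite mxE consVS !mxE; ring.
Qed.

End DirichletIntegral.

(** * Aggregation of Dirichlet integrals over blocks *)

Section DirichletAggregation.
Variable R : realType.
Local Notation mu := (@lebesgue_measure R).
Local Notation Re := (@complex.Re R).
Local Notation Im := (@complex.Im R).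

(** Adds the first two entries into one. It is generic in the monoid because it acts on complex
    exponents and on real coordinates alike. *)
Definition merge (A : nmodType) r (al : 'I_r.+2 -> A) (i : 'I_r.+1) : A :=
  (if i == ord0 then al ord0 else 0) + al (lift ord0 i).

Definition mergeV r (g : 'rV[R]_r.+2) : 'rV[R]_r.+1 := \row_i merge (g 0) i.

Lemma continuous_addr (T : topologicalType) (f g : T -> R) :
  continuous f -> continuous g -> continuous (fun x => f x + g x).
Proof. by move=> cf cg x; apply: cvgD; [exact: cf|exact: cg]. Qed.

Lemma continuous_mulr (T : topologicalType) (f g : T -> R) :
  continuous f -> continuous g -> continuous (fun x => f x * g x).
Proof. by move=> cf cg x; apply: cvgM; [exact: cf|exact: cg]. Qed.

Lemma Cintegral_widen (D E : set R) (f g : R -> R[i]) : D `<=` E ->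
  (forall t, D t -> f t = g t) -> (forall t, E t -> ~ D t -> g t = 0) ->
  Cintegral D f = Cintegral E g.
Proof.
move=> DE fg g0; rewrite [LHS]Cintegral_mkcond [RHS]Cintegral_mkcond.
apply: eq_Cintegral => t _; case: ifPn => [/set_mem tD|/negP tD].
  by rewrite (mem_set (DE _ tD)) fg.
case: ifPn => // /set_mem tE; rewrite g0// => tD'; apply: tD; exact: mem_set.
Qed.

(** With first coordinates [t] and [(1 - t) u], the merged one is [w = t + (1 - t) u], and the rest
    is scaled by [(1 - t)(1 - u) = 1 - w]. In the variables [(t, w)] the integrand is that of
    [beta_convolution]. With only two coordinates there is no rest, and the claim is the definition
    of [Beta]. *)
Lemma dirichlet_merge r (al : 'I_r.+2 -> R[i]) (F : 'rV[R]_r.+1 -> R[i]) :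
  (forall i, 0 < Re (al i)) -> Ccontinuous F ->
  dirichlet al (fun g => F (mergeV g)) =
  Beta (al ord0) (al (lift ord0 ord0)) * dirichlet (merge al) F.
Proof.
case: r al F => [|r] al F al0 cF.
  rewrite /= /Beta -CintegralZr//; last exact: Cintegrable_beta.
  apply: eq_Cintegral => t _; rewrite big_ord_recl big_ord0 addr0; congr (_ * F _).
  apply/rowP => i; rewrite !mxE !ord1 /merge eqxx consV0 consVS !mxE.
  by rewrite mulr1 addrC subrK.
set a0 := al ord0; set a1 := al (lift ord0 ord0).
pose al2 i := al (lift ord0 (lift ord0 i)).
set A2 := \sum_i al2 i.
have a00 : 0 < Re a0 by exact: al0.
have a10 : 0 < Re a1 by exact: al0.
have A20 : 0 < Re A2 by apply: Re_sum_gt0 => i; exact: al0.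
pose Q w := dirichlet al2 (fun g => F (consV w ((1 - w) *: g))).
have cQ : Ccontinuous Q by apply: Ccontinuous_dirichlet_slice => // i; exact: al0.
(* All that depends on [w] alone, cut off outside []0, 1[] so that the half-line integrals of
   [beta_convolution] reduce to integrals over the simplex. *)
pose G w := if (0 < w) && (w < 1) then cpow (1 - w) (A2 - 1) * Q w else 0.
have mG : Cmeasurable [set: R] G.
  apply: Cmeasurable_if.
    by apply: measurable_and; apply: measurable_fun_ltr => //; exact: measurable_cst.
  apply: CmeasurableM; last exact: Ccontinuous_Cmeasurable.
  by apply: Cmeasurable_cpow; apply: measurable_funB => //; exact: measurable_cst.
have iG : mu.-integrable [set t | 0 < t]
    (EFin \o (fun t => t `^ (Re a0 + Re a1 - 1) * cabs (G t))).
  have [M hM] := Ccontinuous_bounded cQ.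
  have ib := integrable_beta (addr_gt0 a00 a10) A20.
  pose k t := M * 2 * (t `^ (Re a0 + Re a1 - 1) * (1 - t) `^ (Re A2 - 1)).
  have ik : mu.-integrable setT (EFin \o (k \_ `]0, 1[)).
    rewrite -restrict_EFin.
    apply: ((@integrable_mkcond _ _ _ mu `]0, 1[%classic _ (measurable_itv _)).1 _).
    by apply: integrableZl_real => //; exact: measurable_itv.
  apply: (@le_integrable_real _ _ _ (k \_ `]0, 1[)).
  - exact: measurable_pos.
  - apply: measurable_funTS; apply: measurable_funM; first exact: measurable_powR.
    case: mG => m1 m2; apply: measurable_funD; exact: (measurableT_comp (@normr_measurable R setT)).
  - move=> t /= t0; rewrite ger0_norm ?mulr_ge0 ?powR_ge0 ?cabs_ge0// patchE /G t0/=.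
    have -> : (t \in (`]0, 1[%classic : set R)) = (t < 1).
      by apply/idP/idP; rewrite inE/= in_itv/= t0.
    case: ifP => t1; last by rewrite /cabs /= normr0 addr0 mulr0.
    rewrite /k mulrCA ler_wpM2l ?powR_ge0//; apply: (le_trans (cabsM _ _)).
    rewrite mulrC -mulrA; apply: ler_pM; rewrite ?cabs_ge0// ?hM ?(ltW t0) ?(ltW t1)//.
    by apply: (le_trans (cabs_cpow _ _)); rewrite ?subr_gt0// cReD.
  - by apply: integrableS ik => //; exact: measurable_pos.
have := @beta_convolution R a0 a1 G a00 a10 mG iG.
have -> : Cintegral [set w | 0 < w] (fun w => cpow w (a0 + a1 - 1) * G w) =
    dirichlet (merge al) F.
  apply/esym; apply: Cintegral_widen.
  - by move=> t; rewrite /= in_itv/= => /andP[].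
  - move=> t; rewrite /= in_itv/= => /andP[t0 t1].
    rewrite /G t0 t1/= -!mulrA; congr (cpow _ (_ - 1) * _).
    congr (cpow _ (_ - 1) * _).
      by apply: eq_bigr => i _; rewrite /merge add0r.
    by apply: eq_dirichlet => // i; rewrite /merge add0r.
  - move=> t /= t0; rewrite in_itv/= t0/= => /negP/negbTE t1.
    by rewrite /G t0 t1/= mulr0.
move=> <-; apply: Cintegral_widen.
- by move=> t; rewrite /= in_itv/= => /andP[].
- move=> t; rewrite /= in_itv/= => /andP[t0 t1].
  have s0 : 0 < 1 - t by rewrite subr_gt0.
  have sN : 1 - t != 0 by rewrite gt_eqF.
  have sV : (1 - t)^-1 != 0 by rewrite invr_eq0.
  set A1 := \sum_i al (lift ord0 i).
  have A1E : A1 = a1 + A2 by rewrite /A1 big_ord_recl.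
  pose k u := cpow t (a0 - 1) * cpow (1 - t) (A1 - 1) *
    (cpow u (a1 - 1) * cpow (1 - u) (A2 - 1) * Q (t + (1 - t) * u)).
  have cQt : Ccontinuous (fun u : R => Q (t + (1 - t) * u)).
    apply: (Ccontinuous_comp cQ) => q; apply: cvgD; first exact: cvg_cst.
    by apply: cvgM; [exact: cvg_cst|exact: cvg_id].
  have ik : Cintegrable `]0, 1[
      (fun u => cpow u (a1 - 1) * cpow (1 - u) (A2 - 1) * Q (t + (1 - t) * u)).
    by apply: CintegrableM_continuous => //; exact: Cintegrable_beta.
  have mk : Cmeasurable (`]0, 1[%classic : set R) k.
    apply: CmeasurableM; first exact: Cmeasurable_cst.
    exact: Cintegrable_measurable.
  transitivity (Cintegral `]0, 1[ k).
    rewrite /k CintegralZl//; congr (_ * _).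
    apply: eq_Cintegral => u _; congr (_ * _); rewrite /Q; apply: eq_dirichlet => // g _.
    congr F; apply: consVP => [|i].
      by rewrite mxE /merge eqxx consV0 consVS mxE consV0.
    by rewrite mxE /merge add0r consVS mxE consVS !mxE; ring.
  have ik' : Cintegrable `]0, 1[ k by exact: CintegrableMl.
  (* The factor is the Jacobian of the change from [u] to [w]. *)
  pose f u := ((1 - t)^-1)%:C * k u.
  have mf : Cmeasurable (`]0, 1[%classic : set R) f.
    by apply: CmeasurableM => //; exact: Cmeasurable_cst.
  have := @Cintegral_affine R (1 - t)^-1 (- t / (1 - t)) _ f sV (measurable_itv _) mf.
  rewrite normfV invrK gtr0_norm// => e.
  transitivity ((1 - t)%:C * Cintegral `]0, 1[ f).
    by rewrite /f CintegralZl// mulrA -rmorphM/= mulfV// mul1r.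
  rewrite -e {e}.
  have -> : (fun x : R => (1 - t)^-1 * x + - t / (1 - t)) @^-1` `]0, 1[ = `]t, 1[%classic.
    apply/seteqP; split => x /=; rewrite !in_itv/= mulrC -mulrDl.
      by rewrite pmulr_lgt0 ?invr_gt0// ltr_pdivrMr// mul1r subr_gt0 ltrD2r.
    by rewrite pmulr_lgt0 ?invr_gt0// ltr_pdivrMr// mul1r subr_gt0 ltrD2r.
  apply: Cintegral_widen.
  + by move=> w; rewrite /= in_itv/= => /andP[].
  + move=> w; rewrite /= in_itv/= => /andP[tw w1].
    rewrite /G (lt_trans t0 tw) w1/= /f /k.
    set u := (1 - t)^-1 * w + _.
    have uE : u = (w - t) / (1 - t) by rewrite /u; field.
    have u0 : 0 < u by rewrite uE divr_gt0// subr_gt0.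
    have u1 : 0 < 1 - u by rewrite uE subr_gt0 ltr_pdivrMr// mul1r ltrD2r.
    have e1 : w - t = (1 - t) * u by rewrite uE; field.
    have e2 : 1 - w = (1 - t) * (1 - u) by rewrite uE; field.
    have e3 : t + (1 - t) * u = w by rewrite -e1 addrC subrK.
    rewrite e3 e1 e2 (cpowM _ s0 u0) (cpowM _ s0 u1) A1E.
    have -> : a1 + A2 - 1 = ((a1 - 1) + (A2 - 1)) + 1 by ring.
    rewrite (cpowD (1 - t) _ 1) cpowr1// (cpowD (1 - t) (a1 - 1) (A2 - 1)).
    rewrite -[RHS]mul1r.
    have -> : 1 = ((1 - t)^-1)%:C * (1 - t)%:C :> R[i] by rewrite -rmorphM/= mulVf.
    ring.
  + move=> w /= tw; rewrite in_itv/= tw/= => /negP/negbTE w1.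
    by rewrite /G w1 andbF mulr0.
- move=> t /= t0; rewrite in_itv/= t0/= => /negP; rewrite -leNgt => t1.
  rewrite -(@Cintegral0 R [set w | t < w]); apply: eq_Cintegral => w /= tw.
  by rewrite /G [w < 1]ltNge (ltW (le_lt_trans t1 tw)) andbF mulr0.
Qed.

Definition collapse (A : nmodType) n r (p : 'I_n -> 'I_r) (al : 'I_n -> A) (i : 'I_r) : A :=
  \sum_(k | p k == i) al k.

Definition collapseV n r (p : 'I_n -> 'I_r) (g : 'rV[R]_n) : 'rV[R]_r :=
  \row_i collapse p (g 0) i.

Lemma continuous_collapseV n r (p : 'I_n -> 'I_r) : continuous (collapseV p).
Proof.
apply: continuous_rV => i; under eq_fun do rewrite mxE /collapse.
suff h (T : topologicalType) (f : 'I_n -> T -> R) : (forall k, continuous (f k)) ->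
    continuous (fun t => \sum_(k | p k == i) f k t).
  by apply: (@h 'rV[R]_n (fun k g => g 0 k)) => k; exact: coord_continuous.
move=> cf; elim: (index_enum _) => [|k s IH].
  by under eq_fun do rewrite big_nil; exact: cst_continuous.
under eq_fun do rewrite big_cons.
by case: (p k == i) => //; exact: continuous_addr.
Qed.

Lemma sum_collapse (A : nmodType) n r (p : 'I_n -> 'I_r) (al : 'I_n -> A) :
  \sum_i collapse p al i = \sum_k al k.
Proof. by rewrite [RHS](partition_big p xpredT). Qed.

Lemma big_collapse_recl (A : nmodType) n r (p : 'I_n.+1 -> 'I_r) (al : 'I_n.+1 -> A) i :
  collapse p al i = (if p ord0 == i then al ord0 else 0) +
    collapse (fun k => p (lift ord0 k)) (fun k => al (lift ord0 k)) i.
Proof. by rewrite /collapse big_mkcond big_ord_recl -big_mkcond. Qed.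

Lemma collapse_merge (A : nmodType) n r (p : 'I_n.+2 -> 'I_r) (al : 'I_n.+2 -> A) i :
  p ord0 = p (lift ord0 ord0) ->
  collapse p al i = collapse (fun k => p (lift ord0 k)) (merge al) i.
Proof.
move=> p01; rewrite 2!big_collapse_recl [in RHS]big_collapse_recl p01 addrA.
congr (_ + _); last by apply: eq_bigr => k _; rewrite /merge add0r.
by case: ifP => _; rewrite ?addr0// /merge eqxx.
Qed.

(* Both sides are integrated one coordinate at a time: if p identifies the
   first two coordinates they are merged, otherwise the first coordinate is
   kept and the recursion acts on the others. *)
Lemma dirichlet_collapse n r (p : 'I_n.+1 -> 'I_r.+1) (al : 'I_n.+1 -> R[i])
    (F : 'rV[R]_r.+1 -> R[i]) :
  {homo p : k l / (k <= l)%N} -> (forall i, exists k, p k = i) ->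
  (forall k, 0 < Re (al k)) -> Ccontinuous F ->
  (\prod_i Gamma (collapse p al i)) * dirichlet al (fun g => F (collapseV p g)) =
  (\prod_k Gamma (al k)) * dirichlet (collapse p al) F.
Proof.
elim: n r p al F => [|n IH] r p al F pm ps al0 cF.
  (* A single index maps onto a single block only. *)
  have r0 : r = 0%N.
    case: r p F pm ps cF => // r p F _ ps _.
    have [k k0] := ps ord0; have [l l1] := ps ord_max.
    by have := congr1 val (etrans (esym k0) (etrans (congr1 p (etrans (ord1 k) (esym (ord1 l)))) l1)).
  subst r.
  have cE (A : nmodType) (be : 'I_1 -> A) i : collapse p be i = be ord0.
    by rewrite /collapse big_mkcond big_ord_recl big_ord0 Monoid.mulm1 (ord1 i) (ord1 (p _)).
  rewrite !big_ord_recl !big_ord0 !mulr1 cE; congr (_ * F _).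
  by apply/rowP => i; rewrite !mxE cE mxE.
have [p01|p01] := eqVneq (p ord0) (p (lift ord0 ord0)).
  pose p' k := p (lift ord0 k).
  have pm' : {homo p' : k l / (k <= l)%N} by move=> k l kl; apply: pm.
  have ps' i : exists k, p' k = i.
    have [k ki] := ps i; move: ki; have [j ->|->] := unliftP ord0 k => ki.
      by exists j.
    by exists ord0; rewrite /p' -p01.
  have mal0 k : 0 < Re (merge al k).
    rewrite /merge cReD; case: ifP => _; rewrite ?add0r//.
    by rewrite addr_gt0.
  have cF' : Ccontinuous (fun g => F (collapseV p' g)).
    by apply: (Ccontinuous_comp cF); exact: continuous_collapseV.
  have := IH _ p' (merge al) F pm' ps' mal0 cF.
  have -> : collapse p' (merge al) = collapse p al.
    by apply/funext => i; rewrite (collapse_merge _ _ p01).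
  have -> : dirichlet al (fun g => F (collapseV p g)) =
      dirichlet al (fun g => F (collapseV p' (mergeV g))).
    apply: eq_dirichlet => // g _; congr F; apply/rowP => i.
    rewrite !mxE (collapse_merge _ _ p01); apply: eq_bigr => k _.
    by rewrite mxE.
  rewrite (dirichlet_merge al0 cF') mulrCA => ->.
  rewrite mulrA; congr (_ * _).
  rewrite big_ord_recl [in RHS]big_ord_recl [in RHS]big_ord_recl !mulrA.
  rewrite /merge eqxx -Gamma_Beta//; congr (_ * _).
  by apply: eq_bigr => k _; rewrite add0r.
have p0 : p ord0 = ord0.
  have [k k0] := ps ord0; apply: val_inj; apply/eqP; rewrite /= -leqn0.
  by have := pm ord0 k (leq0n _); rewrite k0.
case: r p F pm ps cF p01 p0 => [|r] p F pm ps cF p01 p0.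
  by move: p01; rewrite ![p _]ord1 eqxx.
(* The first index is alone in its block, and by monotonicity no later index returns to it; hence
   the shifted map [q] is again monotone and onto, with one block fewer. *)
have pS k : exists i, p (lift ord0 k) = lift ord0 i.
  have [i ->|pk0] := unliftP ord0 (p (lift ord0 k)); first by exists i.
  have := pm (lift ord0 ord0) (lift ord0 k) (leq_trans (leqnn 1) _); rewrite /= /bump/= => /(_ isT).
  rewrite pk0 leqn0 => /eqP p10; move: p01; rewrite p0 => /eqP; case.
  by apply: val_inj; rewrite /= p10.
pose q k : 'I_r.+1 := projT1 (cid (pS k)).
have qE k : p (lift ord0 k) = lift ord0 (q k) by rewrite /q; case: cid.
have qm : {homo q : k l / (k <= l)%N}.
  move=> k l kl; have := pm (lift ord0 k) (lift ord0 l); rewrite !qE /= /bump/= !add1n !ltnS.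
  exact.
have qs i : exists k, q k = i.
  have [k ki] := ps (lift ord0 i); move: ki; have [j ->|->] := unliftP ord0 k.
    by rewrite qE => /lift_inj <-; exists j.
  by rewrite p0 => /(congr1 val).
pose al' k := al (lift ord0 k).
have al'0 k : 0 < Re (al' k) by exact: al0.
have c0 : collapse p al ord0 = al ord0.
  rewrite big_collapse_recl p0 eqxx /collapse big1 ?addr0// => k /eqP; rewrite qE.
  by move=> /(congr1 val).
have cS i : collapse p al (lift ord0 i) = collapse q al' i.
  rewrite big_collapse_recl p0 add0r; apply: eq_bigl => k.
  by rewrite qE (inj_eq lift_inj).
have cq0 i : 0 < Re (collapse q al' i).
  rewrite /collapse cRe_sum; have [k ki] := qs i.
  rewrite (bigD1 k) ?ki//= ltr_wpDr// sumr_ge0// => l _; exact: ltW.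
rewrite !(big_ord_recl n.+1) (big_ord_recl r.+1) c0 -!mulrA; congr (_ * _).
rewrite (eq_bigr (fun i => Gamma (collapse q al' i))); last by move=> i _; rewrite cS.
set A := \sum_i al' i.
have A0 : 0 < Re A by exact: Re_sum_gt0.
have cont (t : R) : Ccontinuous (fun h : 'rV[R]_r.+1 => F (consV t ((1 - t) *: h))).
  exact: (Ccontinuous_comp cF (@continuous_consV_scale _ _ t (1 - t))).
have colE (t c : R) (g : 'rV[R]_n.+1) : collapseV p (consV t (c *: g)) = consV t (c *: collapseV q g).
  apply: consVP => [|i].
    rewrite mxE big_collapse_recl p0 eqxx consV0 /collapse big1 ?addr0// => k.
    by rewrite qE => /eqP/(congr1 val).
  rewrite !mxE big_collapse_recl p0 add0r /collapse mulr_sumr; apply: eq_big => k.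
    by rewrite qE (inj_eq lift_inj).
  by move=> _; rewrite consVS mxE.
have eL : dirichlet al (fun g => F (collapseV p g)) =
    Cintegral `]0, 1[ (fun t => cpow t (al ord0 - 1) * cpow (1 - t) (A - 1) *
      dirichlet al' (fun g => F (consV t ((1 - t) *: collapseV q g)))).
  by apply: eq_Cintegral => t _; congr (_ * _); apply: eq_dirichlet => // g _; rewrite colE.
have eR : dirichlet (collapse p al) F =
    Cintegral `]0, 1[ (fun t => cpow t (al ord0 - 1) * cpow (1 - t) (A - 1) *
      dirichlet (collapse q al') (fun h => F (consV t ((1 - t) *: h)))).
  apply: eq_Cintegral => t _; rewrite c0; congr (_ * cpow _ (_ - 1) * _).
    by rewrite (eq_bigr _ (fun i _ => cS i)) sum_collapse.
  by apply: eq_dirichlet => // i; exact: cS.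
rewrite eL eR -!CintegralZl//; last 2 first.
- apply: CintegrableM_continuous; last exact: Ccontinuous_dirichlet_slice.
  exact: Cintegrable_beta.
- apply: CintegrableM_continuous; first exact: Cintegrable_beta.
  have cF' : Ccontinuous (fun g => F (collapseV p g)).
    by apply: (Ccontinuous_comp cF); exact: continuous_collapseV.
  have := Ccontinuous_dirichlet_slice 1 al'0 cF'.
  under [X in Ccontinuous X]eq_fun do under eq_fun do rewrite colE.
  exact.
apply: eq_Cintegral => t _; rewrite mulrCA [RHS]mulrCA; congr (_ * _).
exact: IH.
Qed.

End DirichletAggregation.

(** * Sorted and interlacing roots *)

Section SortedRoots.
Variable R : realType.

Definition exp2 (x : R) : R := expR (2 * x).

Lemma exp2_gt0 x : 0 < exp2 x. Proof. exact: expR_gt0. Qed.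

Lemma exp2_inj : injective exp2.
Proof. by move=> x y /expR_inj /mulfI; apply; rewrite pnatr_eq0. Qed.

Lemma ltr_exp2 x y : (exp2 x < exp2 y) = (x < y).
Proof. by rewrite ltr_expR ltr_pM2l. Qed.

Lemma continuous_exp2 (T : topologicalType) (f : T -> R) :
  continuous f -> continuous (fun x => exp2 (f x)).
Proof.
move=> cf x; apply: (@continuous_comp _ _ _ (fun x => 2 * f x) expR).
  by apply: cvgM; [exact: cvg_cst|exact: cf].
exact: continuous_expR.
Qed.

Lemma continuous_subr (T : topologicalType) (f g : T -> R) :
  continuous f -> continuous g -> continuous (fun x => f x - g x).
Proof. by move=> cf cg x; apply: cvgB; [exact: cf|exact: cg]. Qed.

Lemma closed_chamberP n (x : 'rV[R]_n) :
  closed_chamber x <-> sorted >=%R [seq x 0 k | k : 'I_n].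
Proof.
case: n x => [|n] x.
  split => [_|_ [//]]; rewrite (size0nil (s := [seq x 0 k | k : 'I_0]))//.
  by rewrite size_map size_enum_ord.
have sz : size [seq x 0 k | k : 'I_n.+1] = n.+1 by rewrite size_map size_enum_ord.
have nthE (i : 'I_n.+1) : nth 0 [seq x 0 k | k : 'I_n.+1] i = x 0 i.
  by rewrite (nth_map ord0) ?size_enum_ord// nth_ord_enum.
have gtr : transitive (>=%R : rel R) by exact: ge_trans.
split => [hx|/(sorted_leq_nth gtr (@le_refl _ _) 0) hx].
  apply/(sortedP 0) => i; rewrite sz => i1.
  have i0 : (i < n.+1)%N by exact: ltnW.
  by have := hx (Ordinal i0) (Ordinal i1) (ltnSn i); rewrite -!nthE.
move=> i j ij; have := hx i j; rewrite !inE sz !ltn_ord !nthE => h.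
by apply: h => //; exact: ltnW.
Qed.

(** The pointwise form is the one that passes to limits. It suffices because a nonzero difference
    would vanish at as many integers as its size. *)
Lemma exp2_roots_monicP n (p : {poly R}) (x : 'rV[R]_n) : p \is monic ->
  exp2_roots_are p x <-> forall t, p.[t] = \prod_k (t - exp2 (x 0 k)).
Proof.
move=> pm; split => [[_ ->] t|h].
  rewrite (monicP pm) scale1r horner_prod; apply: eq_bigr => k _.
  by rewrite hornerXsubC.
split; first exact: monic_neq0.
rewrite (monicP pm) scale1r; apply/eqP; rewrite -subr_eq0.
set d := _ - _; apply: contraT => d0.
have := @max_poly_roots _ d [seq i%:R | i <- iota 0 (size d)] d0.
rewrite size_map size_iota ltnn; apply.
  apply/allP => t _; rewrite /root /d hornerD hornerN h horner_prod subr_eq0.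
  by apply/eqP; apply: eq_bigr => k _; rewrite hornerXsubC.
rewrite map_inj_uniq ?iota_uniq// => i j /eqP; rewrite eqr_nat; exact/eqP.
Qed.

(** The polynomial determines the multiset of its roots, and a sorted sequence is determined by its
    multiset. *)
Lemma exp2_roots_inj n (p : {poly R}) (x y : 'rV[R]_n) :
  closed_chamber x -> closed_chamber y ->
  exp2_roots_are p x -> exp2_roots_are p y -> x = y.
Proof.
move=> /closed_chamberP cx /closed_chamberP cy [p0 px] [_ py].
have lc0 : lead_coef p != 0 by rewrite lead_coef_eq0.
have : \prod_(z <- [seq exp2 (x 0 k) | k : 'I_n]) ('X - z%:P) =
       \prod_(z <- [seq exp2 (y 0 k) | k : 'I_n]) ('X - z%:P).
  by rewrite !big_image; apply: (scalerI lc0); exact: etrans (esym px) py.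
move=> /prod_XsubC_eq.
have mE (z : 'rV[R]_n) : [seq exp2 (z 0 k) | k : 'I_n] = map exp2 [seq z 0 k | k : 'I_n].
  by rewrite -map_comp.
rewrite !mE.
move=> /(perm_map_inj exp2_inj) xy.
have e : [seq x 0 k | k : 'I_n] = [seq y 0 k | k : 'I_n].
  apply: (sorted_eq _ _ cx cy xy); first exact: ge_trans.
  exact: ge_anti.
apply/rowP => i.
have nthE (z : 'rV[R]_n) : nth 0 [seq z 0 k | k : 'I_n] i = z 0 i.
  by rewrite (nth_map i) ?size_enum_ord// nth_ord_enum.
by rewrite -(nthE x) e nthE.
Qed.

Lemma log_roots_eq n (p : {poly R}) (x : 'rV[R]_n) :
  closed_chamber x -> exp2_roots_are p x -> log_roots n p = x.
Proof.
move=> cx px; apply: xget_subset1 => //= y z [cy py] [cz pz].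
exact: exp2_roots_inj py pz.
Qed.

(** Closed conditions survive at cluster points: a value of [c] above the limit would be separated
    by the midpoint [m] from the values along the filter. *)
Lemma cluster_le (I : Type) (F : set_system I) {FF : ProperFilter F}
    (T : topologicalType) (u : I -> T) (x : T) (c : T -> R) (f : I -> R) (l : R) :
  cluster (u i @[i --> F]) x -> {for x, continuous c} ->
  (\forall i \near F, c (u i) <= f i) -> f i @[i --> F] --> l -> c x <= l.
Proof.
move=> ux cc cf fl; rewrite leNgt; apply/negP => lc.
pose m := (l + c x) / 2.
have lm : l < m by rewrite /m; lra.
have mc : m < c x by rewrite /m; lra.
have n1 : \forall y \near x, m < c y.
  by have h := lt_nbhsr mc; exact (cc _ h).
have n2 : \forall i \near F, c (u i) < m.
  have : \forall i \near F, f i < m.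
    by have h := lt_nbhsl lm; exact (fl _ h).
  by apply: filterS2 cf => i ci fi; exact: le_lt_trans fi.
have [y [/= ym my]] := ux [set y | c y < m] _ n2 n1.
by have := lt_trans ym my; rewrite ltxx.
Qed.

Lemma cluster_eq (I : Type) (F : set_system I) {FF : ProperFilter F}
    (T : topologicalType) (u : I -> T) (x : T) (c : T -> R) (f : I -> R) (l : R) :
  cluster (u i @[i --> F]) x -> {for x, continuous c} ->
  (\forall i \near F, c (u i) = f i) -> f i @[i --> F] --> l -> c x = l.
Proof.
move=> ux cc cf fl; apply/eqP; rewrite eq_le; apply/andP; split.
  by apply: (cluster_le ux cc _ fl); apply: filterS cf => i ->.
rewrite -lerN2; apply: (cluster_le (c := fun y => - c y) ux _ _ (cvgN fl)).
  exact: cvgN.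
by apply: filterS cf => i ->.
Qed.

Lemma continuous_prod_exp2 n (t : R) :
  continuous (fun x : 'rV[R]_n => \prod_k (t - exp2 (x 0 k))).
Proof.
suff h (T : topologicalType) (f : 'I_n -> T -> R) : (forall k, continuous (f k)) ->
    continuous (fun x => \prod_k (t - exp2 (f k x))).
  by apply: (@h 'rV[R]_n (fun k x => x 0 k)) => k; exact: coord_continuous.
move=> cf; elim: (index_enum _) => [|k s IH].
  by under eq_fun do rewrite big_nil; exact: cst_continuous.
under eq_fun do rewrite big_cons.
apply: continuous_mulr => //.
have cN : continuous (fun x => - exp2 (f k x)).
  by move=> x; apply: cvgN; exact: continuous_exp2.
exact: (continuous_addr (f := fun=> t) (@cst_continuous _ _ t) cN).
Qed.

Lemma rV_box_compact n (M : R) :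
  compact [set x : 'rV[R]_n | forall k, `[- M, M]%classic (x 0 k)].
Proof. by apply: (@rV_compact R n (fun=> `[- M, M]%classic)) => k; exact: segment_compact. Qed.

Lemma near_rV_box n (x : 'rV[R]_n) (M : R) : (forall k, `|x 0 k| < M) ->
  nbhs x [set y : 'rV[R]_n | forall k, `[- M, M]%classic (y 0 k)].
Proof.
have FF : Filter (nbhs x) by exact: nbhs_filter.
move=> xM; apply: (filter_forall FF) => k.
have xk : x 0 k \in `]- M, M[ by rewrite in_itv/= -ltr_norml.
have h : \forall y \near x, (y : 'rV[R]_n) 0 k \in `]- M, M[.
  have nk := near_in_itvoo xk; exact (@coord_continuous R 1 n 0 k x _ nk).
by apply: filterS h => y; rewrite /= !in_itv/= => /andP[y1 y2]; rewrite !ltW.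
Qed.

(* Closed graph: every limit point of the sorted roots is again a sorted root
   vector of the limit polynomial, hence is the expected one. *)
Lemma continuous_log_roots (T : topologicalType) n (P : T -> {poly R}) :
  (forall t, P t \is monic) ->
  (forall t, exists x : 'rV[R]_n, closed_chamber x /\ exp2_roots_are (P t) x) ->
  (forall s : R, continuous (fun t => (P t).[s])) ->
  (forall t0 : T, exists M, \forall t \near t0, forall k, `|log_roots n (P t) 0 k| < M) ->
  continuous (fun t => log_roots n (P t)).
Proof.
move=> Pm Pr Pc Pb t0.
pose u t := log_roots n (P t).
have uP t : closed_chamber (u t) /\ exp2_roots_are (P t) (u t).
  by have [x [cx rx]] := Pr t; rewrite /u (log_roots_eq cx rx).
have [M nM] := Pb t0.
pose V := [set x : 'rV[R]_n | forall k, `[- M, M]%classic (x 0 k)].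
have cV : compact V by exact: rV_box_compact.
have uV : \forall t \near t0, V (u t).
  apply: filterS nM => t h k; rewrite /= in_itv/= -ler_norml ltW//; exact: h.
have sub x : cluster (u t @[t --> t0]) x -> x = u t0.
  move=> ux; apply: (@exp2_roots_inj _ (P t0)); last exact: (uP t0).2.
  - move=> i j ij; rewrite -subr_le0.
    apply: (cluster_le (c := fun y : 'rV[R]_n => y 0 j - y 0 i) (f := fun=> 0) ux).
    + by apply: (@continuous_subr 'rV[R]_n (fun y => y 0 j)) => y; exact: coord_continuous.
    + by apply: nearW => t; rewrite subr_le0; exact: (uP t).1.
    + exact: cvg_cst.
  - exact: (uP t0).1.
  - apply/exp2_roots_monicP => // s; apply/esym.
    apply: (cluster_eq (c := fun y : 'rV[R]_n => \prod_k (s - exp2 (y 0 k)))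
      (f := fun t => (P t).[s]) ux).
    + exact: continuous_prod_exp2.
    + by apply: nearW => t; apply/esym; exact: ((exp2_roots_monicP _ (Pm t)).1 (uP t).2 s).
    + exact: Pc.
(* Inside a compact set, a filter with a single cluster point converges to it. *)
apply: (compact_cluster_set1 _ cV) => //.
- by apply: near_rV_box; exact: nbhs_singleton nM.
- apply/seteqP; split => [x|x /= ->]; first exact: sub.
  by have [y [_ cy]] := cV (u t @[t --> t0]) _ uV; rewrite -[X in cluster _ X](sub _ cy).
Qed.

End SortedRoots.

(** * Existence of interlacing roots *)

Section Interlacing.
Variable R : realType.

Lemma horner_mix_poly n (Y b : 'rV[R]_n) t :
  (mix_poly Y b).[t] =
  \sum_p b 0 p * \prod_(j | j != p) (t - exp2 (Y 0 j)).
Proof.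
rewrite /mix_poly horner_sum; apply: eq_bigr => p _.
rewrite hornerZ horner_prod; congr (_ * _); apply: eq_bigr => j _.
by rewrite hornerXsubC.
Qed.

Lemma horner_mix_poly_node n (Y b : 'rV[R]_n) k :
  (mix_poly Y b).[exp2 (Y 0 k)] =
  b 0 k * \prod_(j | j != k) (exp2 (Y 0 k) - exp2 (Y 0 j)).
Proof.
rewrite horner_mix_poly (bigD1 k)//= [X in _ + X]big1 ?addr0// => p pk.
by rewrite (bigD1 k) 1?eq_sym//= subrr mul0r mulr0.
Qed.

(** Each product is monic of degree [n], so the coefficient in degree [n] is the sum of the
    weights. *)
Lemma mix_poly_size_monic n (Y b : 'rV[R]_n.+1) : \sum_k b 0 k = 1 ->
  size (mix_poly Y b) = n.+1 /\ mix_poly Y b \is monic.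
Proof.
move=> b1.
pose q (p : 'I_n.+1) : {poly R} := \prod_(j | j != p) ('X - (exp2 (Y 0 j))%:P).
have sq p : size (q p) = n.+1.
  rewrite /q -big_filter size_prod_XsubC size_filter -sum1_count.
  by rewrite sum1_card cardC1 card_ord.
have lq p : (q p)`_n = 1.
  by have := lead_coef_prod_XsubC (index_enum 'I_n.+1) (predC1 p)
    (fun j => exp2 (Y 0 j)); rewrite /lead_coef -/(q p) sq.
have mE : mix_poly Y b = \sum_p b 0 p *: q p by [].
have cn : (mix_poly Y b)`_n = 1.
  rewrite mE coef_sum -b1; apply: eq_bigr => p _.
  by rewrite coefZ lq mulr1.
have sm : (size (mix_poly Y b) <= n.+1)%N.
  rewrite mE; apply: (leq_trans (size_sum _ _ _)); apply/bigmax_leqP => p _.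
  by rewrite (leq_trans (size_scale_leq _ _))// sq.
have sm' : size (mix_poly Y b) = n.+1.
  apply/eqP; rewrite eqn_leq sm/= ltnNge; apply/negP => h.
  by move: cn; rewrite nth_default// => /eqP; rewrite eq_sym oner_eq0.
by split => //; rewrite monicE /lead_coef sm'/= cn.
Qed.

Lemma interlacing_closed_chamber n (Y : 'rV[R]_n.+1) (x : 'rV[R]_n) :
  closed_chamber Y -> interlacing Y x -> closed_chamber x.
Proof.
move=> cY ix i j ij.
have /andP[_ h1] := ix j; have /andP[h2 _] := ix i.
apply: (le_trans h1); apply: le_trans h2.
have [e|ne] := eqVneq (lift ord0 i) (widen_ord (leqnSn n) j); first by rewrite e.
apply: cY; rewrite /= ltn_neqAle /bump/= add1n ij andbT.
by apply: contra_neq ne => e; exact: val_inj.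
Qed.

(** With distinct nodes and positive weights the values at consecutive nodes have opposite signs.
    The intermediate value theorem gives a root in each of the [n] gaps, which exhausts the
    degree. *)
Let generic_roots n (Y b : 'rV[R]_n.+1) : chamber Y -> (forall k, 0 < b 0 k) ->
  \sum_k b 0 k = 1 ->
  exists x : 'rV[R]_n, interlacing Y x /\ exp2_roots_are (mix_poly Y b) x.
Proof.
move=> cY b0 b1; set q := mix_poly Y b.
pose y k := exp2 (Y 0 k).
have yl (i j : 'I_n.+1) : (i < j)%N -> y j < y i by move=> ij; rewrite ltr_exp2; exact: cY.
have sgn (k : 'I_n) : q.[y (lift ord0 k)] * q.[y (widen_ord (leqnSn n) k)] < 0.
  set k1 := lift ord0 k; set k0 := widen_ord _ k.
  have k01 : (k0 < k1)%N by rewrite /= /bump/= add1n.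
  have kN : k0 != k1 by rewrite -val_eqE neq_ltn k01.
  rewrite /q !horner_mix_poly_node (bigD1 k0)//= [in X in _ * X](bigD1 k1) 1?eq_sym//=.
  have -> : \prod_(j | (j != k0) && (j != k1)) (exp2 (Y 0 k0) - exp2 (Y 0 j)) =
     \prod_(j | (j != k1) && (j != k0)) (y k0 - y j).
    by apply: eq_bigl => j; rewrite andbC.
  rewrite -!/(y _); set P1 := \prod_(j | _) _; set P0 := \prod_(j | _) _.
  (* No node lies between two consecutive ones, so every other node contributes two differences of
     equal sign. *)
  have P01 : 0 < P1 * P0.
    rewrite /P1 /P0 -big_split/=; apply: prodr_gt0 => j /andP[j1 j0].
    have [jk|jk|jk] := ltngtP j k0.
    - by rewrite nmulr_rgt0 subr_lt0; apply: yl => //; exact: ltn_trans k01.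
    - have jk1 : (k1 < j)%N.
        rewrite [X in (X < _)%N](_ : _ = k.+1)// ltn_neqAle jk andbT.
        by apply: contra_neq j1 => e; apply: val_inj; rewrite /= -e.
      by rewrite mulr_gt0 ?subr_gt0//; apply: yl.
    - by move: j0; rewrite -val_eqE /= jk eqxx.
  have -> : b 0 k1 * ((y k1 - y k0) * P0) * (b 0 k0 * ((y k0 - y k1) * P1)) =
    (b 0 k1 * b 0 k0 * (P1 * P0)) * ((y k1 - y k0) * (y k0 - y k1)) by ring.
  rewrite pmulr_rlt0; last by apply: mulr_gt0 => //; exact: mulr_gt0.
  by rewrite nmulr_rlt0 ?subr_lt0 ?subr_gt0; exact: yl.
have yk (k : 'I_n) : y (lift ord0 k) <= y (widen_ord (leqnSn n) k).
  by apply/ltW/yl; rewrite /= /bump/= add1n.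
have hex (k : 'I_n) : exists t,
    (y (lift ord0 k) < t < y (widen_ord (leqnSn n) k)) && root q t.
  have [t + rt] := poly_ivtoo (yk k) (sgn k).
  by rewrite in_itv/= => yt; exists t; rewrite yt.
have [z hz] := choice hex.
have z0 k : 0 < z k.
  by have /andP[/andP[h _] _] := hz k; exact: lt_trans (exp2_gt0 _) h.
pose x : 'rV[R]_n := \row_k (ln (z k) / 2).
have xz k : exp2 (x 0 k) = z k.
  by rewrite /exp2 mxE mulrC divfK// lnK// posrE.
have zl (k l : 'I_n) : (k < l)%N -> z l < z k.
  move=> kl; have /andP[/andP[_ h1] _] := hz l.
  have /andP[/andP[h2 _] _] := hz k.
  apply: (lt_trans h1); apply: le_lt_trans h2.
  have [e|ne] := eqVneq (lift ord0 k) (widen_ord (leqnSn n) l); first by rewrite e.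
  apply: ltW; apply: yl; rewrite /= ltn_neqAle /bump/= add1n kl andbT.
  by apply: contra_neq ne => e; exact: val_inj.
have [sq qm] : size q = n.+1 /\ q \is monic by exact: mix_poly_size_monic.
exists x; split.
  move=> k; have /andP[/andP[h1 h2] _] := hz k.
  by rewrite -!xz !ltr_exp2 in h1 h2; rewrite !ltW.
split; first exact: monic_neq0.
rewrite (eq_bigr (fun k => 'X - (z k)%:P)); last by move=> k _; rewrite -/(exp2 _) xz.
have -> : \prod_k ('X - (z k)%:P) = \prod_(t <- [seq z k | k : 'I_n]) ('X - t%:P).
  by rewrite big_image.
apply: all_roots_prod_XsubC.
- by rewrite sq size_map size_enum_ord.
- by apply/allP => _ /mapP[k _ ->]; have /andP[] := hz k.
- rewrite uniq_rootsE map_inj_uniq ?enum_uniq// => k l kl; apply: val_inj.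
  by case: (ltngtP k l) => // /zl; rewrite kl ltxx.
Qed.

Lemma continuous_oppr (T : topologicalType) (f : T -> R) :
  continuous f -> continuous (fun x => - f x).
Proof. by move=> cf x; apply: cvgN; exact: cf. Qed.

Lemma continuous_bigsum (T : topologicalType) I (s : seq I) (P : pred I) (f : I -> T -> R) :
  (forall i, continuous (f i)) -> continuous (fun x => \sum_(i <- s | P i) f i x).
Proof.
move=> cf; elim: s => [|i s IH].
  by under eq_fun do rewrite big_nil; exact: cst_continuous.
under eq_fun do rewrite big_cons.
by case: (P i) => //; exact: continuous_addr.
Qed.

Lemma continuous_bigprod (T : topologicalType) I (s : seq I) (P : pred I) (f : I -> T -> R) :
  (forall i, continuous (f i)) -> continuous (fun x => \prod_(i <- s | P i) f i x).
Proof.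
move=> cf; elim: s => [|i s IH].
  by under eq_fun do rewrite big_nil; exact: cst_continuous.
under eq_fun do rewrite big_cons.
by case: (P i) => //; exact: continuous_mulr.
Qed.

Lemma continuous_mix_poly (T : topologicalType) n (Y b : T -> 'rV[R]_n) (s : R) :
  continuous Y -> continuous b -> continuous (fun x => (mix_poly (Y x) (b x)).[s]).
Proof.
move=> cY cb; under eq_fun do rewrite horner_mix_poly.
apply: continuous_bigsum => p; apply: continuous_mulr; first exact: continuous_coord.
apply: continuous_bigprod => j; apply: continuous_subr; first exact: cst_continuous.
by apply: continuous_exp2; exact: continuous_coord.
Qed.

Lemma rV_coord_le n (Y : 'rV[R]_n) i : `|Y 0 i| <= \sum_j `|Y 0 j|.
Proof. by rewrite (bigD1 i)//= lerDl sumr_ge0. Qed.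

(* The strictly decreasing chamber points and the positive weights are dense,
   and the interlacing root vectors of the approximations stay in a compact
   box. *)
Lemma interlacing_roots n (Y b : 'rV[R]_n.+1) : closed_chamber Y -> simplex b ->
  exists x : 'rV[R]_n, interlacing Y x /\ exp2_roots_are (mix_poly Y b) x.
Proof.
move=> cY [b0 b1].
(* Subtracting a multiple of the index opens the gaps between equal nodes; mixing with the
   barycentre of the simplex makes all weights positive and keeps their sum. *)
pose Ye (e : R) : 'rV[R]_n.+1 := \row_i (Y 0 i - e * i%:R).
pose be (e : R) : 'rV[R]_n.+1 := \row_i ((1 - e) * b 0 i + e * n.+1%:R^-1).
have be1 e : \sum_k be e 0 k = 1.
  under eq_bigr do rewrite mxE.
  rewrite big_split/= -mulr_sumr b1 mulr1 sumr_const card_ord -[X in _ + X]mulr_natr.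
  by rewrite divfK ?pnatr_eq0// subrK.
(* The range of [e] sits inside the existential so that choice gives a function on the whole
   line. *)
have hex e : exists x : 'rV[R]_n, 0 < e <= 1 ->
    interlacing (Ye e) x /\ exp2_roots_are (mix_poly (Ye e) (be e)) x.
  case: (boolP (0 < e <= 1)) => [/andP[e0 e1]|_]; last by exists 0.
  have [x hx] : exists x : 'rV[R]_n, interlacing (Ye e) x /\
      exp2_roots_are (mix_poly (Ye e) (be e)) x.
    apply: generic_roots => //.
      move=> i j ij; rewrite !mxE ler_ltB ?ltr_pM2l ?ltr_nat//.
      exact: cY.
    move=> k; rewrite mxE ltr_wpDl ?mulr_ge0 ?subr_ge0//.
    by rewrite divr_gt0.
  by exists x.
have [u hu] := choice hex.
pose F := at_right (0 : R).
have FF : ProperFilter F by exact: at_right_proper_filter.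
have nF : \forall e \near F, 0 < e <= 1.
  by near=> e; apply/andP; split => //; near: e; exact: nbhs_right_le.
pose M := \sum_j `|Y 0 j| + n%:R.
have cYi i : continuous (fun e => Ye e 0 i).
  under eq_fun do rewrite mxE.
  apply: continuous_subr; first exact: cst_continuous.
  by apply: continuous_mulr; [move=> ?; exact: cvg_id|exact: cst_continuous].
have cYe : continuous Ye by exact: continuous_rV.
have cbe : continuous be.
  apply: continuous_rV => i; under eq_fun do rewrite mxE.
  apply: continuous_addr; apply: continuous_mulr; try exact: cst_continuous.
    by apply: continuous_subr; [exact: cst_continuous|move=> ?; exact: cvg_id].
  by move=> ?; exact: cvg_id.
have Y0 : Ye 0 = Y by apply/rowP => i; rewrite mxE mul0r subr0.
have be0 : be 0 = b by apply/rowP => i; rewrite mxE subr0 mul1r mul0r addr0.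
have uV : \forall e \near F, [set x : 'rV[R]_n | forall k, `[- M, M]%classic (x 0 k)] (u e).
  apply: filterS nF => e e01 k; have [ix _] := hu e e01.
  have /andP[h1 h2] := ix k; move: e01 => /andP[e0 e1].
  have bd i : `|Ye e 0 i| <= M.
    rewrite mxE; apply: (le_trans (ler_normB _ _)); apply: lerD; first exact: rV_coord_le.
    rewrite normrM normr_nat gtr0_norm// (@le_trans _ _ (1 * i%:R)) ?ler_wpM2r//.
    by rewrite mul1r ler_nat -ltnS.
  rewrite /= in_itv/= (le_trans _ h1) ?(le_trans h2)//=.
    by apply: le_trans (bd _); exact: ler_norm.
  by have := bd (lift ord0 k); rewrite ler_norml => /andP[].
have [x [_ cx]] := @rV_box_compact R n M (u e @[e --> F]) _ uV.
have lim (f : R -> R) : continuous f -> f e @[e --> F] --> f 0.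
  by move=> cf; apply: cvg_at_right_filter; exact: cf.
exists x; split.
  move=> k; apply/andP; split.
    rewrite -lerN2 -Y0.
    apply: (cluster_le (c := fun y : 'rV[R]_n => - y 0 k)
      (f := fun e => - Ye e 0 (lift ord0 k)) cx).
    - have h : continuous (fun y : 'rV[R]_n => y 0 k) by exact: coord_continuous.
      have hh := continuous_oppr h. exact: hh.
    - apply: filterS nF => e e01; rewrite lerN2.
      by have [ix _] := hu e e01; have /andP[] := ix k.
    - apply: (lim (fun e => - Ye e 0 (lift ord0 k))) => e.
      by apply: cvgN; exact: cYi.
  rewrite -Y0.
  apply: (cluster_le (c := fun y : 'rV[R]_n => y 0 k)
      (f := fun e => Ye e 0 (widen_ord (leqnSn n) k)) cx).
  - exact: coord_continuous.
  - apply: filterS nF => e e01.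
    by have [ix _] := hu e e01; have /andP[] := ix k.
  - exact: (lim _ (cYi _)).
have mono := (mix_poly_size_monic Y b1).2.
apply/(exp2_roots_monicP _ mono) => s; apply/esym; rewrite -{1}Y0 -{1}be0.
apply: (cluster_eq (c := fun y : 'rV[R]_n => \prod_k (s - exp2 (y 0 k)))
      (f := fun e => (mix_poly (Ye e) (be e)).[s]) cx).
- exact: continuous_prod_exp2.
- apply: filterS nF => e e01; have [_ rx] := hu e e01.
  apply/esym; apply: (exp2_roots_monicP _ _).1 rx s.
  exact: (mix_poly_size_monic _ _).2.
- by apply: (lim (fun e => (mix_poly (Ye e) (be e)).[s])); exact: continuous_mix_poly.
Unshelve. all: by end_near. Qed.

End Interlacing.

(** * Sorting as a continuous projection *)

Section ChamberProjection.
Variable R : realType.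

Lemma chamber_projP n (X : 'rV[R]_n) : closed_chamber (chamber_proj X) /\
  exists s : 'S_n, chamber_proj X = col_perm s X.
Proof.
apply: (@xgetPex _ 0 [set Y | closed_chamber Y /\ exists s : 'S_n, Y = col_perm s X]).
pose t := [tuple X 0 i | i < n].
have : perm_eq (sort >=%R t) t by rewrite perm_sort.
move=> /tuple_permP[s hs]; exists (col_perm s X); split; last by exists s.
apply/closed_chamberP.
have -> : [seq (col_perm s X) 0 k | k : 'I_n] = sort >=%R t.
  by rewrite hs /=; apply: eq_map => i; rewrite tnth_mktuple mxE.
by apply: sort_sorted => x y; exact: ge_total.
Qed.

Lemma exp2_roots_prod n (X : 'rV[R]_n) :
  exp2_roots_are (\prod_k ('X - (exp2 (X 0 k))%:P)) X.
Proof.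
apply/exp2_roots_monicP => [|t]; first exact: monic_prod_XsubC.
by rewrite horner_prod; apply: eq_bigr => k _; rewrite hornerXsubC.
Qed.

Lemma col_perm_reindex (A : Type) (idx : A) (op : Monoid.com_law idx) n (X : 'rV[R]_n)
    (s : 'S_n) (f : R -> A) :
  \big[op/idx]_k f ((col_perm s X) 0 k) = \big[op/idx]_k f (X 0 k).
Proof.
rewrite [RHS](reindex_inj (@perm_inj _ s)); apply: eq_bigr => k _.
by rewrite mxE.
Qed.

Lemma chamber_proj_reindex (A : Type) (idx : A) (op : Monoid.com_law idx) n (X : 'rV[R]_n)
    (f : R -> A) :
  \big[op/idx]_k f (chamber_proj X 0 k) = \big[op/idx]_k f (X 0 k).
Proof. by have [_ [s ->]] := chamber_projP X; exact: col_perm_reindex. Qed.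

(** Sorting is an instance of root extraction, so its continuity and its identity on the closed
    chamber follow from the results on [log_roots]. *)
Lemma chamber_projE n (X : 'rV[R]_n) :
  chamber_proj X = log_roots n (\prod_k ('X - (exp2 (X 0 k))%:P)).
Proof.
apply/esym; apply: log_roots_eq; first exact: (chamber_projP X).1.
rewrite -(chamber_proj_reindex _ X (fun x => 'X - (exp2 x)%:P)).
exact: exp2_roots_prod.
Qed.

Lemma chamber_proj_id n (X : 'rV[R]_n) : closed_chamber X -> chamber_proj X = X.
Proof.
move=> cX; rewrite chamber_projE; apply: log_roots_eq => //.
exact: exp2_roots_prod.
Qed.

Lemma chamber_proj_norm_le n (X : 'rV[R]_n) k : `|chamber_proj X 0 k| <= \sum_j `|X 0 j|.
Proof.
apply: (le_trans (rV_coord_le _ k)).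
by rewrite (chamber_proj_reindex _ X (fun x => `|x|)).
Qed.

Lemma near_sum_norm (T : topologicalType) n (X : T -> 'rV[R]_n) (t0 : T) :
  continuous X -> \forall t \near t0,
    \sum_j `|X t 0 j| < \sum_j `|X t0 0 j| + 1.
Proof.
move=> cX; have c : continuous (fun t => \sum_j `|X t 0 j|).
  apply: continuous_bigsum => j t; apply: cvg_norm; exact: continuous_coord.
have h : \forall y \near \sum_j `|X t0 0 j|, y < \sum_j `|X t0 0 j| + 1.
  by apply: lt_nbhsl; rewrite ltrDl.
exact (c t0 _ h).
Qed.

Lemma continuous_chamber_proj n : continuous (@chamber_proj R n).
Proof.
suff h (T : topologicalType) (X : T -> 'rV[R]_n) : continuous X ->
    continuous (fun t => log_roots n (\prod_k ('X - (exp2 (X t 0 k))%:P))).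
  have -> : @chamber_proj R n =
      (fun X => log_roots n (\prod_k ('X - (exp2 (X 0 k))%:P))).
    by apply/funext => X; exact: chamber_projE.
  by apply: (h 'rV[R]_n id) => x; exact: cvg_id.
move=> cX; apply: continuous_log_roots.
- by move=> t; exact: monic_prod_XsubC.
- move=> t; exists (chamber_proj (X t)); split; first exact: (chamber_projP _).1.
  rewrite -(chamber_proj_reindex _ (X t) (fun x => 'X - (exp2 x)%:P)).
  exact: exp2_roots_prod.
- move=> s; under eq_fun do rewrite horner_prod.
  apply: continuous_bigprod => k; under eq_fun do rewrite hornerXsubC.
  apply: continuous_subr; first exact: cst_continuous.
  by apply: continuous_exp2; exact: continuous_coord.
- move=> t0; exists (\sum_j `|X t0 0 j| + 1); apply: filterS (near_sum_norm t0 cX).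
  move=> t ht k; apply: le_lt_trans ht; rewrite -chamber_projE.
  exact: chamber_proj_norm_le.
Qed.

End ChamberProjection.

(** * A continuous retraction onto the simplex *)

Section SimplexRetraction.
Variable R : realType.
Implicit Types (r n : nat).

Let pos_sum r (b : 'rV[R]_r.+1) := \sum_j Num.max (b 0 j) 0.

(** Negative entries are cut to 0; then a total below 1 is topped up evenly, and a total above 1 is
    divided out. On the simplex nothing changes, so integrands may be composed with it to become
    continuous everywhere. *)
Definition simplex_retract r (b : 'rV[R]_r.+1) : 'rV[R]_r.+1 :=
  \row_i ((Num.max (b 0 i) 0 + Num.max (1 - pos_sum b) 0 / r.+1%:R) /
          Num.max 1 (pos_sum b)).

Lemma simplex_retractP r (b : 'rV[R]_r.+1) : simplex (simplex_retract b).
Proof.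
have m0 : 0 < Num.max 1 (pos_sum b) by rewrite lt_max ltr01.
split=> [k|].
  have mx (x : R) : 0 <= Num.max x 0 by rewrite le_max lexx orbT.
  by rewrite mxE; apply: divr_ge0; [apply: addr_ge0 => //; exact: divr_ge0|exact: ltW].
under eq_bigr do rewrite mxE.
rewrite -mulr_suml big_split/= sumr_const card_ord -[X in _ + X]mulr_natr divfK ?pnatr_eq0//.
rewrite -/(pos_sum b) (_ : pos_sum b + _ = Num.max 1 (pos_sum b)) ?divff ?gt_eqF//.
by rewrite addr_maxr addrC subrK addr0.
Qed.

Lemma simplex_retract_id r (b : 'rV[R]_r.+1) : simplex b -> simplex_retract b = b.
Proof.
move=> [b0 b1]; have p1 : pos_sum b = 1.
  by rewrite -b1; apply: eq_bigr => j _; rewrite max_l.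
by apply/rowP => i; rewrite mxE p1 subrr maxxx mul0r addr0 maxxx divr1 max_l.
Qed.

Lemma continuous_maxr (T : topologicalType) (f g : T -> R) :
  continuous f -> continuous g -> continuous (fun x => Num.max (f x) (g x)).
Proof. by move=> cf cg x; apply: continuous_max; [exact: cf|exact: cg]. Qed.

Lemma continuous_simplex_retract r : continuous (@simplex_retract r).
Proof.
suff h (T : topologicalType) (b : T -> 'rV[R]_r.+1) : continuous b ->
    continuous (fun t => simplex_retract (b t)).
  by apply: (h 'rV[R]_r.+1 id) => x; exact: cvg_id.
move=> cb; have cs : continuous (fun t => pos_sum (b t)).
  apply: continuous_bigsum => j; apply: continuous_maxr; last exact: cst_continuous.
  exact: continuous_coord.
apply: continuous_rV => i; under eq_fun do rewrite mxE.
apply: continuous_mulr.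
  apply: continuous_addr.
    by apply: continuous_maxr; [exact: continuous_coord|exact: cst_continuous].
  apply: continuous_mulr; last exact: cst_continuous.
  apply: continuous_maxr; last exact: cst_continuous.
  by apply: continuous_subr; [exact: cst_continuous|].
have cm : continuous (fun t => Num.max 1 (pos_sum (b t))).
  by apply: continuous_maxr; [exact: cst_continuous|].
by move=> t; apply: cvgV; [rewrite gt_eqF// lt_max ltr01|exact: cm].
Qed.

Lemma continuous_mix_roots n :
  continuous (fun q : 'rV[R]_n.+1 * 'rV[R]_n.+1 =>
    log_roots n (mix_poly (chamber_proj q.1) (simplex_retract q.2))).
Proof.
suff h (T : topologicalType) (Y b : T -> 'rV[R]_n.+1) : continuous Y -> continuous b ->
    continuous (fun t => log_roots n (mix_poly (chamber_proj (Y t)) (simplex_retract (b t)))).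
  apply: (h ('rV[R]_n.+1 * 'rV[R]_n.+1)%type fst snd) => q; [exact: cvg_fst|exact: cvg_snd].
move=> cY cb.
have sr t := simplex_retractP (b t).
have rootsP t := interlacing_roots (chamber_projP (Y t)).1 (sr t).
have cc t x : interlacing (chamber_proj (Y t)) x -> closed_chamber x.
  by apply: interlacing_closed_chamber; exact: (chamber_projP _).1.
apply: continuous_log_roots.
- by move=> t; exact: (mix_poly_size_monic _ (sr t).2).2.
- by move=> t; have [x [ix rx]] := rootsP t; exists x; split => //; exact: cc ix.
- move=> s; apply: continuous_mix_poly => t.
    apply: (@continuous_comp _ _ _ Y (@chamber_proj R n.+1)); first exact: cY.
    exact: continuous_chamber_proj.
  apply: (@continuous_comp _ _ _ b (@simplex_retract n)); first exact: cb.
  exact: continuous_simplex_retract.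
- move=> t0; exists (\sum_j `|Y t0 0 j| + 1); apply: filterS (near_sum_norm t0 cY).
  move=> t ht k; apply: le_lt_trans ht.
  have [x [ix rx]] := rootsP t; rewrite (log_roots_eq (cc _ _ ix) rx).
  have /andP[h1 h2] := ix k.
  rewrite ler_norml (le_trans _ h1) ?(le_trans h2)//=.
    exact: le_trans (ler_norm _) (chamber_proj_norm_le _ _).
  by have := chamber_proj_norm_le (Y t) (lift ord0 k); rewrite ler_norml => /andP[].
Qed.

End SimplexRetraction.

(** * Spherical functions on the closed chamber *)

Section ChiContinuity.
Variables (R : realType) (m : R[i]).
Hypothesis m0 : 0 < complex.Re m.
Local Notation Re := (@complex.Re R).
Local Notation Im := (@complex.Im R).

Let half_gt0 : 0 < Re (m / 2%:R).
Proof.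
have -> : 2%:R = (2 : R)%:C :> R[i] by rewrite rmorph_nat.
by rewrite -fmorphV cReM/= mulr0 subr0 divr_gt0.
Qed.

(** The candidate for the extension: defined and continuous on the whole space, symmetric through
    [chamber_proj], and equal to [chi_step] on the closed chamber. *)
Definition chi_formula n (lambda : 'rV[R[i]]_n.+1) (f : 'rV[R]_n -> R[i])
    (X : 'rV[R]_n.+1) : R[i] :=
  Gamma (m * n.+1%:R / 2%:R) / Gamma (m / 2%:R) ^+ n.+1
  * cexp ('i%C * lambda 0 ord_max * (\sum_k X 0 k)%:C)
  * dirichlet (fun=> m / 2%:R) (fun b =>
      f (log_roots n (mix_poly (chamber_proj X) (simplex_retract b)))).

Lemma chi_stepE n (lambda : 'rV[R[i]]_n.+1) (f : 'rV[R]_n -> R[i]) X :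
  Ccontinuous f -> closed_chamber X ->
  chi_step m lambda f X = chi_formula lambda f X.
Proof.
move=> cf cX; rewrite /chi_step /chi_formula; congr (_ * _).
pose F b := f (log_roots n (mix_poly (chamber_proj X) (simplex_retract b))).
have cF : Ccontinuous F.
  have cq : continuous (fun b : 'rV[R]_n.+1 => (X, b)).
    by apply: continuous_pair => b; [exact: cst_continuous|exact: cvg_id].
  exact: (Ccontinuous_comp (Ccontinuous_comp cf (@continuous_mix_roots R n)) cq).
rewrite /simplex_integral
  (@scaled_simplex_integralE R n (fun=> m / 2%:R) F _ 1 1 ltr01 (fun=> half_gt0) cF).
  rewrite cpow_1 !mul1r; apply: eq_dirichlet => // g _.
  by rewrite scale1r.
move=> g g0 gs; rewrite mul1r /F chamber_proj_id// simplex_retract_id; last first.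
  by split => // k; exact: ltW.
by congr (_ * _); exact: cpow_prod.
Qed.

Lemma Ccontinuous_chi_formula n (lambda : 'rV[R[i]]_n.+1) (f : 'rV[R]_n -> R[i]) :
  Ccontinuous f -> Ccontinuous (chi_formula lambda f).
Proof.
move=> cf; apply: CcontinuousM.
  apply: CcontinuousM; first exact: Ccontinuous_cst.
  apply: Ccontinuous_cexp; apply: CcontinuousM; first exact: Ccontinuous_cst.
  apply: Ccontinuous_real; apply: (@continuous_bigsum R 'rV[R]_n.+1 _ _ _ (fun k X => X 0 k)) => k.
  exact: coord_continuous.
apply: (@Ccontinuous_dirichlet R _ n _
  (fun q => f (log_roots n (mix_poly (chamber_proj q.1) (simplex_retract q.2))))) => //.
exact: (Ccontinuous_comp cf (@continuous_mix_roots R n)).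
Qed.

(** Subtracting small multiples of the index makes the entries strictly decreasing. This ensures
    that the limit in [chamber_ext] is along a proper filter. *)
Lemma closure_chamber n (Y : 'rV[R]_n) : closed_chamber Y -> closure (@chamber R n) Y.
Proof.
move=> cY; pose Ye (e : R) : 'rV[R]_n := \row_i (Y 0 i - e * i%:R).
have cYe : continuous Ye.
  apply: continuous_rV => i; under eq_fun do rewrite mxE.
  apply: continuous_subr; first exact: cst_continuous.
  by apply: continuous_mulr; [move=> ?; exact: cvg_id|exact: cst_continuous].
have Y0 : Ye 0 = Y by apply/rowP => i; rewrite mxE mul0r subr0.
have lim : Ye e @[e --> 0^'+] --> Y.
  by rewrite -Y0; apply: cvg_at_right_filter; exact: cYe.
move=> B BY; have nB : \forall e \near 0^'+, B (Ye e) by exact (lim _ BY).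
have n0 : \forall e \near (0 : R)^'+, 0 < e by exact: nbhs_right_gt.
have [e [Be e0]] := @filter_ex _ _ (at_right_proper_filter (0 : R)) _ (filterI nB n0).
exists (Ye e); split => // i j ij.
by rewrite !mxE ler_ltB ?ltr_pM2l ?ltr_nat//; exact: cY.
Qed.

Lemma chi_formula_proj n (lambda : 'rV[R[i]]_n.+1) (f : 'rV[R]_n -> R[i]) X :
  chi_formula lambda f (chamber_proj X) = chi_formula lambda f X.
Proof.
rewrite /chi_formula (chamber_proj_id (chamber_projP X).1).
by rewrite (chamber_proj_reindex _ X id).
Qed.

(** Inside the chamber this is [chi_stepE]. On a wall, [chi_step] agrees on the open chamber with
    the continuous [chi_formula], so its limit is the value of the latter. *)
Lemma chamber_ext_chi_step n (lambda : 'rV[R[i]]_n.+1) (f : 'rV[R]_n -> R[i]) X :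
  Ccontinuous f ->
  chamber_ext (chi_step m lambda f) X = chi_formula lambda f X.
Proof.
move=> cf; rewrite -chi_formula_proj /chamber_ext.
have cY := (chamber_projP X).1; set Y := chamber_proj X in cY *.
case: asboolP => [_|_]; first exact: chi_stepE.
have PF : ProperFilter (within (@chamber R n.+1) (nbhs Y)).
  by apply: (@within_nbhs_proper 'rV[R]_n.+1 _ Y); exact: closure_chamber.
have [c1 c2] := Ccontinuous_chi_formula lambda cf.
have near_eq : \forall t \near within (@chamber R n.+1) (nbhs Y),
    chi_formula lambda f t = chi_step m lambda f t.
  apply: (@filterE _ (nbhs Y) (nbhs_filter Y)) => t ct.
  by rewrite chi_stepE// => i j ij; apply: ltW; exact: ct.
apply: complex_ext; apply: cvg_lim => //.
- have : Re (chi_formula lambda f t) @[t --> within (@chamber R n.+1) (nbhs Y)]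
      --> Re (chi_formula lambda f Y).
    exact: cvg_within_filter (c1 Y).
  apply: cvg_trans; apply: near_eq_cvg.
  by apply: filterS near_eq => t ->.
- have : Im (chi_formula lambda f t) @[t --> within (@chamber R n.+1) (nbhs Y)]
      --> Im (chi_formula lambda f Y).
    exact: cvg_within_filter (c2 Y).
  apply: cvg_trans; apply: near_eq_cvg.
  by apply: filterS near_eq => t ->.
Qed.

(** The closed-chamber formula in one more variable requires continuity in one less, so both advance
    together in the induction. *)
Lemma Ccontinuous_chi n (lambda : 'rV[R[i]]_n.+1) : Ccontinuous (chi m lambda).
Proof.
elim: n lambda => [|n IH] lambda.
  apply: Ccontinuous_cexp; apply: CcontinuousM; first exact: Ccontinuous_cst.
  apply: Ccontinuous_sum => k; apply: CcontinuousM; first exact: Ccontinuous_cst.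
  by apply: Ccontinuous_real; exact: coord_continuous.
have -> : chi m lambda = chi_formula lambda (chi m (lambda0 lambda)).
  by apply/funext => X; apply: chamber_ext_chi_step; exact: IH.
by apply: Ccontinuous_chi_formula; exact: IH.
Qed.

Lemma chiE n (lambda : 'rV[R[i]]_n.+2) X :
  chi m lambda X = chi_formula lambda (chi m (lambda0 lambda)) X.
Proof. exact: (chamber_ext_chi_step _ _ (Ccontinuous_chi _)). Qed.

End ChiContinuity.

(** * Repeated entries *)

Section Blocks.
Variables (R : realType) (n r : nat).
Variables (Y : 'rV[R]_n.+1) (a : 'rV[R]_r.+1) (p : 'I_n.+1 -> 'I_r.+1).
Variable nn : 'I_r.+1 -> nat.
Hypothesis a_decr : forall i j : 'I_r.+1, (i < j)%N -> a 0 j < a 0 i.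
Hypothesis YE : forall k, Y 0 k = a 0 (p k).
Hypothesis pm : {homo p : k l / (k <= l)%N}.
Hypothesis ps : forall i, exists k, p k = i.
Hypothesis nnE : forall i, nn i = #|[set k | p k == i]%SET|.

Let c (j : 'I_r.+1) : {poly R} := 'X - (exp2 (a 0 j))%:P.
Let M : {poly R} := \prod_j c j ^+ (nn j).-1.

Lemma block_gt0 i : (0 < nn i)%N.
Proof.
by rewrite nnE; apply/card_gt0P; have [k ki] := ps i; exists k; rewrite inE ki.
Qed.

Lemma mult_polyE g : mult_poly a nn g = M * mix_poly a g.
Proof. by []. Qed.

Lemma mix_poly_collapse (b : 'rV[R]_n.+1) :
  mix_poly Y b = mult_poly a nn (collapseV p b).
Proof.
have key k : \prod_(l | l != k) ('X - (exp2 (Y 0 l))%:P) =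
    M * \prod_(j | j != p k) c j.
  rewrite (partition_big p xpredT)//= [X in M * X]big_mkcond -big_split/=.
  apply: eq_bigr => j _.
  have -> : \prod_(l | (l != k) && (p l == j)) ('X - (exp2 (Y 0 l))%:P) =
      \prod_(l | (l != k) && (p l == j)) c j.
    by apply: eq_bigr => l /andP[_ /eqP <-]; rewrite YE.
  rewrite prodr_const; have nj := block_gt0 j.
  have [->|jk] := eqVneq j (p k).
    rewrite mulr1; congr (_ ^+ _); rewrite nnE (cardsD1 k) inE eqxx add1n /=.
    by rewrite -cardsE; apply: eq_card => l; rewrite !inE.
  rewrite -exprSr prednK// nnE -cardsE; congr (_ ^+ _); apply: eq_card => l.
  rewrite !inE unfold_in; have [->|//] := eqVneq l k.
  by rewrite [p k == j]eq_sym (negbTE jk).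
rewrite mult_polyE {1}/mix_poly (partition_big p xpredT)//= mulr_sumr.
apply: eq_bigr => i _; rewrite mxE /collapse scaler_suml mulr_sumr.
by apply: eq_bigr => k /eqP <-; rewrite -scalerAr -key.
Qed.

(** A continuous section of [collapseV], sharing each block weight equally. It transports facts
    about simplex weights on positions to weights on blocks. *)
Definition spread (g : 'rV[R]_r.+1) : 'rV[R]_n.+1 :=
  \row_k (g 0 (p k) / (nn (p k))%:R).

Lemma spreadK g : collapseV p (spread g) = g.
Proof.
apply/rowP => i; rewrite mxE /collapse.
rewrite (eq_bigr (fun=> g 0 i / (nn i)%:R)); last by move=> k /eqP <-; rewrite mxE.
rewrite sumr_const -cardsE -nnE -[LHS]mulr_natr divfK// pnatr_eq0 -lt0n.
exact: block_gt0.
Qed.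

Lemma simplex_spread g : simplex g -> simplex (spread g).
Proof.
move=> [g0 g1]; split=> [k|]; first by rewrite mxE divr_ge0.
rewrite -g1 -[in RHS](spreadK g); under [RHS]eq_bigr do rewrite mxE.
by rewrite sum_collapse.
Qed.

Lemma simplex_collapseV (b : 'rV[R]_n.+1) : simplex b -> simplex (collapseV p b).
Proof.
move=> [b0 b1]; split=> [i|].
  by rewrite mxE sumr_ge0.
by under eq_bigr do rewrite mxE; rewrite sum_collapse.
Qed.

Lemma continuous_spread : continuous spread.
Proof.
apply: continuous_rV => k; under eq_fun do rewrite mxE.
apply: (@continuous_mulr R 'rV[R]_r.+1 (fun g => g 0 (p k)) (fun=> (nn (p k))%:R^-1)).
  exact: coord_continuous.
exact: cst_continuous.
Qed.

Lemma blocks_closed_chamber : closed_chamber Y.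
Proof.
move=> k l kl; rewrite !YE; have := pm (ltnW kl).
by rewrite leq_eqVlt => /orP[/eqP/val_inj ->//|/a_decr/ltW].
Qed.

(** For locating block boundaries: applied to the indices whose block precedes [i], it makes the
    partial sum the threshold between them and the others. *)
Lemma downset_card N (P : pred 'I_N) : (forall k l : 'I_N, (l <= k)%N -> P k -> P l) ->
  forall k, P k = (k < #|P|)%N.
Proof.
move=> dP k; apply/idP/idP => [Pk|].
  rewrite -[X in (X < _)%N]card_ord -ltnS.
  pose f (i : 'I_k.+1) : 'I_N := widen_ord (ltn_ord k) i.
  have fi : injective f by move=> i j /(congr1 val) /= ij; exact: val_inj.
  rewrite ltnS -[X in (X <= _)%N]/(#|'I_k|.+1) card_ord -[X in (X <= _)%N]card_ord.
  rewrite -(card_imset _ fi); apply: subset_leq_card; apply/fintype.subsetP => _ /imsetP[i _ ->].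
  by apply: dP Pk; rewrite -ltnS /= ltn_ord.
apply: contraTT => nPk; rewrite -leqNgt.
pose f (i : 'I_k) : 'I_N := widen_ord (ltnW (ltn_ord k)) i.
rewrite -[X in (_ <= X)%N]card_ord -[X in (_ <= X)%N]cardsT.
apply: leq_trans (leq_imset_card f _); apply: subset_leq_card; apply/fintype.subsetP => l Pl.
have lk : (l < k)%N by rewrite ltnNge; apply: contra nPk => kl; exact: dP kl Pl.
by apply/imsetP; exists (Ordinal lk) => //; exact: val_inj.
Qed.

Lemma block_lt (i : nat) (k : 'I_n.+1) : (k < partial_sum nn i)%N = (p k < i)%N.
Proof.
have -> : partial_sum nn i = #|[pred l | (p l < i)%N]|.
  rewrite /partial_sum -sum1_card (partition_big p (fun j : 'I_r.+1 => (j < i)%N))//=.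
  apply: eq_bigr => j ji; rewrite nnE -sum1dep_card; apply: eq_bigl => l.
  by rewrite inE; case: eqVneq => [->|]; rewrite ?ji ?andbF.
rewrite -(downset_card (P := [pred l | (p l < i)%N]))// => l l' /= ll'.
by apply: leq_ltn_trans; exact: pm.
Qed.

Lemma in_block (i : 'I_r.+1) (k : 'I_n.+1) :
  (partial_sum nn i <= k < partial_sum nn i.+1)%N = (p k == i).
Proof. by rewrite block_lt leqNgt block_lt -leqNgt ltnS -eqn_leq eq_sym. Qed.

(** [wd k] and [nx k] are the positions in [Y] that bound the k-th interlacing root from above and
    from below. *)
Let wd (k : 'I_n) : 'I_n.+1 := widen_ord (leqnSn n) k.
Let nx (k : 'I_n) : 'I_n.+1 := lift ord0 k.

Lemma p0 : p ord0 = ord0.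
Proof.
have [k k0] := ps ord0; apply: val_inj; apply/eqP; rewrite /= -leqn0.
by have := @pm ord0 k (leq0n _); rewrite k0.
Qed.

(** Counting from 0, the position just before a partial sum is the last of its block. The next one
    is in a later block, and surjectivity forbids skipping any. *)
Lemma jump_succ (k : 'I_n) (i : 'I_r) : k.+1 = partial_sum nn i.+1 ->
  p (wd k) = widen_ord (leqnSn r) i /\ p (nx k) = lift ord0 i.
Proof.
move=> kN.
have h1 : (p (wd k) < i.+1)%N by rewrite -block_lt -kN.
have h2 : (i.+1 <= p (nx k))%N by rewrite leqNgt -block_lt -kN /= /bump/= add1n ltnn.
have [l lE] := ps (widen_ord (leqnSn r) i).
have [l' lE'] := ps (lift ord0 i).
split; apply: val_inj; apply/eqP; rewrite /= eqn_leq.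
  rewrite -ltnS h1/= leqNgt; apply/negP => h3.
  have kl : (k < l)%N.
    by rewrite ltnNge; apply/negP => lk; have := @pm l (wd k) lk; rewrite lE /= leqNgt h3.
  have := @pm (nx k) l; rewrite /= {1}/bump/= add1n => /(_ kl); rewrite lE /=.
  by move=> /(leq_trans h2); rewrite ltnn.
rewrite {2}/bump/= add1n h2 andbT /bump/= add1n leqNgt; apply/negP => h3.
have kl : (l' <= k)%N.
  rewrite leqNgt; apply/negP => kl; have := @pm (nx k) l'; rewrite /= {1}/bump/= add1n => /(_ kl).
  by rewrite lE' /= /bump/= add1n leqNgt h3.
have := @pm l' (wd k) kl; rewrite lE' /= {1}/bump/= add1n => /leq_ltn_trans/(_ h1).
by rewrite ltnn.
Qed.

Lemma jump_exists (i : 'I_r) : exists k : 'I_n, k.+1 = partial_sum nn i.+1.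
Proof.
have h1 : (0 < partial_sum nn i.+1)%N by rewrite (block_lt _ ord0) p0.
have h2 : (partial_sum nn i.+1 <= n)%N.
  rewrite leqNgt -[X in (X < _)%N]/(nat_of_ord (@ord_max n)) block_lt -leqNgt.
  have [l lE] := ps ord_max.
  have := @pm l ord_max (leq_ord _); rewrite lE /=; exact: leq_trans.
have kn : ((partial_sum nn i.+1).-1 < n)%N by rewrite prednK.
by exists (Ordinal kn); rewrite /= prednK.
Qed.

Let kk (i : 'I_r) : 'I_n := projT1 (cid (jump_exists i)).
Let kkE i : (kk i).+1 = partial_sum nn i.+1.
Proof. by rewrite /kk; case: cid. Qed.

(** At these indices both bounds coincide, so interlacing pins the root; the remaining indices are
    the jumps [kk i], where the roots [eta] sit. *)
Let same (k : 'I_n) := p (wd k) == p (nx k).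

Lemma jump_reindex (A : Type) (idx : A) (op : Monoid.com_law idx) (F : 'I_n -> A) :
  \big[op/idx]_(k | ~~ same k) F k = \big[op/idx]_i F (kk i).
Proof.
have kinj : injective kk.
  move=> i j ij; have [+ _] := jump_succ (kkE i); have [+ _] := jump_succ (kkE j).
  by rewrite ij => -> /(congr1 val) /= ji; apply: val_inj.
transitivity (\big[op/idx]_(k in [set kk i | i in 'I_r]%SET) F k); last first.
  by rewrite big_imset//= => i j _ _; exact: kinj.
apply: eq_bigl => k.
apply/idP/imsetP => [nk|[i _ ->]].
  have h1 : (p (wd k) <= p (nx k))%N by apply: pm; rewrite /= /bump/= add1n.
  have h2 : (p (wd k) < p (nx k))%N by rewrite ltn_neqAle h1 andbT.
  have ir : (p (wd k) < r)%N by rewrite -ltnS (leq_trans _ (ltn_ord (p (nx k)))).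
  exists (Ordinal ir) => //; apply: val_inj; apply: succn_inj; rewrite kkE /=.
  apply/eqP; rewrite eqn_leq; apply/andP; split.
    by have := block_lt (p (wd k)).+1 (wd k); rewrite ltnSn /= => ->.
  rewrite leqNgt; have := block_lt (p (wd k)).+1 (nx k).
  by rewrite /= {1}/bump/= add1n => ->; rewrite -leqNgt.
have [h1 h2] := jump_succ (kkE i).
by rewrite /same h1 h2 -val_eqE /= /bump/= add1n neq_ltn ltnSn.
Qed.

(** Position 0 and the successors of the jumps are the first positions of the blocks, one for each;
    the other members of a block are counted by [same]. *)
Lemma card_same j : #|[pred k | same k & p (nx k) == j]| = (nn j).-1.
Proof.
have nj := block_gt0 j; apply: succn_inj; rewrite prednK//.
have -> : nn j = (\sum_k (p k == j))%N.
  by rewrite nnE -sum1dep_card big_mkcond; apply: eq_bigr => k _; case: eqP.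
rewrite big_ord_recl (bigID same)/= addnCA (jump_reindex _ (fun k => nat_of_bool (p (nx k) == j))).
have -> : ((p ord0 == j) + \sum_i (p (nx (kk i)) == j) = 1)%N.
  transitivity (\sum_(i < r.+1) (i == j))%N.
    rewrite big_ord_recl p0; congr (_ + _)%N; apply: eq_bigr => i _.
    by rewrite (jump_succ (kkE i)).2.
  rewrite (bigD1 j)//= eqxx big1// => i /negbTE ->.
  by [].
rewrite addn1 -sum1_card; congr _.+1.
rewrite [RHS]big_mkcond [LHS]big_mkcond; apply: eq_bigr => k _ /=.
by rewrite inE; case: (same k) => //=; case: (_ == _).
Qed.

Lemma interlacing_blocks (x : 'rV[R]_n) : interlacing Y x ->
  \prod_k ('X - (exp2 (x 0 k))%:P) =
  M * \prod_i ('X - (exp2 (x 0 (kk i)))%:P).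
Proof.
move=> ix; rewrite (bigID same)/= (jump_reindex _ (fun k => 'X - (exp2 (x 0 k))%:P)).
congr (_ * _).
rewrite (partition_big (fun k => p (nx k)) xpredT)//=; apply: eq_bigr => j _.
rewrite (eq_bigr (fun=> c j)).
  by rewrite prodr_const; congr (_ ^+ _); rewrite -(card_same j); apply: eq_card.
move=> k /andP[/eqP sk /eqP pj].
have /andP[] := ix k; rewrite -/(wd k) -/(nx k) !YE sk pj => h1 h2.
by congr ('X - (exp2 _)%:P); apply/eqP; rewrite eq_le h1 h2.
Qed.

Lemma log_roots_blocks g : simplex g ->
  let x := log_roots n (mult_poly a nn g) in
  [/\ closed_chamber x, exp2_roots_are (mult_poly a nn g) x, interlacing Y x &
    exists eta : 'rV[R]_r,
      [/\ (forall (i : 'I_r.+1) (k : 'I_n),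
             (partial_sum nn i <= k)%N ->
             (k.+1 < partial_sum nn i.+1)%N -> x 0 k = a 0 i),
          (forall (i : 'I_r) (k : 'I_n),
             k.+1 = partial_sum nn i.+1 -> x 0 k = eta 0 i),
          (forall i : 'I_r,
             a 0 (lift ord0 i) <= eta 0 i <= a 0 (widen_ord (leqnSn r) i))
        & exp2_roots_are (mix_poly a g) eta]].
Proof.
move=> sg x0.
have gE : mult_poly a nn g = mix_poly Y (spread g).
  by rewrite mix_poly_collapse spreadK.
have [x [ix rx]] := interlacing_roots blocks_closed_chamber (simplex_spread sg).
have cx := interlacing_closed_chamber blocks_closed_chamber ix.
have -> : x0 = x by rewrite /x0 gE; exact: log_roots_eq.
split => //; first by rewrite gE.
exists (\row_i x 0 (kk i)); split.
(* With indices from 0 the hypotheses say that [k] and [k + 1] both lie in block [i], so the two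
   interlacing bounds are equal. *)
- move=> i k h1 h2.
  have pw : p (wd k) = i by apply/eqP; rewrite -in_block h1/= ltnW.
  have pn : p (nx k) = i.
    by apply/eqP; rewrite -in_block /= /bump/= add1n h2 andbT (leq_trans h1).
  have /andP[] := ix k; rewrite -/(wd k) -/(nx k) !YE pw pn => h3 h4.
  by apply/eqP; rewrite eq_le h3 h4.
- move=> i k kN; rewrite mxE; congr (x 0 _); apply: val_inj.
  by apply: succn_inj; rewrite kkE kN.
- move=> i; rewrite mxE; have := ix (kk i).
  by rewrite -/(wd _) -/(nx _) !YE (jump_succ (kkE i)).1 (jump_succ (kkE i)).2.
- have [p1 p2] := rx.
  have mo := (mix_poly_size_monic Y (simplex_spread sg).2).2.
  have M0 : M != 0.
    by apply/prodf_neq0 => j _; rewrite expf_neq0// polyXsubC_eq0.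
  (* The pinned roots account exactly for [M]; cancelling it leaves the polynomial of the free
     roots. *)
  have e : mix_poly a g = \prod_i ('X - (exp2 (x 0 (kk i)))%:P).
    apply: (mulfI M0); rewrite -interlacing_blocks// -mult_polyE gE p2.
    by rewrite (monicP mo) scale1r.
  rewrite e /exp2_roots_are; have := exp2_roots_prod (\row_i x 0 (kk i)).
  by under eq_bigr do rewrite mxE.
Qed.

End Blocks.

(** Lagrange interpolation: at a node only the corresponding summand survives, which gives its
    weight. Conversely two monic polynomials of degree [r] agreeing at the [r + 1] distinct nodes
    are equal. *)
Lemma mix_poly_weightsP (R : realType) (r : nat) (a g : 'rV[R]_r.+1) (eta : 'rV[R]_r) :
  (forall i j : 'I_r.+1, (i < j)%N -> a 0 j < a 0 i) -> \sum_k g 0 k = 1 ->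
  exp2_roots_are (mix_poly a g) eta <->
  (forall p : 'I_r.+1,
     g 0 p = (\prod_(j < r) (exp2 (eta 0 j) - exp2 (a 0 p)))
             / \prod_(j < r.+1 | j != p) (exp2 (a 0 j) - exp2 (a 0 p))).
Proof.
move=> ad g1.
have [sm mm] := mix_poly_size_monic a g1.
have neq (i j : 'I_r.+1) : i != j -> exp2 (a 0 i) != exp2 (a 0 j).
  rewrite -val_eqE neq_ltn (inj_eq (@exp2_inj R)) => /orP[/ad|/ad] h.
    by rewrite gt_eqF.
  by rewrite lt_eqF.
have D0 q : \prod_(j < r.+1 | j != q) (exp2 (a 0 q) - exp2 (a 0 j)) != 0.
  by apply/prodf_neq0 => j jq; rewrite subr_eq0 neq// eq_sym.
(* Numerator and denominator have [r] factors each, so reversing all the differences changes both by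
   the same sign. *)
have flip q : (\prod_(j < r) (exp2 (eta 0 j) - exp2 (a 0 q)))
             / \prod_(j < r.+1 | j != q) (exp2 (a 0 j) - exp2 (a 0 q)) =
    (\prod_(j < r) (exp2 (a 0 q) - exp2 (eta 0 j)))
             / \prod_(j < r.+1 | j != q) (exp2 (a 0 q) - exp2 (a 0 j)).
  under [in LHS]eq_bigr do rewrite -opprB.
  under [in X in _ / X = _]eq_bigr do rewrite -opprB.
  rewrite !prodrN card_ord cardC1 card_ord /= -mulf_div divff ?mul1r//.
  by rewrite signr_eq0.
rewrite exp2_roots_monicP//; split => [h q|h].
  rewrite flip -h horner_mix_poly_node mulfK//.
have h' q : (mix_poly a g).[exp2 (a 0 q)] = (\prod_k ('X - (exp2 (eta 0 k))%:P)).[exp2 (a 0 q)].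
  rewrite horner_mix_poly_node h flip divfK// horner_prod.
  by apply: eq_bigr => k _; rewrite hornerXsubC.
suff -> : mix_poly a g = \prod_k ('X - (exp2 (eta 0 k))%:P).
  by move=> t; rewrite horner_prod; apply: eq_bigr => k _; rewrite hornerXsubC.
apply/eqP; rewrite -subr_eq0; set d := _ - _; apply: contraT => d0.
have sq : size (\prod_(k < r) ('X - (exp2 (eta 0 k))%:P)) = r.+1.
  by rewrite size_prod_XsubC /index_enum -enumT size_enum_ord.
have dr : d`_r = 0.
  have := monicP mm; have := lead_coef_prod_XsubC (index_enum 'I_r) xpredT (fun k => exp2 (eta 0 k)).
  by rewrite /lead_coef sm sq /= coefB => -> ->; rewrite subrr.
have sd : (size d <= r)%N.
  apply/leq_sizeP => j; rewrite leq_eqVlt => /orP[/eqP <-//|rj].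
  by rewrite coefB !nth_default ?subrr ?sm ?sq.
have := @max_poly_roots _ d [seq exp2 (a 0 q) | q : 'I_r.+1] d0.
rewrite size_map size_enum_ord ltnNge (leq_trans sd)//=; apply.
  by apply/allP => _ /mapP[q _ ->]; rewrite /root hornerD hornerN h' subrr.
rewrite map_inj_uniq ?enum_uniq// => i j ij; apply/eqP; apply: contraT => /neq.
by rewrite ij eqxx.
Qed.

Lemma div_swap (K : fieldType) (x e G P D D' : K) :
  G != 0 -> P != 0 -> P * D = G * D' -> x / G * e * D = x / P * e * D'.
Proof.
move=> G0 P0 E; have -> : D = G * D' / P by rewrite -E mulrC mulKf.
by field; rewrite P0.
Qed.

(** The integrand factors through the block sums only on the simplex, since the retraction need not
    be compatible with collapsing elsewhere. *)
Lemma dirichlet_collapse_ext (R : realType) n r (p : 'I_n.+1 -> 'I_r.+1)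
    (al : 'I_n.+1 -> R[i]) (F : 'rV[R]_r.+1 -> R[i]) (L : 'rV[R]_n.+1 -> R[i]) :
  {homo p : k l / (k <= l)%N} -> (forall i, exists k, p k = i) ->
  (forall k, 0 < complex.Re (al k)) -> Ccontinuous F ->
  (forall b, simplex b -> L b = F (collapseV p b)) ->
  (\prod_i Gamma (collapse p al i)) * dirichlet al L =
  (\prod_k Gamma (al k)) * dirichlet (collapse p al) F.
Proof.
move=> pm ps al0 cF LE; apply: etrans (dirichlet_collapse pm ps al0 cF).
by congr (_ * _); apply: eq_dirichlet; [exact: frefl|exact: LE].
Qed.

Lemma chi_blocks (R : realType) (m : R[i]) (n r : nat) (lambda : 'rV[R[i]]_n.+2)
    (X : 'rV[R]_n.+2) (a : 'rV[R]_r.+1) (p : 'I_n.+2 -> 'I_r.+1) (nn : 'I_r.+1 -> nat) :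
  0 < complex.Re m ->
  (forall i j : 'I_r.+1, (i < j)%N -> a 0 j < a 0 i) ->
  (forall k, chamber_proj X 0 k = a 0 (p k)) ->
  {homo p : k l / (k <= l)%N} -> (forall i, exists k, p k = i) ->
  (forall i, nn i = #|[set k | p k == i]%SET|) ->
  chi m lambda X =
    Gamma (m * n.+2%:R / 2%:R) / \prod_(i < r.+1) Gamma (m * (nn i)%:R / 2%:R)
    * cexp ('i%C * lambda 0 ord_max * (\sum_(k < r.+1) (nn k)%:R * a 0 k)%:C)
    * simplex_integral (fun g : 'rV[R]_r.+1 =>
        chi m (lambda0 lambda) (log_roots n.+1 (mult_poly a nn g))
        * \prod_(i < r.+1) cpow (g 0 i) (m * (nn i)%:R / 2%:R - 1)).
Proof.
move=> m0 ad XE pm ps nnE; rewrite chiE// /chi_formula.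
set f := chi m (lambda0 lambda); set Y := chamber_proj X.
have cf : Ccontinuous f by exact: Ccontinuous_chi.
have al0 : 0 < complex.Re (m / 2%:R).
  have -> : 2%:R = (2 : R)%:C :> R[i] by rewrite rmorph_nat.
  by rewrite -fmorphV cReM/= mulr0 subr0 divr_gt0.
pose al : 'I_n.+2 -> R[i] := fun=> m / 2%:R.
pose L (b : 'rV[R]_n.+2) := f (log_roots n.+1 (mix_poly Y (simplex_retract b))).
(* Going through [spread], rather than through the roots of [mult_poly], makes [F] inherit the
   continuity of [L]. *)
pose F g := L (spread p nn g).
have cL : Ccontinuous L.
  have cq : continuous (fun b : 'rV[R]_n.+2 => (X, b)).
    by apply: continuous_pair => b; [exact: cst_continuous|exact: cvg_id].
  exact: (Ccontinuous_comp (Ccontinuous_comp cf (@continuous_mix_roots R n.+1)) cq).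
have cF : Ccontinuous F by apply: (Ccontinuous_comp cL); exact: continuous_spread.
have FE g : simplex g -> F g = f (log_roots n.+1 (mult_poly a nn g)).
  move=> sg; rewrite /F /L simplex_retract_id; last exact: (simplex_spread ps nnE).
  by rewrite (mix_poly_collapse XE ps nnE) (spreadK ps nnE).
have LE b : simplex b -> L b = F (collapseV p b).
  move=> sb; rewrite FE; last exact: simplex_collapseV.
  by rewrite /L (simplex_retract_id sb) (mix_poly_collapse XE ps nnE).
have colE i : collapse p al i = m * (nn i)%:R / 2%:R.
  by rewrite /collapse sumr_const -cardsE -nnE (mulrAC m) (mulr_natr (m / 2%:R)).
have col0 i : 0 < complex.Re (collapse p al i).
  rewrite /collapse cRe_sum; have [k ki] := ps i.
  by rewrite (bigD1 k) ?ki//= ltr_wpDr// sumr_ge0// => l _; exact: ltW.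
have -> : \sum_k X 0 k = \sum_(k < r.+1) (nn k)%:R * a 0 k.
  rewrite -(chamber_proj_reindex _ X id) (partition_big p xpredT)//=.
  apply: eq_bigr => i _; rewrite (eq_bigr (fun=> a 0 i)); last first.
    by move=> k /eqP <-; exact: XE.
  by rewrite sumr_const -cardsE -nnE mulr_natl.
have -> : simplex_integral (fun g : 'rV[R]_r.+1 =>
    f (log_roots n.+1 (mult_poly a nn g))
    * \prod_(i < r.+1) cpow (g 0 i) (m * (nn i)%:R / 2%:R - 1))
    = dirichlet (collapse p al) F.
  rewrite /simplex_integral (@scaled_simplex_integralE R r (collapse p al) F _ 1 1 ltr01 col0 cF).
    rewrite cpow_1 !mul1r; apply: eq_dirichlet; first exact: frefl.
    by move=> g _; rewrite scale1r.
  move=> g g0 gs; have sg : simplex g := conj (fun k => ltW (g0 k)) gs.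
  rewrite mul1r -(FE g sg).
  rewrite (eq_bigr (fun i => cpow (g 0 i) (collapse p al i - 1))) => [//|i _].
  by rewrite colE.
have PE : \prod_i Gamma (collapse p al i) = \prod_(i < r.+1) Gamma (m * (nn i)%:R / 2%:R).
  by apply: eq_bigr => i _; rewrite colE.
have PA : \prod_k Gamma (al k) = Gamma (m / 2%:R) ^+ n.+2 by rewrite /al prodr_const card_ord.
have := @dirichlet_collapse_ext R n.+1 r p al F L pm ps (fun k => al0 : 0 < complex.Re (al k)) cF LE.
rewrite PE PA => E.
have G0 : Gamma (m / 2%:R) ^+ n.+2 != 0 by rewrite expf_neq0// Gamma_neq0.
have P0 : \prod_(i < r.+1) Gamma (m * (nn i)%:R / 2%:R) != 0.
  by apply/prodf_neq0 => i _; rewrite -colE Gamma_neq0.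
exact: div_swap G0 P0 E.
Qed.

Theorem theorem2p2 (R : realType) (n : nat) (m : R[i])
    (lambda : 'rV[R[i]]_n.+1) (X : 'rV[R]_n.+1)
    (r : nat) (a : 'rV[R]_r.+1) (nn : 'I_r.+1 -> nat) :
  (2 <= n.+1)%N ->
  0 < complex.Re m ->
  (* a lists the distinct entries of X in decreasing order, nn their
     multiplicities *)
  (forall i j : 'I_r.+1, (i < j)%N -> a 0 j < a 0 i) ->
  (forall c : R, (exists k, X 0 k = c) <-> (exists i, a 0 i = c)) ->
  (forall i, nn i = #|[set k | X 0 k == a 0 i]%SET|) ->
  [/\ (forall (i : 'I_r.+1) (k : 'I_n.+1),
         (partial_sum nn i <= k < partial_sum nn i.+1)%N ->
         chamber_proj X 0 k = a 0 i),
      chi m lambda X =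
        Gamma (m * n.+1%:R / 2%:R)
          / \prod_(i < r.+1) Gamma (m * (nn i)%:R / 2%:R)
        * cexp ('i%C * lambda 0 ord_max
                * (\sum_(k < r.+1) (nn k)%:R * a 0 k)%:C)
        * simplex_integral (fun g : 'rV[R]_r.+1 =>
            chi m (lambda0 lambda) (log_roots n (mult_poly a nn g))
            * \prod_(i < r.+1) cpow (g 0 i) (m * (nn i)%:R / 2%:R - 1)),
      (forall g : 'rV[R]_r.+1, simplex g ->
         let xi := log_roots n (mult_poly a nn g) in
         (forall xi' : 'rV[R]_n,
            closed_chamber xi' /\ exp2_roots_are (mult_poly a nn g) xi'
            <-> xi' = xi) /\
         interlacing (chamber_proj X) xi /\
         exists eta : 'rV[R]_r,
           [/\ (forall (i : 'I_r.+1) (k : 'I_n),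
                  (partial_sum nn i <= k)%N ->
                  (k.+1 < partial_sum nn i.+1)%N -> xi 0 k = a 0 i),
               (forall (i : 'I_r) (k : 'I_n),
                  k.+1 = partial_sum nn i.+1 -> xi 0 k = eta 0 i),
               (forall i : 'I_r,
                  a 0 (lift ord0 i) <= eta 0 i
                                    <= a 0 (widen_ord (leqnSn r) i))
             & exp2_roots_are (mix_poly a g) eta])
    & (forall (g : 'rV[R]_r.+1) (eta : 'rV[R]_r), simplex g ->
         exp2_roots_are (mix_poly a g) eta <->
         (forall p : 'I_r.+1,
            g 0 p = (\prod_(j < r) (expR (2 * eta 0 j) - expR (2 * a 0 p)))
                    / \prod_(j < r.+1 | j != p)
                        (expR (2 * a 0 j) - expR (2 * a 0 p))))].
Proof.
move=> n2 m0 ad hc nnE; case: n lambda X n2 hc nnE => [//|n] lambda X _ hc nnE.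
set Y := chamber_proj X.
have [cY [s Ys]] := chamber_projP X.
have hp k : exists i, Y 0 k = a 0 i.
  have [i ai] : exists i, a 0 i = Y 0 k.
    by apply/hc; exists (s k); rewrite /Y Ys mxE.
  by exists i.
have [p pE] := choice hp.
have a_inj i j : a 0 i = a 0 j -> i = j.
  move=> e; apply: val_inj; case: (ltngtP i j) => // /ad; by rewrite e ltxx.
have pm : {homo p : k l / (k <= l)%N}.
  move=> k l; rewrite leq_eqVlt => /orP[/eqP/val_inj ->//|kl].
  rewrite leqNgt; apply/negP => /ad; rewrite -!pE ltNge.
  by move/negP; apply; exact: cY.
have ps i : exists k, p k = i.
  have [k ki] : exists k, X 0 k = a 0 i by apply/hc; exists i.
  exists ((s^-1)%g k); apply: a_inj; rewrite -pE -ki /Y Ys mxE.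
  by rewrite permKV.
(* Multiplicities are given for [X] while the blocks live on its sorted copy; a count is a sum over
   entries, hence invariant under the permutation. *)
have nnE' i : nn i = #|[set k | p k == i]%SET|.
  rewrite nnE -!sum1dep_card big_mkcond [RHS]big_mkcond.
  rewrite -(chamber_proj_reindex _ X (fun x => if x == a 0 i then 1%N else 0%N)).
  apply: eq_bigr => k _; rewrite -/Y pE.
  by case: (eqVneq (p k) i) => [->|pi]; rewrite ?eqxx//; case: eqP => // /a_inj/eqP; rewrite (negbTE pi).
split.
- by move=> i k; rewrite (in_block pm nnE') -/Y pE => /eqP ->.
- exact: (chi_blocks _ m0 ad pE pm ps nnE').
- move=> g sg /=; have [h1 h2 h3 h4] := log_roots_blocks ad pE pm ps nnE' sg.
  split=> [xi'|]; last by split.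
  split=> [[c1 c2]|-> //]; exact: exp2_roots_inj c2 h2.
- by move=> g eta [_ g1]; exact: mix_poly_weightsP.
Qed.
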